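(* Let $f$ be a transcendental entire function with a multiply connected wandering domain $U$ and let $z_0 \in U$. Then $$h(z) = \lim_{n\to \infty} \frac{\log |f^n(z)|}{\log |f^n(z_0)|}$$ defines a non-constant positive harmonic function $h: U \to \mathbb{R}$, with $h(z_0)=1$.
   Context: A transcendental entire function is an entire function $f:\mathbb{C}\to\mathbb{C}$ that is not a polynomial; $f^n$ denotes its $n$-th iterate, and $\mathbb{N}=\{1,2,\dots\}$. The Fatou set $F(f)$ is the set of points of $\mathbb{C}$ having a neighbourhood on which the iterates $f^n$ form a normal family (locally uniform convergence to $\infty$ being allowed). A Fatou component is a connected component of $F(f)$. For a Fatou component $U$, $U_n$ denotes the Fatou component containing $f^n(U)$, with $U_0=U$; $U$ is a wandering domain if the sequence $(U_n)$ is not eventually periodic. A domain is multiply connected if it is not simply connected. By results of Baker, if $U$ is a multiply connected wandering domain then each $U_n$ is bounded and multiply connected, $U_n=f^n(U)$, for all large $n$ both $U_n$ and $0$ lie in a bounded complementary component of $U_{n+1}$, and $\mathrm{dist}(U_n,0)\to\infty$ as $n\to\infty$; in particular the quotient above is defined for all large $n$. *)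

(* Defs.v *)
From mathcomp Require Import all_boot all_order all_algebra.
From mathcomp Require Import complex.
From mathcomp Require Import all_classical all_reals all_analysis.
Import numFieldNormedType.Exports.

Set Implicit Arguments.
Unset Strict Implicit.
Unset Printing Implicit Defensive.

Import Order.TTheory GRing.Theory Num.Theory.
Local Open Scope classical_set_scope.
Local Open Scope ring_scope.

(* [R[i]] has no declared topology; seen as a [numFieldType] it gets the usual
   one from its norm, and is a normed module over itself, so that [derivable]
   at direction 1 is complex differentiability. *)
Definition Cx (R : realType) : numFieldType := R[i].

Section Defs.
Context {R : realType}.
Local Notation C := (Cx R).

(* The modulus with values in [R]; the library's [`|z|] lives in [R[i]]. *)
Definition modulus (z : C) : R := complex.Re (`|z| : R[i]).

Definition entire (f : C -> C) := forall z, derivable f z 1.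

Definition transcendental_entire (f : C -> C) :=
  entire f /\ ~ exists p : {poly C}, forall z, f z = p.[z].

Definition locally_uniform_cvg (D : set C) (u : nat -> C -> C) (g : C -> C) :=
  forall z, D z -> exists2 W, nbhs z W & {uniform W, u @ \oo --> g}.

Definition locally_uniform_cvg_infty (D : set C) (u : nat -> C -> C) :=
  forall z, D z -> exists2 W, nbhs z W &
    forall M : R, \forall n \near \oo, forall w, W w -> M < modulus (u n w).

Definition normal_family (D : set C) (F : set (C -> C)) :=
  forall u : nat -> C -> C, (forall k, F (u k)) ->
  exists phi : nat -> nat, {homo phi : m n / (m < n)%N} /\
    ((exists g, locally_uniform_cvg D (u \o phi) g) \/
     locally_uniform_cvg_infty D (u \o phi)).

Definition fatou_set (f : C -> C) : set C :=
  [set z | exists2 V, open_nbhs z V &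
     normal_family V (range (fun n => iter n.+1 f))].

Definition fatou_component (f : C -> C) (U : set C) :=
  exists2 z, fatou_set f z & U = connected_component (fatou_set f) z.

(* Existence holds because [f] maps its Fatou set into itself, and uniqueness
   because components are disjoint. *)
Definition fatou_component_iter (f : C -> C) (U : set C) (n : nat) : set C :=
  get [set V | fatou_component f V /\ iter n f @` U `<=` V].

Definition eventually_periodic (T : Type) (u : nat -> T) :=
  exists N p : nat, (0 < p)%N /\ forall n, (N <= n)%N -> u (n + p)%N = u n.

Definition wandering_domain (f : C -> C) (U : set C) :=
  fatou_component f U /\ ~ eventually_periodic (fatou_component_iter f U).

Definition path_in (D : set C) (c : R -> C) :=
  {within `[0, 1], continuous c} /\ forall t, t \in `[0, 1] -> D (c t).

Definition path_connected (D : set C) :=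
  forall x y, D x -> D y -> exists c, [/\ path_in D c, c 0 = x & c 1 = y].

(* Homotopies [H] are parametrised as [H (s, t)], [s] being the deformation
   parameter; the base point [c 0] is fixed. *)
Definition null_homotopic (D : set C) (c : R -> C) :=
  exists H : R * R -> C,
  [/\ {within `[0, 1] `*` `[0, 1], continuous H},
      forall s t, s \in `[0, 1] -> t \in `[0, 1] -> D (H (s, t)),
      forall t, t \in `[0, 1] -> H (0, t) = c t /\ H (1, t) = c 0 &
      forall s, s \in `[0, 1] -> H (s, 0) = c 0 /\ H (s, 1) = c 0].

Definition simply_connected (D : set C) :=
  path_connected D /\
  forall c, path_in D c -> c 0 = c 1 -> null_homotopic D c.

Definition domain (D : set C) := [/\ open D, connected D & D !=set0].

Definition multiply_connected (D : set C) := domain D /\ ~ simply_connected D.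

(* The restriction of [h] to the line through [z] with direction [v]: its
   derivatives at 0 for [v] = 1 and [v] = i are the real partial derivatives. *)
Definition along (v : C) (h : C -> R) (z : C) (t : R) : R :=
  h (z + (t%:C)%C * v).

Definition partial (v : C) (h : C -> R) (z : C) : R := derive1 (along v h z) 0.

Definition C1_on (D : set C) (h : C -> R) :=
  forall v, v = 1 \/ v = 'i%C ->
    (forall z, D z -> derivable (along v h z) 0 1) /\
    {in D, continuous (partial v h)}.

Definition C2_on (D : set C) (h : C -> R) :=
  C1_on D h /\ C1_on D (partial 1 h) /\ C1_on D (partial 'i%C h).

Definition harmonic_on (D : set C) (h : C -> R) :=
  C2_on D h /\
  forall z, D z ->
    partial 1 (partial 1 h) z + partial 'i%C (partial 'i%C h) z = 0.

End Defs.

(* Main.v *)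
(** The component U has a hole: a bounded open set Om, not contained in U, whose boundary lies in U, and hence Om
    meets the Julia set. Consequently f^n tends to infinity on U, and f^n(Om) eventually contains the disc of radius
    min |f^n| taken over the boundary of Om. Harnack's inequality makes the functions log |f^n| comparable with
    L_n = log |f^n z0| on compact subsets of U, and transcendence of f then yields L_(n+1) / L_n -> infinity.
    On some disc in Om, log |f^n| is of order at most L_(n-1); by the three circles theorem log |f^n| / L_n is
    therefore not asymptotically constant on any disc in U, and a branch of log f^n near z covers a disc of radius
    proportional to L_n. Harnack's inequality for log |f o exp| on that disc gives
    log M(|f^n z|) <= (1 + O(1 / L_n)) log |f^(n+1) z|, M being the maximum modulus of f. By the convexity of log M
    (Hadamard), a ratio q_n = log |f^n z| / L_n at least 1 decreases by at most O(1 / L_n) in one step, and so does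
    1 / q_n when q_n <= 1; since L_n at least doubles, q_n converges. Its limit is locally the real part of an
    ultrafilter limit of normalised branches of log f^n. *)

(* Harnack's inequality on a fixed disc of [U] only gives bounded ratios; convergence needs an error
   that is summable in [n]. Used instead in the plane of [log f^n], on a disc of radius proportional
   to [L_n], it costs only O(1 / [L_n]). Such a disc exists only if [log f^n] oscillates near each
   point by a fixed multiple of [L_n], uniformly in [n]. Hence nonconstancy, for limits along
   arbitrary free ultrafilters, is settled before convergence and is not a corollary of it.
   Convexity of log M bounds growth at the smaller of two radii by growth at the larger; so the
   drift is one-sided, and ratios above and below 1 are treated apart, the two points exchanging
   roles. Integration is confined to rectangles: Cauchy estimates, the Schwarz lemma and the
   polynomial growth criterion come from one division lemma based on the maximum principle, and
   limits of holomorphic functions from an interpolation inequality that passes to pointwise limits.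
   The topology of [U] enters only through the hole, which is found by contracting walks in a
   triangular lattice. *)
Require Import Defs.
From mathcomp Require Import all_boot all_order all_algebra.
From mathcomp Require Import complex.
From mathcomp Require Import all_classical all_reals all_analysis.
From mathcomp Require Import ring lra zify.
Import numFieldNormedType.Exports.
Import Order.TTheory GRing.Theory Num.Theory.
Set Implicit Arguments.
Unset Strict Implicit.
Unset Printing Implicit Defensive.
Local Open Scope classical_set_scope.
Local Open Scope ring_scope.

(** * The modulus and complex differentiation *)

Section Basics.
Context {R : realType}.
Local Notation C := (Cx R).
Implicit Types (z w : C) (x y e d r : R).

Definition re z : R := complex.Re z.
Definition im z : R := complex.Im z.
Definition rc x : C := (x%:C)%C.
Definition ii : C := ('i)%C.

Lemma moE z : modulus z = Num.sqrt (re z ^+ 2 + im z ^+ 2).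
Proof. by rewrite /modulus normc_def. Qed.

Lemma norm_mo z : `|z| = rc (modulus z).
Proof. by rewrite moE /rc -[RHS]normc_def. Qed.

Lemma mo_ge0 z : 0 <= modulus z.
Proof. by rewrite moE sqrtr_ge0. Qed.

Lemma rc_inj : injective rc.
Proof. by move=> x y []. Qed.

Lemma rcD x y : rc (x + y) = rc x + rc y.
Proof. by rewrite /rc rmorphD. Qed.
Lemma rcB x y : rc (x - y) = rc x - rc y.
Proof. by rewrite /rc rmorphB. Qed.
Lemma rcM x y : rc (x * y) = rc x * rc y.
Proof. by rewrite /rc rmorphM. Qed.
Lemma rcN x : rc (- x) = - rc x.
Proof. by rewrite /rc rmorphN. Qed.
Lemma rcV x : rc (x^-1) = (rc x)^-1.
Proof. by rewrite /rc fmorphV. Qed.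
Lemma rc0 : rc 0 = 0. Proof. by rewrite /rc rmorph0. Qed.
Lemma rc1 : rc 1 = 1. Proof. by rewrite /rc rmorph1. Qed.
Lemma rc_nat n : rc n%:R = n%:R.
Proof. by rewrite /rc rmorph_nat. Qed.
Lemma rc_eq0 x : (rc x == 0) = (x == 0).
Proof. by rewrite -rc0 (inj_eq rc_inj). Qed.

Lemma moM z w : modulus (z * w) = modulus z * modulus w.
Proof. by apply: rc_inj; rewrite -norm_mo normrM !norm_mo rcM. Qed.

Lemma moD z w : modulus (z + w) <= modulus z + modulus w.
Proof.
have := ler_normD z w; rewrite !norm_mo -rcD /rc.
by rewrite -[X in (X <= _) -> _]/(_%:C%C) lecR.
Qed.

Lemma moN z : modulus (- z) = modulus z.
Proof. by rewrite /modulus normrN. Qed.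

Lemma moB z w : modulus (z - w) <= modulus z + modulus w.
Proof. by rewrite -(moN w) moD. Qed.

Lemma mo_sym z w : modulus (z - w) = modulus (w - z).
Proof. by rewrite -moN opprB. Qed.

Lemma mo_tri z w v : modulus (z - v) <= modulus (z - w) + modulus (w - v).
Proof. by rewrite (_ : z - v = (z - w) + (w - v)) ?moD //; ring. Qed.

Lemma mo_subr z w : modulus z - modulus w <= modulus (z - w).
Proof. rewrite lerBlDr (_ : modulus z = modulus ((z - w) + w)) ?moD //; congr modulus; ring. Qed.

Lemma mo0 : modulus (0 : C) = 0.
Proof. by rewrite /modulus normr0. Qed.
Lemma mo1 : modulus (1 : C) = 1.
Proof. by rewrite /modulus normr1. Qed.

Lemma mo_eq0 z : (modulus z == 0) = (z == 0).
Proof. by rewrite -rc_eq0 -norm_mo normr_eq0. Qed.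

Lemma mo_gt0 z : (0 < modulus z) = (z != 0).
Proof. by rewrite lt_def mo_eq0 mo_ge0 andbT. Qed.

Lemma mo_rc x : modulus (rc x) = `|x|.
Proof. by rewrite moE /= expr0n /= addr0 sqrtr_sqr. Qed.

Lemma mo_ii : modulus ii = 1.
Proof. by rewrite moE /= expr0n /= add0r expr1n sqrtr1. Qed.

Lemma moV z : modulus (z^-1) = (modulus z)^-1.
Proof. by apply: rc_inj; rewrite -norm_mo normfV norm_mo rcV. Qed.

Lemma moX z n : modulus (z ^+ n) = modulus z ^+ n.
Proof. by elim: n => [|n IH]; rewrite ?expr0 ?mo1 // !exprS moM IH. Qed.

Lemma mo_nat n : modulus (n%:R : C) = n%:R.
Proof. by rewrite -rc_nat mo_rc normr_nat. Qed.

Lemma reD z w : re (z + w) = re z + re w. Proof. by case: z; case: w. Qed.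
Lemma imD z w : im (z + w) = im z + im w. Proof. by case: z; case: w. Qed.
Lemma reN z : re (- z) = - re z. Proof. by case: z. Qed.
Lemma imN z : im (- z) = - im z. Proof. by case: z. Qed.
Lemma reB z w : re (z - w) = re z - re w. Proof. by rewrite reD reN. Qed.
Lemma imB z w : im (z - w) = im z - im w. Proof. by rewrite imD imN. Qed.
Lemma reM z w : re (z * w) = re z * re w - im z * im w.
Proof. by case: z; case: w. Qed.
Lemma imM z w : im (z * w) = re z * im w + im z * re w.
Proof. by case: z; case: w. Qed.
Lemma re_rc x : re (rc x) = x. Proof. by []. Qed.
Lemma im_rc x : im (rc x) = 0. Proof. by []. Qed.
Lemma re_ii : re ii = 0. Proof. by []. Qed.
Lemma im_ii : im ii = 1. Proof. by []. Qed.
Lemma re0 : re 0 = 0. Proof. by []. Qed.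
Lemma im0 : im 0 = 0. Proof. by []. Qed.
Lemma re1 : re 1 = 1. Proof. by []. Qed.
Lemma im1 : im 1 = 0. Proof. by []. Qed.

Definition reimE := (reD, imD, reN, imN, reM, imM, re_rc, im_rc, re_ii, im_ii,
  re0, im0, re1, im1).

Lemma C_ext z w : re z = re w -> im z = im w -> z = w.
Proof. by case: z => a b; case: w => c d; rewrite /re /im /= => -> ->. Qed.

Lemma reim z : z = rc (re z) + ii * rc (im z).
Proof. by apply: C_ext; rewrite !reimE; ring. Qed.

Lemma iiK : ii * ii = -1.
Proof. by apply: C_ext; rewrite !reimE; ring. Qed.

Lemma re_le z : `|re z| <= modulus z.
Proof. by rewrite moE -sqrtr_sqr ler_wsqrtr // lerDl sqr_ge0. Qed.
Lemma im_le z : `|im z| <= modulus z.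
Proof. by rewrite moE -sqrtr_sqr ler_wsqrtr // lerDr sqr_ge0. Qed.
Lemma re_le' z : re z <= modulus z.
Proof. exact: le_trans (ler_norm _) (re_le _). Qed.

Lemma mo_le z : modulus z <= `|re z| + `|im z|.
Proof.
rewrite {1}(reim z); apply: (le_trans (moD _ _)).
by rewrite moM mo_ii mul1r !mo_rc.
Qed.

Lemma mo_sqr z : modulus z ^+ 2 = re z ^+ 2 + im z ^+ 2.
Proof. by rewrite moE sqr_sqrtr // addr_ge0 // sqr_ge0. Qed.

Definition D z r : set C := [set w | modulus (w - z) < r].

(** Balls of [Cx R] have radii in [R[i]]; a positive one has zero imaginary part, so real radii
    suffice. *)
Lemma nbhs_cx z (W : set C) : nbhs z W <-> exists2 e : R, 0 < e & D z e `<=` W.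
Proof.
split.
- move/(@nbhs_ballP _ C) => [e /= e0 We].
  have er : e = rc (re e).
    apply: C_ext => //; rewrite im_rc /im; move: e0; rewrite ltcE /= => /andP[/eqP h _]; exact: h.
  exists (re e).
    by move: e0; rewrite ltcE => /andP[_].
  move=> w /= h; apply: We; rewrite /ball /= -normrN opprB norm_mo er.
  by rewrite /rc ltcR.
- move=> [e e0 We]; apply/(@nbhs_ballP _ C); exists (rc e) => /=.
    by rewrite /rc ltcR.
  move=> w; rewrite /ball /= -normrN opprB norm_mo /rc ltcR => h; exact: We.
Qed.

Lemma open_cx (W : set C) :
  open W <-> forall z, W z -> exists2 e : R, 0 < e & D z e `<=` W.
Proof.
rewrite openE; split => h z Wz; first by apply/nbhs_cx; exact: h.
by rewrite /interior; apply/nbhs_cx; exact: h.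
Qed.

Lemma D_open z r : open (D z r).
Proof.
apply/open_cx => w; rewrite {1}/D /= => h; exists (r - modulus (w - z)); first by lra.
move=> v; rewrite /D /= => h2; have := mo_tri v w z; lra.
Qed.

Lemma cont_cx (g : C -> C) z : {for z, continuous g} <->
  forall e : R, 0 < e -> exists2 d : R, 0 < d & forall w, modulus (w - z) < d -> modulus (g w - g z) < e.
Proof.
split.
- move=> cg e e0.
  have /cg /nbhs_cx[d d0 H] : nbhs (g z) (D (g z) e) by apply/nbhs_cx; exists e.
  by exists d.
- move=> H W /nbhs_cx[e e0 We]; have [d d0 Hd] := H e e0.
  by apply/nbhs_cx; exists d => // w /Hd h; apply: We.
Qed.

Lemma contCR (g : C -> R) z : {for z, continuous g} <->
  forall e : R, 0 < e -> exists2 d : R, 0 < d & forall w, modulus (w - z) < d -> `|g w - g z| < e.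
Proof.
split.
- move=> cg e e0.
  have /cg /nbhs_cx[d d0 H] : nbhs (g z) (ball (g z) e) by apply: nbhsx_ballx.
  by exists d => // w /H; rewrite /= /ball /= -normrN opprB.
- move=> H W /nbhs_ballP[e e0 We]; have [d d0 Hd] := H e e0.
  by apply/nbhs_cx; exists d => // w /Hd h; apply: We; rewrite /= /ball /= -normrN opprB.
Qed.

Lemma contRC (g : R -> C) x : {for x, continuous g} <->
  forall e : R, 0 < e -> exists2 d : R, 0 < d & forall y, `|y - x| < d -> modulus (g y - g x) < e.
Proof.
split.
- move=> cg e e0.
  have /cg /nbhs_ballP[d d0 H] : nbhs (g x) (D (g x) e) by apply/nbhs_cx; exists e.
  by exists d => // y h; apply: H; rewrite /ball /= -normrN opprB.
- move=> H W /nbhs_cx[e e0 We]; have [d d0 Hd] := H e e0.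
  apply/nbhs_ballP; exists d => //= y; rewrite /ball /= -normrN opprB => /Hd h; exact: We.
Qed.

Lemma contRR (g : R -> R) x : {for x, continuous g} <->
  forall e : R, 0 < e -> exists2 d : R, 0 < d & forall y, `|y - x| < d -> `|g y - g x| < e.
Proof.
split.
- move=> cg e e0.
  have /cg /nbhs_ballP[d d0 H] : nbhs (g x) (ball (g x) e) by apply: nbhsx_ballx.
  exists d => // y h; have : ball x d y by rewrite /ball /= -normrN opprB.
  by move/H; rewrite /= /ball /= -normrN opprB.
- move=> H W /nbhs_ballP[e e0 We]; have [d d0 Hd] := H e e0.
  apply/nbhs_ballP; exists d => //= y; rewrite /ball /= -normrN opprB => /Hd h; apply: We.
  by rewrite /= /ball /= -normrN opprB.
Qed.

End Basics.

Lemma is_deriveP (K : numFieldType) (f : K -> K) (x l : K) :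
  is_derive x 1 f l <-> forall e : K, 0 < e -> exists2 d : K, 0 < d &
    forall h, `|h| < d -> `|f (x + h) - f x - h * l| <= e * `|h|.
Proof.
have key (h : K) : h != 0 ->
    `|l - h^-1 *: (f (h *: 1 + x) - f x)| * `|h| = `|f (x + h) - f x - h * l|.
  move=> h0; rewrite -normrM -[RHS]normrN; congr (Num.norm _).
  by rewrite /GRing.scale /= mulr1 (addrC h x); field.
split.
- move=> [dx Dx] e e0; move: dx; rewrite /derivable /= => /cvg_ex[/= l' cl'].
  have ll' : l' = l by rewrite -Dx /derive; apply/esym/cvg_lim.
  subst l'; move: cl' => /cvgrPdist_le /(_ e e0).
  rewrite /dnbhs /within /prop_near1 /= => /nbhs_ballP[d /= d0 H].
  exists d => // h hd; have [->|h0] := eqVneq h 0.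
    by rewrite addr0 subrr mul0r subr0 normr0 mulr0.
  rewrite -key // ler_wpM2r //; apply: H => //.
  by rewrite /ball /= sub0r normrN.
- move=> H.
  have cl : (fun h : K => h^-1 *: (f (h *: 1 + x) - f x)) @ 0^' --> l.
    apply/cvgrPdist_le => e e0; have [d d0 Hd] := H e e0.
    rewrite /dnbhs /within /prop_near1 /=; apply/nbhs_ballP; exists d => //= h.
    rewrite /ball /= sub0r normrN => hd h0.
    by rewrite -(ler_pM2r (x := `|h|)) ?normr_gt0// key // Hd.
  split; first by apply/cvg_ex; exists l.
  exact/cvg_lim.
Qed.

Section Deriv.
Context {R : realType}.
Local Notation C := (Cx R).
Implicit Types (z w l : C) (x y e d r : R) (g f : C -> C) (F : R -> C).

(** Linear approximation with real error bounds instead of a quotient: [h = 0] is not excluded,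
    which lets products and compositions be estimated without case distinctions. *)
Definition hder g z l := forall e, 0 < e -> exists2 d, 0 < d &
  forall h : C, modulus h < d -> modulus (g (z + h) - g z - h * l) <= e * modulus h.

Definition rder F x l := forall e, 0 < e -> exists2 d, 0 < d &
  forall h : R, `|h| < d -> modulus (F (x + h) - F x - rc h * l) <= e * `|h|.

Definition ccont g z := forall e, 0 < e -> exists2 d, 0 < d &
  forall w, modulus (w - z) < d -> modulus (g w - g z) < e.
Definition rcont F x := forall e, 0 < e -> exists2 d, 0 < d &
  forall y, `|y - x| < d -> modulus (F y - F x) < e.

Lemma pos_rc (e : C) : 0 < e -> e = rc (re e) /\ 0 < re e.
Proof.
rewrite ltcE /= => /andP[/eqP h h2]; split => //.
by apply: C_ext => //; rewrite im_rc /im.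
Qed.

Lemma hder_is_derive g z l : hder g z l <-> is_derive z 1 g l.
Proof.
apply: (iff_trans _ (iff_sym (is_deriveP g z l))); split => H e e0.
- have [-> er] := pos_rc e0; have [d d0 Hd] := H _ er.
  exists (rc d); first by rewrite /rc ltcR.
  move=> h; rewrite !norm_mo -rcM /rc ltcR lecR; exact: Hd.
- have [|d d0 Hd] := H (rc e); first by rewrite /rc ltcR.
  have [de dr] := pos_rc d0; exists (re d) => // h hd.
  have := Hd h; rewrite !norm_mo -rcM de /rc ltcR lecR; exact.
Qed.

Lemma hder_derivable g z : derivable g z 1 <-> exists l, hder g z l.
Proof.
split => [/derivableP/hder_is_derive ?|[l /hder_is_derive[]//]].
by eexists; eassumption.
Qed.

Lemma hder_cont g z l : hder g z l -> ccont g z.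
Proof.
move=> H e e0; have [d d0 Hd] := H 1 ltr01.
have L0 : 0 < 1 + modulus l by have := mo_ge0 l; lra.
exists (Num.min d (e / (1 + modulus l))); first by rewrite lt_min d0 divr_gt0.
move=> w; rewrite lt_min => /andP[wd we].
have := Hd (w - z) wd; rewrite (_ : z + (w - z) = w); last by ring.
move=> h1; have := moD (g w - g z - (w - z) * l) ((w - z) * l).
rewrite subrK moM; move: we; rewrite ltr_pdivlMr //; lra.
Qed.

Lemma hder_eqnear g f z l r : 0 < r -> (forall w, modulus (w - z) < r -> g w = f w) ->
  hder f z l -> hder g z l.
Proof.
move=> r0 E H e e0; have [d d0 Hd] := H e e0.
exists (Num.min d r); first by rewrite lt_min d0.
move=> h; rewrite lt_min => /andP[hd hr]; rewrite !E ?Hd //.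
  by rewrite subrr mo0.
by rewrite (_ : z + h - z = h) //; ring.
Qed.

Lemma hder_cst a z : hder (fun=> a) z 0.
Proof.
move=> e e0; exists 1 => // h _.
by rewrite subrr mulr0 subr0 mo0 mulr_ge0 ?mo_ge0 // ltW.
Qed.

Lemma hder_id z : hder (fun w => w) z 1.
Proof.
move=> e e0; exists 1 => // h _.
rewrite (_ : _ - _ = 0); last by ring.
by rewrite mo0 mulr_ge0 ?mo_ge0 // ltW.
Qed.

Lemma hderD g f z l m : hder g z l -> hder f z m -> hder (fun w => g w + f w) z (l + m).
Proof.
move=> Hg Hf e e0; have e2 : 0 < e / 2 by lra.
have [d d0 Hd] := Hg _ e2; have [d' d'0 Hd'] := Hf _ e2.
exists (Num.min d d'); first by rewrite lt_min d0.
move=> h; rewrite lt_min => /andP[/Hd h1 /Hd' h2].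
rewrite (_ : _ - _ = (g (z + h) - g z - h * l) + (f (z + h) - f z - h * m)); last by ring.
by apply: (le_trans (moD _ _)); lra.
Qed.

Lemma hderM g f z l m : hder g z l -> hder f z m ->
  hder (fun w => g w * f w) z (l * f z + g z * m).
Proof.
move=> Hg Hf e e0.
have cf := hder_cont Hf.
set A := modulus (g z) + modulus (f z) + modulus l + 1.
have Ap : 0 < A by rewrite /A; have := mo_ge0 (g z); have := mo_ge0 (f z); have := mo_ge0 l; lra.
have e2 : 0 < Num.min 1 (e / (4 * A)) by rewrite lt_min ltr01 divr_gt0 // mulr_gt0.
have [d d0 Hd] := Hg _ e2; have [d' d'0 Hd'] := Hf _ e2.
have [d2 d20 Hd2] := cf _ e2.
exists (Num.min d (Num.min d' d2)); first by rewrite !lt_min d0 d'0.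
move=> h; rewrite !lt_min => /and3P[/Hd h1 /Hd' h2 h3].
have {h3}: modulus (z + h - z) < d2 by rewrite (_ : z + h - z = h) //; ring.
move/Hd2 => h3.
set E := Num.min 1 (e / (4 * A)) in h1 h2 h3 e2.
have E1 : E <= 1 by rewrite /E ge_min lexx.
have EA : E * A <= e / 4.
  have : E <= e / (4 * A) by rewrite /E ge_min lexx orbT.
  by rewrite ler_pdivlMr ?mulr_gt0 //; lra.
rewrite (_ : _ - _ = (g (z + h) - g z - h * l) * f (z + h)
   + g z * (f (z + h) - f z - h * m) + h * l * (f (z + h) - f z)); last by ring.
have f1 : modulus (f (z + h)) <= modulus (f z) + 1.
  have := mo_subr (f (z + h)) (f z); lra.
apply: (le_trans (moD _ _)).
have := moD ((g (z + h) - g z - h * l) * f (z + h)) (g z * (f (z + h) - f z - h * m)).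
rewrite !moM.
have hg : 0 <= modulus h := mo_ge0 _.
have t1 : modulus (g (z + h) - g z - h * l) * modulus (f (z + h)) <= E * modulus h * A.
  apply: ler_pM; rewrite ?mo_ge0 //; rewrite /A; have := mo_ge0 (g z); have := mo_ge0 l; lra.
have t2 : modulus (g z) * modulus (f (z + h) - f z - h * m) <= A * (E * modulus h).
  apply: ler_pM; rewrite ?mo_ge0 //; rewrite /A; have := mo_ge0 (f z); have := mo_ge0 l; lra.
have t3 : modulus h * modulus l * modulus (f (z + h) - f z) <= modulus h * A * E.
  apply: ler_pM; rewrite ?mulr_ge0 ?mo_ge0 //; last exact: ltW.
  apply: ler_pM; rewrite ?mo_ge0 //; rewrite /A; have := mo_ge0 (f z); have := mo_ge0 (g z); lra.
have : E * A * modulus h <= e / 4 * modulus h by rewrite ler_wpM2r.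
have : 0 <= e * modulus h by rewrite mulr_ge0 // ltW.
lra.
Qed.

Lemma hder_comp g f z l m : hder g z l -> hder f (g z) m -> hder (fun w => f (g w)) z (l * m).
Proof.
move=> Hg Hf e e0.
have cg := hder_cont Hg.
set A := modulus l + 1; set B := modulus m + 1.
have Ap : 0 < A by rewrite /A; have := mo_ge0 l; lra.
have Bp : 0 < B by rewrite /B; have := mo_ge0 m; lra.
have e1 : 0 < e / (2 * A) by rewrite divr_gt0 // mulr_gt0.
have e2 : 0 < Num.min 1 (e / (2 * B)) by rewrite lt_min ltr01 divr_gt0 // mulr_gt0.
have [d d0 Hd] := Hf _ e1; have [d' d'0 Hd'] := Hg _ e2.
have [d2 d20 Hd2] := cg _ d0.
exists (Num.min d' d2); first by rewrite !lt_min d20 d'0.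
move=> h; rewrite !lt_min => /andP[/Hd' h1 h2].
have {h2}: modulus (z + h - z) < d2 by rewrite (_ : z + h - z = h) //; ring.
move/Hd2 => h2; have := Hd _ h2.
rewrite (_ : g z + (g (z + h) - g z) = g (z + h)); last by ring.
move=> h3.
rewrite (_ : _ - _ = (f (g (z + h)) - f (g z) - (g (z + h) - g z) * m)
   + (g (z + h) - g z - h * l) * m); last by ring.
apply: (le_trans (moD _ _)); rewrite moM.
set E := Num.min 1 (e / (2 * B)) in h1 e2.
have E1 : E <= 1 by rewrite /E ge_min lexx.
have EB : E * B <= e / 2.
  have : E <= e / (2 * B) by rewrite /E ge_min lexx orbT.
  by rewrite ler_pdivlMr ?mulr_gt0 //; lra.
have hg : 0 <= modulus h := mo_ge0 _.
have gA : modulus (g (z + h) - g z) <= modulus h * A.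
  have := moD (g (z + h) - g z - h * l) (h * l); rewrite subrK moM /A.
  have : E * modulus h <= 1 * modulus h by rewrite ler_wpM2r.
  lra.
have t1 : e / (2 * A) * modulus (g (z + h) - g z) <= e / 2 * modulus h.
  rewrite -mulrA (mulrC (e / 2)).
  apply: (@le_trans _ _ (e * ((2 * A)^-1 * (modulus h * A)))).
    rewrite ler_wpM2l ?(ltW e0) // ler_wpM2l // invr_ge0; lra.
  by rewrite le_eqVlt; apply/orP; left; apply/eqP; field; lra.
have t2 : modulus (g (z + h) - g z - h * l) * modulus m <= E * modulus h * B.
  apply: ler_pM; rewrite ?mo_ge0 //; rewrite /B; lra.
have : E * B * modulus h <= e / 2 * modulus h by rewrite ler_wpM2r.
lra.
Qed.

Lemma hder_inv z : z != 0 -> hder (fun w => w^-1) z (- (z ^+ 2)^-1).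
Proof.
move=> z0 e e0; have mz : 0 < modulus z by rewrite mo_gt0.
exists (Num.min (modulus z / 2) (e * modulus z ^+ 3 / 2)).
  by rewrite lt_min; apply/andP; split; rewrite divr_gt0 // mulr_gt0 // exprn_gt0.
move=> h; rewrite lt_min => /andP[h1 h2].
have zh : modulus z / 2 <= modulus (z + h).
  have := mo_subr z (- h); rewrite moN opprK; lra.
have zh0 : z + h != 0 by rewrite -mo_gt0; lra.
rewrite (_ : _ - _ = h * h / (z ^+ 2 * (z + h))); last first.
  by field; rewrite z0 zh0.
rewrite moM moV [modulus (h * h)]moM [modulus (_ * (z + h))]moM moX.
rewrite mulrAC ler_wpM2r ?mo_ge0 //.
rewrite ler_pdivrMr; last by rewrite mulr_gt0 ?exprn_gt0 //; lra.
apply: (le_trans (ltW h2)).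
rewrite exprSr; have : 0 <= e * modulus z ^+ 2 by rewrite mulr_ge0 ?(ltW e0) // sqr_ge0.
move=> p; have := ler_wpM2l p zh; lra.
Qed.

Lemma hderN g z l : hder g z l -> hder (fun w => - g w) z (- l).
Proof.
move=> Hg e e0; have [d d0 Hd] := Hg _ e0; exists d => // h /Hd.
rewrite -moN; congr (modulus _ <= _); ring.
Qed.

Lemma hderB g f z l m : hder g z l -> hder f z m -> hder (fun w => g w - f w) z (l - m).
Proof. by move=> hg hf; exact: (hderD hg (hderN hf)). Qed.

Lemma hderZ g z l a : hder g z l -> hder (fun w => a * g w) z (a * l).
Proof.
move=> hg; have := hderM (hder_cst a z) hg; rewrite mul0r add0r; exact.
Qed.

Lemma hderV g z l : g z != 0 -> hder g z l -> hder (fun w => (g w)^-1) z (- l / g z ^+ 2).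
Proof.
move=> g0 hg; have := hder_comp hg (hder_inv g0).
by rewrite mulrN mulNr.
Qed.

Lemma hderX g z l n : hder g z l -> exists m, hder (fun w => g w ^+ n) z m.
Proof.
move=> hg; elim: n => [|n [m IH]].
  by exists 0 => e e0; have [d d0 H] := hder_cst 1 z e0; exists d => // h /H; rewrite !expr0.
eexists => e e0; have [d d0 H] := hderM hg IH e0.
by exists d => // h /H; rewrite !exprS; exact.
Qed.

Lemma hder_uniq g z l m : hder g z l -> hder g z m -> l = m.
Proof.
move=> h1 h2; apply/eqP; rewrite -subr_eq0 -mo_eq0; apply/eqP.
apply/le_anti; rewrite mo_ge0 andbT; apply/ler_addgt0Pl => e e0; rewrite addr0.
have e2 : 0 < e / 2 by lra.
have [d d0 Hd] := h1 _ e2; have [d' d'0 Hd'] := h2 _ e2.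
set t := Num.min d d' / 2.
have dm : 0 < Num.min d d' by rewrite lt_min d0.
have t0 : 0 < t by rewrite /t; lra.
have td : t < Num.min d d' by rewrite /t; lra.
move: td; rewrite lt_min => /andP[td td'].
have := Hd (rc t); have := Hd' (rc t); rewrite !mo_rc gtr0_norm // => /(_ td') a1 /(_ td) a2.
have := moB (g (z + rc t) - g z - rc t * m) (g (z + rc t) - g z - rc t * l).
rewrite (_ : _ - _ = rc t * (l - m)); last by ring.
rewrite moM mo_rc gtr0_norm // => a3.
have : t * modulus (l - m) <= t * e by lra.
by rewrite ler_pM2l.
Qed.

Lemma rder_line g a b x l : hder g (a + rc x * b) l -> rder (fun t => g (a + rc t * b)) x (b * l).
Proof.
move=> H e e0; set A := modulus b + 1.
have Ap : 0 < A by rewrite /A; have := mo_ge0 b; lra.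
have [|d d0 Hd] := H (e / A); first by rewrite divr_gt0.
exists (d / A); first by rewrite divr_gt0.
move=> h; rewrite ltr_pdivlMr // => hd.
have hb : modulus (rc h * b) <= `|h| * A.
  by rewrite moM mo_rc ler_wpM2l // /A lerDl.
have := Hd (rc h * b) (le_lt_trans hb hd).
rewrite (_ : a + rc x * b + rc h * b = a + rc (x + h) * b); last by rewrite rcD; ring.
rewrite mulrA => H2; apply: (le_trans H2).
apply: (@le_trans _ _ (e / A * (`|h| * A))).
  by rewrite ler_wpM2l // divr_ge0 ?ltW.
by rewrite le_eqVlt; apply/orP; left; apply/eqP; field; lra.
Qed.

Lemma rder_scale F x l c : rder F x l -> rder (fun t => c * F t) x (c * l).
Proof.
move=> H e e0; set A := modulus c + 1.
have Ap : 0 < A by rewrite /A; have := mo_ge0 c; lra.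
have [|d d0 Hd] := H (e / A); first by rewrite divr_gt0.
exists d => // h /Hd h1.
rewrite (_ : _ - _ = c * (F (x + h) - F x - rc h * l)); last by ring.
rewrite moM; apply: (@le_trans _ _ (A * (e / A * `|h|))).
  by apply: ler_pM; rewrite ?mo_ge0 // /A lerDl.
by rewrite le_eqVlt; apply/orP; left; apply/eqP; field; lra.
Qed.

Lemma rderD F G x l m : rder F x l -> rder G x m -> rder (fun t => F t + G t) x (l + m).
Proof.
move=> Hg Hf e e0; have e2 : 0 < e / 2 by lra.
have [d d0 Hd] := Hg _ e2; have [d' d'0 Hd'] := Hf _ e2.
exists (Num.min d d'); first by rewrite lt_min d0.
move=> h; rewrite lt_min => /andP[/Hd h1 /Hd' h2].
rewrite (_ : _ - _ = (F (x + h) - F x - rc h * l) + (G (x + h) - G x - rc h * m)); last by ring.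
by apply: (le_trans (moD _ _)); lra.
Qed.

Lemma rder_re F x l : rder F x l -> is_derive x 1 (fun t => re (F t)) (re l).
Proof.
move=> H; apply/is_deriveP => e e0; have [d d0 Hd] := H e e0.
exists d => // h /Hd; apply: le_trans; apply: le_trans (re_le _).
by rewrite !reimE le_eqVlt; apply/orP; left; apply/eqP; congr (`|_|); ring.
Qed.

Lemma is_derive_rder (u v : R -> R) x (a b : R) : is_derive x 1 u a -> is_derive x 1 v b ->
  rder (fun t => rc (u t) + ii * rc (v t)) x (rc a + ii * rc b).
Proof.
move=> /is_deriveP Hu /is_deriveP Hv e e0; have e2 : 0 < e / 2 by lra.
have [d d0 Hd] := Hu _ e2; have [d' d'0 Hd'] := Hv _ e2.
exists (Num.min d d'); first by rewrite lt_min d0.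
move=> h; rewrite lt_min => /andP[/Hd h1 /Hd' h2].
apply: (le_trans (mo_le _)); rewrite !reimE.
rewrite (_ : u _ + _ + _ + _ = u (x + h) - u x - h * a); last by ring.
rewrite (_ : 0 + _ + _ + _ = v (x + h) - v x - h * b); last by ring.
lra.
Qed.

(* The projection of [F b - F a] on its own direction reduces this to the real mean value theorem. *)
Lemma mvi F k M a b : a <= b -> (forall x, a <= x <= b -> rder F x (k x)) ->
  (forall x, a <= x <= b -> modulus (k x) <= M) -> modulus (F b - F a) <= M * (b - a).
Proof.
move=> ab dF kM; have [->|ne] := eqVneq (F b - F a) 0.
  rewrite mo0 mulr_ge0 ?subr_ge0 //.
  by apply: le_trans (kM a _); rewrite ?mo_ge0 // lexx.
set c : C := (rc (modulus (F b - F a)) / (F b - F a)).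
have mc : modulus c = 1.
  rewrite /c moM mo_rc moV ger0_norm ?mo_ge0 // mulfV //.
  by rewrite mo_eq0.
have cE : c * (F b - F a) = rc (modulus (F b - F a)) by rewrite /c divfK.
pose u := fun t : R => re (c * F t).
have du x : a <= x <= b -> is_derive x 1 u (re (c * k x)).
  by move=> h; apply: rder_re; apply: rder_scale; exact: dF.
have uba : u b - u a = modulus (F b - F a).
  rewrite /u -reB -mulrBr cE; exact: re_rc.
rewrite -uba.
have [eab|ltab] := eqVneq a b; first by rewrite eab !subrr mulr0.
have lt : a < b by rewrite lt_neqAle ltab ab.
have [||x xab ->] := @MVT _ u (fun x => re (c * k x)) a b lt.
- move=> x /=; rewrite in_itv /= => /andP[h1 h2]; apply: du; lra.
- apply: derivable_within_continuous => x; rewrite in_itv /= => h.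
  by have [] := du x h.
move: xab; rewrite in_itv /= => /andP[h1 h2].
rewrite ler_wpM2r ?subr_ge0 //.
apply: (le_trans (re_le' _)); rewrite moM mc mul1r; apply: kM; lra.
Qed.

Lemma rder_uniq_prim F G k A B a b : A < a < B -> A < b < B ->
  (forall x, A < x < B -> rder F x (k x)) -> (forall x, A < x < B -> rder G x (k x)) ->
  F b - F a = G b - G a.
Proof.
move=> aAB bAB hF hG.
suff H x y : A < x < B -> A < y < B -> x <= y -> (F y - G y) - (F x - G x) = 0.
  apply/eqP; rewrite -subr_eq0; apply/eqP.
  have [ab|ba] := leP a b.
    by have := H _ _ aAB bAB ab => h; rewrite -[RHS]h; ring.
  by have := H _ _ bAB aAB (ltW ba) => h; rewrite -oppr0 -h; ring.
move=> xAB yAB xy; apply/eqP; rewrite -mo_eq0; apply/eqP/le_anti; rewrite mo_ge0 andbT.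
have := @mvi (fun t => F t + (- 1) * G t) (fun t => k t + (-1) * k t) 0 x y xy.
rewrite mul0r !mulN1r; apply => t h; last by rewrite mulN1r subrr mo0.
have tAB : A < t < B by lra.
by apply: rderD; [exact: hF|apply: rder_scale; exact: hG].
Qed.

Lemma real_prim (u : R -> R) a b : a < b -> continuous u ->
  exists U : R -> R, forall x, a < x < b -> is_derive x 1 U (u x).
Proof.
move=> ab cu.
exists (fun x => (\int[lebesgue_measure]_(t in [set` Interval (BLeft a) (BRight x)]) (u t))%R).
move=> x /andP[ax xb].
have [|||d1 d2] := @continuous_FTC1 R u (BLeft a) x b xb.
- apply: continuous_compact_integrable; first exact: segment_compact.
  by apply: continuous_subspaceT.
- by rewrite /= lte_fin.
- exact: cu.
by apply: DeriveDef; [exact: d1|rewrite -derive1E].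
Qed.

Lemma cplx_prim (k : R -> C) a b : a < b -> (forall x, rcont k x) ->
  exists F : R -> C, forall x, a < x < b -> rder F x (k x).
Proof.
move=> ab ck.
have [|U HU] := @real_prim (fun x => re (k x)) a b ab.
  move=> x; apply/contRR => e e0; have [d d0 Hd] := ck x e e0.
  by exists d => // y /Hd; apply: le_lt_trans; rewrite -reB re_le.
have [|V HV] := @real_prim (fun x => im (k x)) a b ab.
  move=> x; apply/contRR => e e0; have [d d0 Hd] := ck x e e0.
  by exists d => // y /Hd; apply: le_lt_trans; rewrite -imB im_le.
exists (fun x => rc (U x) + ii * rc (V x)) => x xab.
rewrite [k x]reim; apply: is_derive_rder; [exact: HU|exact: HV].
Qed.

End Deriv.

(** * Goursat's theorem, the exponential and logarithms of nonzero numbers *)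

Section Goursat.
Context {R : realType}.
Local Notation C := (Cx R).
Implicit Types (z w l : C) (x y e d r : R) (F : R -> C).

Definition pt x y : C := rc x + ii * rc y.

Lemma re_pt x y : re (pt x y) = x.
Proof. by rewrite /pt !reimE; ring. Qed.
Lemma im_pt x y : im (pt x y) = y.
Proof. by rewrite /pt !reimE; ring. Qed.
Lemma pt_eta z : pt (re z) (im z) = z.
Proof. by rewrite /pt -reim. Qed.

Lemma rder_hor (g : C -> C) x y l : hder g (pt x y) l -> rder (fun t => g (pt t y)) x l.
Proof.
move=> h; have := @rder_line _ g (ii * rc y) 1 x l.
rewrite mul1r (_ : _ + _ = pt x y); last by rewrite /pt; ring.
have -> : (fun t => g (ii * rc y + rc t * 1)) = (fun t => g (pt t y)).
  by apply/funext => t; congr (g _); rewrite /pt; ring.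
exact.
Qed.

Lemma rder_ver (g : C -> C) x y l : hder g (pt x y) l -> rder (fun t => g (pt x t)) y (ii * l).
Proof.
move=> h; have := @rder_line _ g (rc x) ii y l.
rewrite (_ : _ + _ = pt x y); last by rewrite /pt; ring.
have -> : (fun t => g (rc x + rc t * ii)) = (fun t => g (pt x t)).
  by apply/funext => t; congr (g _); rewrite /pt; ring.
exact.
Qed.

Lemma le_eps (a c : R) : 0 <= c -> (forall e, 0 < e -> a <= e * c) -> a <= 0.
Proof.
move=> c0 H; rewrite leNgt; apply/negP => a0.
have := H (a / (2 * (c + 1))); rewrite divr_gt0 ?mulr_gt0 //; last by lra.
move=> /(_ isT); rewrite mulrAC ler_pdivlMr; last by lra.
have : 0 <= a * c by rewrite mulr_ge0 // ltW.
lra.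
Qed.

Lemma exp2_big (S d : R) : 0 < d -> exists n, S / 2 ^+ n < d.
Proof.
move=> d0; exists (Num.bound (S / d)).
rewrite ltr_pdivrMr ?exprn_gt0 // mulrC -ltr_pdivrMr //.
have [S0|S0] := leP 0 (S / d); last by apply: (lt_trans S0); rewrite exprn_gt0.
apply: (lt_trans (archi_boundP S0)).
by rewrite -natrX ltr_nat ltn_expl.
Qed.

Section Rect.
Variables (N : R) (g : C -> C) (FH FV : R -> R -> C).
Hypothesis HFH : forall y x, - N < x < N -> rder (FH y) x (g (pt x y)).
Hypothesis HFV : forall x y, - N < y < N -> rder (FV x) y (g (pt x y)).

(** The counterclockwise integral of [g] over the boundary of a rectangle, each side evaluated
    through a primitive along its line. *)
Let J x1 x2 y1 y2 : C := (FH y1 x2 - FH y1 x1) - (FH y2 x2 - FH y2 x1)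
  + ii * ((FV x2 y2 - FV x2 y1) - (FV x1 y2 - FV x1 y1)).

(** A primitive of [al + be * z]. Its increments around a rectangle add up to zero, so [J] depends
    on [g] only modulo affine functions. *)
Let A (al be z : C) : C := al * z + be * (z * z / 2).

Lemma hder_A al be z : hder (A al be) z (al + be * z).
Proof.
have -> : al + be * z = (al * 1 + be * (2^-1 * (1 * z + z * 1))).
  by field.
rewrite (_ : A al be = fun z => al * z + be * (2^-1 * (z * z))); last first.
  by apply/funext => t; rewrite /A; field.
apply: hderD; first by apply: hderZ; exact: hder_id.
by do 2 apply: hderZ; apply: hderM; exact: hder_id.
Qed.

Lemma sideH_le al be eta y a b : - N < a -> a <= b -> b < N ->
  (forall t, a <= t <= b -> modulus (g (pt t y) - (al + be * pt t y)) <= eta) ->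
  modulus ((FH y b - FH y a) - (A al be (pt b y) - A al be (pt a y))) <= eta * (b - a).
Proof.
move=> Na ab bN H.
rewrite (_ : _ - _ = (FH y b + (-1) * A al be (pt b y)) - (FH y a + (-1) * A al be (pt a y))); last by ring.
apply: (@mvi _ (fun t => FH y t + (-1) * A al be (pt t y)) (fun t => g (pt t y) + (-1) * (al + be * pt t y))) => // t tab.
  apply: rderD; first by apply: HFH; lra.
  by apply: rder_scale; apply: rder_hor; exact: hder_A.
by rewrite mulN1r; exact: H.
Qed.

Lemma sideV_le al be eta x a b : - N < a -> a <= b -> b < N ->
  (forall t, a <= t <= b -> modulus (g (pt x t) - (al + be * pt x t)) <= eta) ->
  modulus (ii * (FV x b - FV x a) - (A al be (pt x b) - A al be (pt x a))) <= eta * (b - a).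
Proof.
move=> Na ab bN H.
rewrite (_ : _ - _ = (ii * FV x b + (-1) * A al be (pt x b)) - (ii * FV x a + (-1) * A al be (pt x a))); last by ring.
apply: (@mvi _ (fun t => ii * FV x t + (-1) * A al be (pt x t)) (fun t => ii * g (pt x t) + (-1) * (ii * (al + be * pt x t)))) => // t tab.
  apply: rderD; first by apply: rder_scale; apply: HFV; lra.
  by apply: rder_scale; apply: rder_ver; exact: hder_A.
rewrite (_ : _ + _ = ii * (g (pt x t) - (al + be * pt x t))); last by ring.
by rewrite moM mo_ii mul1r; exact: H.
Qed.

Lemma J_le al be eta x1 x2 y1 y2 : - N < x1 -> x1 <= x2 -> x2 < N -> - N < y1 -> y1 <= y2 -> y2 < N ->
  (forall x y, x1 <= x <= x2 -> y1 <= y <= y2 -> modulus (g (pt x y) - (al + be * pt x y)) <= eta) ->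
  modulus (J x1 x2 y1 y2) <= eta * (2 * (x2 - x1) + 2 * (y2 - y1)).
Proof.
move=> N1 x12 N2 N3 y12 N4 H.
have h1 := @sideH_le al be eta y1 x1 x2 N1 x12 N2 (fun t h => H t y1 h _).
have h2 := @sideH_le al be eta y2 x1 x2 N1 x12 N2 (fun t h => H t y2 h _).
have h3 := @sideV_le al be eta x1 y1 y2 N3 y12 N4 (fun t h => H x1 t _ h).
have h4 := @sideV_le al be eta x2 y1 y2 N3 y12 N4 (fun t h => H x2 t _ h).
move: h1 h2 h3 h4; rewrite !lexx x12 y12 /= => /(_ isT) h1 /(_ isT) h2 /(_ isT) h3 /(_ isT) h4.
set a1 := (X in modulus X <= _) in h1; set a2 := (X in modulus X <= _) in h2.
set a3 := (X in modulus X <= _) in h3; set a4 := (X in modulus X <= _) in h4.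
have -> : J x1 x2 y1 y2 = (a1 - a2) + (a4 - a3) by rewrite /J /a1 /a2 /a3 /a4; ring.
have := moD (a1 - a2) (a4 - a3); have := moB a1 a2; have := moB a4 a3; lra.
Qed.

Let half (a b : R) := (a + b) / 2.

Lemma J_quarter x1 x2 y1 y2 (c : R) : c <= modulus (J x1 x2 y1 y2) ->
  let xm := half x1 x2 in let ym := half y1 y2 in
  [\/ c / 4 <= modulus (J x1 xm y1 ym), c / 4 <= modulus (J xm x2 y1 ym),
      c / 4 <= modulus (J x1 xm ym y2) | c / 4 <= modulus (J xm x2 ym y2)].
Proof.
move=> h xm ym.
have E : J x1 x2 y1 y2 = (J x1 xm y1 ym + J xm x2 y1 ym) + (J x1 xm ym y2 + J xm x2 ym y2).
  by rewrite /J; ring.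
move: h; rewrite E => h.
have := moD (J x1 xm y1 ym + J xm x2 y1 ym) (J x1 xm ym y2 + J xm x2 ym y2).
have := moD (J x1 xm y1 ym) (J xm x2 y1 ym); have := moD (J x1 xm ym y2) (J xm x2 ym y2).
case: (leP (c / 4) (modulus (J x1 xm y1 ym))) => [?|?]; first by constructor 1.
case: (leP (c / 4) (modulus (J xm x2 y1 ym))) => [?|?]; first by constructor 2.
case: (leP (c / 4) (modulus (J x1 xm ym y2))) => [?|?]; first by constructor 3.
case: (leP (c / 4) (modulus (J xm x2 ym y2))) => [?|?]; first by constructor 4.
lra.
Qed.

Lemma nested (u v : nat -> R) : (forall n, u n <= u n.+1) -> (forall n, v n.+1 <= v n) ->
  (forall n, u n <= v n) -> exists x, forall n, u n <= x <= v n.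
Proof.
move=> uu vv uv.
have um n k : u n <= u (n + k)%N.
  by elim: k => [|k IH]; rewrite ?addn0 // addnS (le_trans IH).
have vm n k : v (n + k)%N <= v n.
  by elim: k => [|k IH]; rewrite ?addn0 // addnS (le_trans _ IH).
have uv' n m : u n <= v m.
  by apply: (le_trans (um n m)); apply: (le_trans (uv _)); rewrite addnC.
have sR : has_sup (range u) by split; [exists (u 0%N), 0%N|exists (v 0%N) => _ [n _ <-]].
exists (sup (range u)) => n; apply/andP; split.
  by apply: sup_upper_bound => //; exists n.
apply: ge_sup; first by exists (u 0%N), 0%N.
by move=> _ [m _ <-].
Qed.

(** Bisection: some quarter keeps at least a quarter of [|J|]. At the common point of the nested
    rectangles [g] differs from its tangent by at most [e] times the distance, so [|J|] is there at
    most [e] times a multiple of the squared size, which shrinks at the same rate [4 ^- n]. *)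
Lemma goursat_le x1 x2 y1 y2 : - N < x1 -> x1 <= x2 -> x2 < N -> - N < y1 -> y1 <= y2 -> y2 < N ->
  (forall x y, x1 <= x <= x2 -> y1 <= y <= y2 -> exists l, hder g (pt x y) l) ->
  J x1 x2 y1 y2 = 0.
Proof.
move=> N1 x12 N2 N3 y12 N4 hg; set c := modulus (J x1 x2 y1 y2).
pose P n (q : R * R * R * R) := let: (a, b, p, s) := q in
  [/\ c / 4 ^+ n <= modulus (J a b p s), b - a = (x2 - x1) / 2 ^+ n & s - p = (y2 - y1) / 2 ^+ n].
pose S (q q' : R * R * R * R) := let: (a, b, p, s) := q in let: (a', b', p', s') := q' in
  [/\ a <= a' , b' <= b, p <= p' & s' <= s].
have step n (q : R * R * R * R) : {q' | P n q -> P n.+1 q' /\ S q q'}.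
  apply/cid; have [Pq|nP] := EM (P n q); last by exists q.
  case: q Pq => [[[a b] p] s] [h1 h2 h3].
  have ab : a <= b by rewrite -subr_ge0 h2 divr_ge0 ?exprn_ge0 // subr_ge0.
  have ps : p <= s by rewrite -subr_ge0 h3 divr_ge0 ?exprn_ge0 // subr_ge0.
  have e4 : c / 4 ^+ n.+1 = c / 4 ^+ n / 4 by rewrite exprSr; field; rewrite expf_eq0 /=; lra.
  have e2 (t : R) : t / 2 ^+ n.+1 = t / 2 ^+ n / 2 by rewrite exprSr; field; rewrite expf_eq0 /=; lra.
  have hl (x y t : R) : x <= y -> y - x = t -> [/\ x <= half x y, half x y <= y, half x y - x = t / 2 & y - half x y = t / 2].
    by move=> xy <-; rewrite /half; split; lra.
  have [a1 a2 a3 a4] := hl _ _ _ ab h2; have [p1 p2 p3 p4] := hl _ _ _ ps h3.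
  case: (J_quarter h1) => h; rewrite /P e4 !e2.
  - by exists (a, half a b, p, half p s) => _; split.
  - by exists (half a b, b, p, half p s) => _; split.
  - by exists (a, half a b, half p s, s) => _; split.
  - by exists (half a b, b, half p s, s) => _; split.
pose Q := fix Q n := if n is k.+1 then sval (step k (Q k)) else (x1, x2, y1, y2).
have PQ n : P n (Q n).
  elim: n => [|n IH]; first by rewrite /P /= !expr0 !divr1.
  by rewrite /=; case: (step n (Q n)) => q' /= /(_ IH)[].
have SQ n : S (Q n) (Q n.+1).
  by rewrite [Q n.+1]/=; case: (step n (Q n)) => q' /= /(_ (PQ n))[].
pose qa n := (Q n).1.1.1; pose qb n := (Q n).1.1.2; pose qp n := (Q n).1.2; pose qs n := (Q n).2.
have EQ n : Q n = (qa n, qb n, qp n, qs n) by rewrite /qa /qb /qp /qs; case: (Q n) => [[[]]].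
have Pn n : [/\ c / 4 ^+ n <= modulus (J (qa n) (qb n) (qp n) (qs n)), qb n - qa n = (x2 - x1) / 2 ^+ n & qs n - qp n = (y2 - y1) / 2 ^+ n].
  by have := PQ n; rewrite EQ.
have Sn n : [/\ qa n <= qa n.+1 , qb n.+1 <= qb n, qp n <= qp n.+1 & qs n.+1 <= qs n].
  by have := SQ n; rewrite !EQ.
have ab n : qa n <= qb n.
  by have [_ h _] := Pn n; rewrite -subr_ge0 h divr_ge0 ?exprn_ge0 // subr_ge0.
have ps n : qp n <= qs n.
  by have [_ _ h] := Pn n; rewrite -subr_ge0 h divr_ge0 ?exprn_ge0 // subr_ge0.
have [|||xs Hx] := @nested qa qb; [by move=> n; have [] := Sn n|by move=> n; have [] := Sn n|by []|].
have [|||ys Hy] := @nested qp qs; [by move=> n; have [] := Sn n|by move=> n; have [] := Sn n|by []|].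
have [l hl] := hg xs ys (Hx 0%N) (Hy 0%N).
pose W := (x2 - x1) + (y2 - y1).
have W0 : 0 <= W by rewrite /W; lra.
suff : c <= 0.
  by move=> c0; apply/eqP; rewrite -mo_eq0; apply/eqP/le_anti; rewrite c0 mo_ge0.
apply: (@le_eps _ (2 * W ^+ 2)); first by rewrite mulr_ge0 // sqr_ge0.
move=> e e0; have [d d0 Hd] := hl e e0.
have [n nd] := exp2_big W d0.
have [h1 h2 h3] := Pn n.
have pn : 0 < 2 ^+ n :> R by rewrite exprn_gt0.
have aN k : x1 <= qa k by elim: k => [|k IH] //; have [? _ _ _] := Sn k; lra.
have bN k : qb k <= x2 by elim: k => [|k IH] //; have [_ ? _ _] := Sn k; lra.
have pN k : y1 <= qp k by elim: k => [|k IH] //; have [_ _ ? _] := Sn k; lra.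
have sN k : qs k <= y2 by elim: k => [|k IH] //; have [_ _ _ ?] := Sn k; lra.
have bd x y : qa n <= x <= qb n -> qp n <= y <= qs n ->
    modulus (g (pt x y) - ((g (pt xs ys) - l * pt xs ys) + l * pt x y)) <= e * (W / 2 ^+ n).
  move=> hx hy; have := Hx n; have := Hy n => hys hxs.
  have m1 : modulus (pt x y - pt xs ys) <= W / 2 ^+ n.
    apply: (le_trans (mo_le _)); rewrite reB imB !re_pt !im_pt /W mulrDl -h2 -h3.
    by apply: lerD; rewrite ler_norml; lra.
  have := Hd _ (le_lt_trans m1 nd).
  rewrite (_ : pt xs ys + (pt x y - pt xs ys) = pt x y); last by ring.
  move=> h.
  rewrite (_ : g (pt x y) - _ = g (pt x y) - g (pt xs ys) - (pt x y - pt xs ys) * l); last by ring.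
  by apply: (le_trans h); rewrite ler_pM2l.
have /= := @J_le _ _ _ _ _ _ _ _ (ab n) _ _ (ps n) _ bd.
have -> : - N < qa n by have := aN n; lra.
have -> : qb n < N by have := bN n; lra.
have -> : - N < qp n by have := pN n; lra.
have -> : qs n < N by have := sN n; lra.
move=> /(_ isT isT isT isT) H.
have : c / 4 ^+ n <= e * (2 * W ^+ 2) / 4 ^+ n.
  apply: (le_trans h1); apply: (le_trans H); rewrite h2 h3.
  have -> : 4 ^+ n = 2 ^+ n * 2 ^+ n :> R by rewrite -exprMn; congr (_ ^+ n); lra.
  by rewrite /W le_eqVlt; apply/orP; left; apply/eqP; field; lra.
by rewrite ler_pM2r // invr_gt0 exprn_gt0.
Qed.

Lemma goursat x1 x2 y1 y2 : - N < x1 < N -> - N < x2 < N -> - N < y1 < N -> - N < y2 < N ->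
  (forall x y, Num.min x1 x2 <= x <= Num.max x1 x2 -> Num.min y1 y2 <= y <= Num.max y1 y2 ->
     exists l, hder g (pt x y) l) ->
  J x1 x2 y1 y2 = 0.
Proof.
move=> /andP[? ?] /andP[? ?] /andP[? ?] /andP[? ?].
case: (leP x1 x2) => hx; case: (leP y1 y2) => hy H.
- exact: goursat_le.
- have := @goursat_le x1 x2 y2 y1; rewrite hx (ltW hy) => G.
  have -> : J x1 x2 y1 y2 = - J x1 x2 y2 y1 by rewrite /J; ring.
  by rewrite G ?oppr0.
- have := @goursat_le x2 x1 y1 y2; rewrite hy (ltW hx) => G.
  have -> : J x1 x2 y1 y2 = - J x2 x1 y1 y2 by rewrite /J; ring.
  by rewrite G ?oppr0.
- have := @goursat_le x2 x1 y2 y1; rewrite (ltW hy) (ltW hx) => G.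
  have -> : J x1 x2 y1 y2 = J x2 x1 y2 y1 by rewrite /J; ring.
  by rewrite G.
Qed.

Lemma sideH al eta y a b : - N < a < N -> - N < b < N ->
  (forall t, Num.min a b <= t <= Num.max a b -> modulus (g (pt t y) - al) <= eta) ->
  modulus ((FH y b - FH y a) - rc (b - a) * al) <= eta * `|b - a|.
Proof.
move=> /andP[? ?] /andP[? ?].
have E p q : A al 0 (pt p y) - A al 0 (pt q y) = rc (p - q) * al.
  by rewrite /A /pt !rcB; ring.
case: (leP a b) => h H.
  have := @sideH_le al 0 eta y a b; rewrite E ger0_norm ?subr_ge0 //; apply => // t ht.
  by rewrite mul0r addr0; exact: H.
have := @sideH_le al 0 eta y b a; rewrite E ltr0_norm ?subr_lt0 // opprB => G.
rewrite -moN (_ : - _ = FH y a - FH y b - rc (a - b) * al); last by rewrite !rcB; ring.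
apply: G => // [|t ht]; first exact: ltW.
by rewrite mul0r addr0; exact: H.
Qed.

Lemma sideV al eta x a b : - N < a < N -> - N < b < N ->
  (forall t, Num.min a b <= t <= Num.max a b -> modulus (g (pt x t) - al) <= eta) ->
  modulus (ii * (FV x b - FV x a) - ii * rc (b - a) * al) <= eta * `|b - a|.
Proof.
move=> /andP[? ?] /andP[? ?].
have E p q : A al 0 (pt x p) - A al 0 (pt x q) = ii * rc (p - q) * al.
  by rewrite /A /pt !rcB; ring.
case: (leP a b) => h H.
  have := @sideV_le al 0 eta x a b; rewrite E ger0_norm ?subr_ge0 //; apply => // t ht.
  by rewrite mul0r addr0; exact: H.
have := @sideV_le al 0 eta x b a; rewrite E ltr0_norm ?subr_lt0 // opprB => G.
rewrite -moN (_ : - _ = ii * (FV x a - FV x b) - ii * rc (a - b) * al); last by rewrite !rcB; ring.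
apply: G => // [|t ht]; first exact: ltW.
by rewrite mul0r addr0; exact: H.
Qed.

End Rect.
End Goursat.

Section BoxPrim.
Context {R : realType}.
Local Notation C := (Cx R).
Implicit Types (z w l : C) (x y e d r : R) (g : C -> C).

Definition clampR (a b t : R) : R := Num.max a (Num.min b t).

Lemma clampR_lip a b s t : `|clampR a b s - clampR a b t| <= `|s - t|.
Proof.
rewrite /clampR ler_norml; have := ler_norm (s - t); have := ler_norm (- (s - t)); rewrite normrN.
by case: (leP b s) => ?; case: (leP b t) => ?; rewrite /Num.max; do ?case: ifPn; lra.
Qed.

Lemma clampR_in a b t : a <= b -> a <= clampR a b t <= b.
Proof.
by move=> ab; rewrite /clampR; case: (leP b t) => ?; rewrite /Num.max; do ?case: ifPn; lra.
Qed.

Lemma clampR_id a b t : a <= t <= b -> clampR a b t = t.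
Proof.
by move=> ab; rewrite /clampR; case: (leP b t) => ?; rewrite /Num.max; do ?case: ifPn; lra.
Qed.

Lemma minmax_in a b x x' s : a < x < b -> a < x' < b ->
  Num.min x x' <= s <= Num.max x x' -> a < s < b.
Proof. by move=> h1 h2; case: (leP x x') => ?; lra. Qed.

Lemma minmax_dist x x' t : Num.min x x' <= t <= Num.max x x' -> `|t - x| <= `|x' - x|.
Proof.
case: (leP x x') => h1 h2; first by rewrite !ger0_norm; lra.
by rewrite !ler0_norm; lra.
Qed.

Lemma box_nbhd x1 x2 y1 y2 z : x1 < re z < x2 -> y1 < im z < y2 ->
  exists2 r, 0 < r & forall w, modulus (w - z) < r -> x1 < re w < x2 /\ y1 < im w < y2.
Proof.
move=> /andP[a1 a2] /andP[a3 a4].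
exists (Num.min (Num.min (re z - x1) (x2 - re z)) (Num.min (im z - y1) (y2 - im z))).
  by rewrite !lt_min !subr_gt0 a1 a2 a3 a4.
move=> w; rewrite !lt_min => /andP[/andP[q1 q2] /andP[q3 q4]].
have := re_le (w - z); have := im_le (w - z).
rewrite reB imB !ler_norml => /andP[? ?] /andP[? ?].
by split; apply/andP; split; lra.
Qed.

Lemma box_prim g x1 x2 y1 y2 :
  (forall z, x1 <= re z <= x2 -> y1 <= im z <= y2 -> exists l, hder g z l) ->
  exists Q, forall z, x1 < re z < x2 -> y1 < im z < y2 -> hder Q z (g z).
Proof.
move=> hg.
have [x12|x12] := leP x2 x1; first by exists g => z h; lra.
have [y12|y12] := leP y2 y1; first by exists g => z _ h; lra.
(* Clamping to the box extends [g] continuously to the plane, as [cplx_prim] asks for continuity on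
   whole lines. *)
pose cl z : C := pt (clampR x1 x2 (re z)) (clampR y1 y2 (im z)).
pose gt z := g (cl z).
have clcont z w : modulus (cl z - cl w) <= 2 * modulus (z - w).
  apply: (le_trans (mo_le _)); rewrite reB imB /cl !re_pt !im_pt.
  have := clampR_lip x1 x2 (re z) (re w); have := clampR_lip y1 y2 (im z) (im w).
  rewrite -reB -imB; have := re_le (z - w); have := im_le (z - w); lra.
have gtc z : ccont gt z.
  move=> e e0; have [||l hl] := hg (cl z).
  - by rewrite re_pt; apply: clampR_in; lra.
  - by rewrite im_pt; apply: clampR_in; lra.
  have [d d0 Hd] := hder_cont hl e0.
  exists (d / 2); first lra.
  move=> w hw; apply: Hd; have := clcont w z; lra.
have gtE z : x1 < re z < x2 -> y1 < im z < y2 -> gt z = g z.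
  move=> hx hy; rewrite /gt /cl !clampR_id ?pt_eta //; lra.
pose N := `|x1| + `|x2| + `|y1| + `|y2| + 1.
have Nx1 : - N < x1 < N by rewrite -ltr_norml /N; have := normr_ge0 x2; have := normr_ge0 y1; have := normr_ge0 y2; lra.
have Nx2 : - N < x2 < N by rewrite -ltr_norml /N; have := normr_ge0 x1; have := normr_ge0 y1; have := normr_ge0 y2; lra.
have Ny1 : - N < y1 < N by rewrite -ltr_norml /N; have := normr_ge0 x2; have := normr_ge0 x1; have := normr_ge0 y2; lra.
have Ny2 : - N < y2 < N by rewrite -ltr_norml /N; have := normr_ge0 x2; have := normr_ge0 y1; have := normr_ge0 x1; lra.
have NN : - N < N by lra.
have mpt x x' y y' : modulus (pt x y - pt x' y') <= `|x - x'| + `|y - y'|.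
  by apply: (le_trans (mo_le _)); rewrite reB imB !re_pt !im_pt.
have exH y : {F : R -> C | forall x, - N < x < N -> rder F x (gt (pt x y))}.
  apply/cid/cplx_prim => // x e e0; have [d d0 Hd] := gtc (pt x y) e e0.
  by exists d => // x' h; apply: Hd; apply: le_lt_trans (mpt _ _ _ _) _; rewrite subrr normr0 addr0.
have exV x : {F : R -> C | forall y, - N < y < N -> rder F y (gt (pt x y))}.
  apply/cid/cplx_prim => // y e e0; have [d d0 Hd] := gtc (pt x y) e e0.
  by exists d => // x' h; apply: Hd; apply: le_lt_trans (mpt _ _ _ _) _; rewrite subrr normr0 add0r.
pose FH y := sval (exH y); pose FV x := sval (exV x).
have HFH y x : - N < x < N -> rder (FH y) x (gt (pt x y)) by exact: (svalP (exH y)).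
have HFV x y : - N < y < N -> rder (FV x) y (gt (pt x y)) by exact: (svalP (exV x)).
pose b1 := (x1 + x2) / 2; pose b2 := (y1 + y2) / 2.
(* Integration from [(b1, b2)] along a horizontal and then a vertical segment. *)
exists (fun z => (FH b2 (re z) - FH b2 b1) + ii * (FV (re z) (im z) - FV (re z) b2)).
move=> z hx hy e e0.
have e4 : 0 < e / 4 by lra.
have [d d0 Hd] := gtc z _ e4.
have [r r0 Hr] := box_nbhd hx hy.
have bN t : x1 < t < x2 -> - N < t < N by clear -Nx1 Nx2; move=> /andP[? ?]; apply/andP; split; lra.
have bN' t : y1 < t < y2 -> - N < t < N by clear -Ny1 Ny2; move=> /andP[? ?]; apply/andP; split; lra.
clearbody N.
exists (Num.min (d / 2) r); first by rewrite lt_min r0 andbT; clear -d0; lra.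
move=> h; rewrite lt_min => /andP[hd hr].
have zh : modulus (z + h - z) < r by rewrite (_ : z + h - z = h) //; ring.
have [bx' by'] := Hr _ zh.
set x := re z; set y := im z; set x' := re (z + h); set y' := im (z + h).
have hre : x' - x = re h by rewrite /x' /x reD; ring.
have him : y' - y = im h by rewrite /y' /y imD; ring.
have reh := re_le h; have imh := im_le h.
have bx : x1 < x < x2 by [].
have by_ : y1 < y < y2 by [].
have bb1 : x1 < b1 < x2 by clear -x12; rewrite /b1; apply/andP; split; lra.
have bb2 : y1 < b2 < y2 by clear -y12; rewrite /b2; apply/andP; split; lra.
clearbody b1 b2.
(* By Goursat the increment of the primitive from [z] to [z + h] is also the integral from [z]
   vertically to height [y'] and then across: two short sides, on which [gt] is close to [gt z]. *)
have := @goursat _ N gt FH FV HFH HFV x x' b2 y'.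
move=> /(_ (bN _ bx) (bN _ bx') (bN' _ bb2) (bN' _ by')) G.
have {}G : FH b2 x' - FH b2 x - (FH y' x' - FH y' x) + ii * (FV x' y' - FV x' b2 - (FV x y' - FV x b2)) = 0.
  apply: G => s t hs ht.
  have bs := minmax_in bx bx' hs; have bt := minmax_in bb2 by' ht.
  have [||l hl] := hg (pt s t); rewrite ?re_pt ?im_pt.
  - by case/andP: bs => ? ?; rewrite !ltW.
  - by case/andP: bt => ? ?; rewrite !ltW.
  exists l; have [||q q0 Hq] := @box_nbhd x1 x2 y1 y2 (pt s t); rewrite ?re_pt ?im_pt //.
  by apply: (hder_eqnear q0 _ hl) => w /Hq[? ?]; exact: gtE.
have sH := @sideH _ N gt FH HFH (gt z) (e / 4) y' x x'.
have sV := @sideV _ N gt FV HFV (gt z) (e / 4) x y y'.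
have {}sH : modulus (FH y' x' - FH y' x - rc (x' - x) * gt z) <= e / 4 * `|x' - x|.
  apply: sH; [exact: bN|exact: bN|] => t ht; apply/ltW/Hd.
  rewrite -(pt_eta z); apply: le_lt_trans (mpt _ _ _ _) _.
  rewrite him; have := minmax_dist ht; rewrite hre; clear -hd reh imh; lra.
have {}sV : modulus (ii * (FV x y' - FV x y) - ii * rc (y' - y) * gt z) <= e / 4 * `|y' - y|.
  apply: sV; [exact: bN'|exact: bN'|] => t ht; apply/ltW/Hd.
  rewrite -(pt_eta z); apply: le_lt_trans (mpt _ _ _ _) _.
  rewrite subrr normr0 add0r; have := minmax_dist ht; rewrite him; clear -hd reh imh.
  have := mo_ge0 h; lra.
rewrite -(gtE z) //.
rewrite (_ : _ - _ = (FH y' x' - FH y' x - rc (x' - x) * gt z) + (ii * (FV x y' - FV x y) - ii * rc (y' - y) * gt z)).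
  apply: (le_trans (moD _ _)); rewrite hre him in sH sV *; have : 0 <= e / 4 * modulus h by rewrite mulr_ge0 ?mo_ge0 // ltW.
  have : e / 4 * `|re h| <= e / 4 * modulus h by rewrite ler_pM2l.
  have : e / 4 * `|im h| <= e / 4 * modulus h by rewrite ler_pM2l.
  clear -sH sV; lra.
rewrite hre him -[LHS]addr0 -oppr0 -G [in h * gt z](reim h); ring.
Qed.

End BoxPrim.

Section Exp.
Context {R : realType}.
Local Notation C := (Cx R).
Implicit Types (z w l : C) (x y e d r : R) (g : C -> C).

Definition cis y : C := rc (cos y) + ii * rc (sin y).
Definition cexp z : C := rc (expR (re z)) * cis (im z).

Lemma cisD x y : cis (x + y) = cis x * cis y.
Proof. by apply: C_ext; rewrite /cis !reimE ?cosD ?sinD; ring. Qed.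

Lemma cexpD z w : cexp (z + w) = cexp z * cexp w.
Proof. by rewrite /cexp reD imD expRD cisD rcM; ring. Qed.

Lemma mo_cis y : modulus (cis y) = 1.
Proof.
apply/eqP; rewrite -(@eqrXn2 _ 2) ?mo_ge0 // mo_sqr expr1n /cis !reimE; apply/eqP.
by rewrite -[RHS](cos2Dsin2 y); ring.
Qed.

Lemma mo_cexp z : modulus (cexp z) = expR (re z).
Proof. by rewrite /cexp moM mo_cis mulr1 mo_rc ger0_norm // expR_ge0. Qed.

Lemma cexp_neq0 z : cexp z != 0.
Proof. by rewrite -mo_gt0 mo_cexp expR_gt0. Qed.

Lemma cis0 : cis 0 = 1.
Proof. by rewrite /cis cos0 sin0 rc0 rc1; ring. Qed.

Lemma cexp0 : cexp 0 = 1.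
Proof. by rewrite /cexp re0 im0 expR0 cis0 rc1 mul1r. Qed.

Lemma cexpN z : cexp (- z) = (cexp z)^-1.
Proof.
apply: (mulfI (cexp_neq0 z)); rewrite -cexpD subrr cexp0 divff //; exact: cexp_neq0.
Qed.

Lemma cexp_pt x y : cexp (pt x y) = rc (expR x) * cis y.
Proof. by rewrite /cexp re_pt im_pt. Qed.

Lemma cis_2pi : cis (pi *+ 2) = 1.
Proof. by rewrite /cis cos2pi sin2pi rc0 rc1; ring. Qed.

Lemma cexp_hder0 e : 0 < e -> exists2 d, 0 < d & forall h, modulus h < d ->
  modulus (cexp h - 1 - h) <= e * modulus h.
Proof.
(* The three error terms below are at most 6, 1 and 2 times [e' * modulus h]. *)
move=> e0; pose e' := Num.min 1 (e / 10).
have e'0 : 0 < e' by rewrite /e' lt_min ltr01; lra.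
have e'1 : e' <= 1 by rewrite /e' ge_min lexx.
have e'2 : e' <= e / 10 by rewrite /e' ge_min lexx orbT.
clearbody e'.
have [d1 d10 H1] := (iffLR (@is_deriveP R (@expR R) 0 _) (is_derive_expR 0)) _ e'0.
have [d2 d20 H2] := (iffLR (@is_deriveP R (@cos R) 0 _) (is_derive_cos 0)) _ e'0.
have [d3 d30 H3] := (iffLR (@is_deriveP R (@sin R) 0 _) (is_derive_sin 0)) _ e'0.
exists (Num.min (Num.min d1 e') (Num.min d2 d3)); first by rewrite !lt_min d10 e'0 d20.
move=> h; rewrite !lt_min => /andP[/andP[h1 he] /andP[h2 h3]].
have rh := re_le h; have ih := im_le h.
have {H1} := H1 _ (le_lt_trans rh h1); have {H2} := H2 _ (le_lt_trans ih h2).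
have {H3} := H3 _ (le_lt_trans ih h3); rewrite !add0r expR0 cos0 sin0 subr0 mulr1 oppr0 mulr0 subr0 mulr1.
set a := re h; set b := im h; set m := modulus h => s c ex.
have em : 0 <= e' * m by rewrite mulr_ge0 ?mo_ge0 // ltW.
have em1 : e' * `|a| <= e' * m by rewrite ler_pM2l.
have em2 : e' * `|b| <= e' * m by rewrite ler_pM2l.
have mm : e' * m <= m by rewrite ler_piMl ?mo_ge0.
have e1 : `|expR a - 1| <= 2 * m.
  rewrite (_ : expR a - 1 = (expR a - 1 - a) + a); last by ring.
  by apply: (le_trans (ler_normD _ _)); rewrite -/a in rh; rewrite -/m in rh; lra.
have mm2 : m * m <= e' * m by rewrite ler_wpM2r ?mo_ge0 // ltW.
have e3 : expR a <= 3 by have := ler_norm (expR a - 1); lra.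
rewrite (_ : cexp h - 1 - h = rc (expR a) * (cis b - 1 - ii * rc b) + rc (expR a - 1 - a) + ii * rc (b * (expR a - 1))); last first.
  have E1 : cexp h = rc (expR a) * cis b by [].
  have E2 : h = rc a + ii * rc b by exact: reim.
  by rewrite E1 [in LHS]E2 !(rcB, rcM) rc1; ring.
apply: (le_trans (moD _ _)); apply: (le_trans (lerD (moD _ _) (lexx _))).
rewrite !moM mo_ii mul1r !mo_rc (ger0_norm (expR_ge0 a)) normrM.
have cb : modulus (cis b - 1 - ii * rc b) <= 2 * (e' * m).
  apply: (le_trans (mo_le _)); rewrite /cis !reimE.
  rewrite (_ : cos b + _ + _ + _ = cos b - 1); last by ring.
  rewrite (_ : 0 + _ + _ + _ = sin b - b); last by ring.
  lra.
have t1 : expR a * modulus (cis b - 1 - ii * rc b) <= 3 * (2 * (e' * m)).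
  by apply: ler_pM; rewrite ?expR_ge0 ?mo_ge0.
have t2 : `|b| * `|expR a - 1| <= m * (2 * m) by apply: ler_pM.
have : e' * m <= e / 10 * m by rewrite ler_wpM2r ?mo_ge0.
lra.
Qed.

Lemma hder_cexp z : hder cexp z (cexp z).
Proof.
move=> e e0; have m0 : 0 < modulus (cexp z) by rewrite mo_gt0 cexp_neq0.
have [|d d0 Hd] := @cexp_hder0 (e / modulus (cexp z)); first by rewrite divr_gt0.
exists d => // h /Hd H; rewrite cexpD (_ : _ - _ = cexp z * (cexp h - 1 - h)); last by ring.
by rewrite moM mulrC -ler_pdivlMr // mulrAC.
Qed.

(** The range of the argument matters in [circle_bound], where all points of one circle need
    logarithms at bounded distance. *)
Lemma cexp_ln (w : C) : w != 0 -> exists t, - pi <= t <= pi /\ w = cexp (pt (ln (modulus w)) t).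
Proof.
move=> w0; have m0 : 0 < modulus w by rewrite mo_gt0.
pose c := re w / modulus w; pose s := im w / modulus w.
have cs : c ^+ 2 + s ^+ 2 = 1.
  by rewrite /c /s !expr_div_n -mulrDl -mo_sqr divff // expf_neq0 // mo_eq0.
have c1 : -1 <= c <= 1.
  have := sqr_ge0 s => s2; have : c ^+ 2 <= 1 by lra.
  by clear; move=> h; apply/andP; split; nra.
have wE : w = rc (modulus w) * (rc c + ii * rc s).
  by apply: C_ext; rewrite !reimE /c /s; field; lra.
have ca : cos (acos c) = c by rewrite acosK // in_itv.
have sa : sin (acos c) = `|s|.
  by rewrite sin_acos // -cs addrC addKr sqrtr_sqr.
have pi0 := @pi_ge0 R.
have ac0 := acos_ge0 c1; have acpi := acos_lepi c1.
exists (if 0 <= s then acos c else - acos c); split; first by case: ifP => _; lra.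
rewrite cexp_pt lnK ?posrE // {1}wE; congr (_ * _); rewrite /cis; case: ifPn => [s0|].
  by rewrite ca sa ger0_norm.
by rewrite -ltNge => s0; rewrite cosN sinN ca sa ltr0_norm // opprK.
Qed.

End Exp.

(** * Maximum principle and Lipschitz bounds *)

Section Mvp.
Context {R : realType}.
Local Notation C := (Cx R).
Implicit Types (z w l : C) (x y e d r : R) (g : C -> C).
Let tp : R := pi *+ 2.

Lemma tp_gt0 : 0 < tp.
Proof. by rewrite /tp mulrn_wgt0 // pi_gt0. Qed.

Definition hol (A : set C) g := forall z, A z -> exists l, hder g z l.

(** In the coordinate [a + cexp z] the annulus becomes a rectangle and circles become vertical
    sides. The horizontal sides cancel by periodicity, so the integral over the circle of radius [r]
    equals the one over radius [r0], where [g] is within [eta] of [g a]. *)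
Lemma mvp_aux g a rho r r0 eta : 0 < r0 -> r0 <= r -> r < rho -> hol (D a rho) g ->
  (forall w, modulus (w - a) = r0 -> modulus (g w - g a) <= eta) ->
  exists F : R -> C, (forall t, -1 < t < tp + 1 -> rder F t (g (a + rc r * cis t))) /\
    modulus (F tp - F 0 - rc tp * g a) <= eta * tp.
Proof.
move=> r00 r0r rrho hg He; have r_gt0 : 0 < r by lra.
have lr : ln r0 <= ln r by rewrite ler_ln ?posrE.
have lrho : ln r < ln rho by rewrite ltr_ln ?posrE //; lra.
have tp0 := tp_gt0.
pose G z := g (a + cexp z).
have dG z : re z < ln rho -> exists l, hder G z l.
  move=> hz; have [|l hl] := hg (a + cexp z).
    rewrite /D /= (_ : a + _ - a = cexp z); last by ring.
    by rewrite mo_cexp -(lnK (x := rho)) ?ltr_expR // posrE; lra.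
  exists ((0 + cexp z) * l); apply: (@hder_comp _ (fun z => a + cexp z) g) => //.
  by apply: hderD; [exact: hder_cst|exact: hder_cexp].
have [P HP] : exists P, forall z, ln r0 - 1 < re z < (ln r + ln rho) / 2 -> -1 < im z < tp + 1 -> hder P z (G z).
  apply: box_prim => z /andP[_ h] _; apply: dG; lra.
have Glr s t : 0 < s -> G (pt (ln s) t) = g (a + rc s * cis t).
  by move=> s0; rewrite /G cexp_pt lnK // posrE.
have Gper x : G (pt x tp) = G (pt x 0).
  by rewrite /G !cexp_pt cis_2pi cis0.
exists (fun t => (- ii) * P (pt (ln r) t)); split.
  move=> t ht; rewrite -Glr // (_ : G _ = (- ii) * (ii * G (pt (ln r) t))); last first.
    by rewrite mulrA mulNr iiK opprK mul1r.
  by apply: rder_scale; apply: rder_ver; apply: HP; rewrite ?re_pt ?im_pt //; lra.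
have E1 : P (pt (ln r) tp) - P (pt (ln r) 0) = P (pt (ln r0) tp) - P (pt (ln r0) 0).
  apply/eqP; rewrite -subr_eq0 -mo_eq0; apply/eqP/le_anti; rewrite mo_ge0 andbT.
  have := @mvi _ (fun x => P (pt x tp) + (-1) * P (pt x 0)) (fun x => G (pt x tp) + (-1) * G (pt x 0)) 0 _ _ lr.
  rewrite mul0r !mulN1r; apply => x hx; last by rewrite mulN1r Gper subrr mo0.
  apply: rderD; first by apply: rder_hor; apply: HP; rewrite ?re_pt ?im_pt; lra.
  by apply: rder_scale; apply: rder_hor; apply: HP; rewrite ?re_pt ?im_pt; lra.
rewrite (_ : _ - _ = (- ii) * (P (pt (ln r0) tp) - P (pt (ln r0) 0) - ii * rc tp * g a)); last first.
  rewrite -E1 (_ : rc tp * g a = - (ii * ii) * rc tp * g a); last by rewrite iiK; ring.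
  ring.
rewrite moM moN mo_ii mul1r.
have := @mvi _ (fun t => P (pt (ln r0) t) + (- (ii * g a)) * (0 + rc t * 1)) (fun t => ii * G (pt (ln r0) t) + (- (ii * g a)) * (1 * 1)) eta 0 tp.
rewrite subr0 rc0 (_ : _ - _ = P (pt (ln r0) tp) - P (pt (ln r0) 0) - ii * rc tp * g a); last by ring.
apply => [||t ht]; first exact: ltW.
  move=> t ht; apply: rderD; first by apply: rder_ver; apply: HP; rewrite ?re_pt ?im_pt; lra.
  by apply: rder_scale; apply: (@rder_line _ (fun z => z)); exact: hder_id.
rewrite Glr // (_ : _ + _ = ii * (g (a + rc r0 * cis t) - g a)); last by ring.
rewrite moM mo_ii mul1r; apply: He.
by rewrite (_ : _ - _ = rc r0 * cis t) ?moM ?mo_rc ?mo_cis ?mulr1 ?gtr0_norm //; ring.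
Qed.

Lemma mvp g a rho r : 0 < r -> r < rho -> hol (D a rho) g ->
  exists F : R -> C, (forall t, -1 < t < tp + 1 -> rder F t (g (a + rc r * cis t))) /\
    F tp - F 0 = rc tp * g a.
Proof.
move=> r0 rrho hg; have tp0 := tp_gt0.
have [l hl] : exists l, hder g a l by apply: hg; rewrite /D /= subrr mo0; lra.
have cg := hder_cont hl.
have step e : 0 < e -> exists F : R -> C, (forall t, -1 < t < tp + 1 -> rder F t (g (a + rc r * cis t))) /\
    modulus (F tp - F 0 - rc tp * g a) <= e * tp.
  move=> e0; have [d d0 Hd] := cg e e0.
  apply: (@mvp_aux g a rho r (Num.min r (d / 2))) => //.
  - by rewrite lt_min r0; lra.
  - by rewrite ge_min lexx.
  move=> w E; apply/ltW/Hd; rewrite E gt_min; apply/orP; right; lra.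
have [F [HF _]] := step 1 ltr01; exists F; split => //.
apply/eqP; rewrite -subr_eq0 -mo_eq0; apply/eqP/le_anti; rewrite mo_ge0 andbT.
apply: (@le_eps _ _ tp (ltW tp0)) => e e0; have [F' [HF' h]] := step e e0.
by rewrite (@rder_uniq_prim _ F F' _ (-1) (tp + 1) 0 tp _ _ HF HF') //; lra.
Qed.

(** With [c] of modulus 1 turning [g a] into [M], the function [re (c * g) - M] is nonpositive on
    the circle and has mean zero. Its primitive [p] is monotone with equal end values, hence
    constant. *)
Lemma mvp_max g a rho r M : 0 < r -> r < rho -> hol (D a rho) g ->
  (forall w, modulus (w - a) < rho -> modulus (g w) <= M) -> modulus (g a) = M ->
  forall t, 0 < t < tp -> modulus (g (a + rc r * cis t)) = M.
Proof.
move=> r0 rrho hg gM gaM t ht; have tp0 := tp_gt0.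
have [F [HF FE]] := mvp r0 rrho hg.
have ins s : modulus (a + rc r * cis s - a) < rho.
  by rewrite (_ : _ - a = rc r * cis s) ?moM ?mo_rc ?mo_cis ?mulr1 ?gtr0_norm //; ring.
apply/le_anti; rewrite gM //=.
have [c mc cE] : exists2 c : C, modulus c = 1 & c * g a = rc M.
  have [g0|g0] := eqVneq (g a) 0.
    by exists 1; [exact: mo1|rewrite -gaM g0 mo0 mulr0 rc0].
  exists (rc M / g a); last by rewrite divfK.
  by rewrite moM moV gaM mo_rc ger0_norm -?gaM ?mo_ge0 // divff // mo_eq0.
pose p s := re (c * F s) - M * s.
pose p' s := re (c * g (a + rc r * cis s)) - M.
have dp s : -1 < s < tp + 1 -> is_derive s 1 p (p' s).
  move=> hs; have h1 := rder_re (rder_scale c (HF _ hs)).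
  have h2 : is_derive s 1 (fun s => M * s) (M * 1).
    by apply: is_deriveZ.
  by rewrite /p' -[X in _ - X]mulr1; apply: is_deriveB.
have p'0 s : p' s <= 0.
  by rewrite /p' subr_le0; apply: (le_trans (re_le' _)); rewrite moM mc mul1r gM.
have mono x y : 0 <= x -> x <= y -> y <= tp -> p y <= p x.
  move=> x0 xy yt; have [->|xy'] := eqVneq x y; first by [].
  have lt : x < y by rewrite lt_neqAle xy'.
  have [||z zxy E] := @MVT _ p p' x y lt.
  - by move=> z; rewrite in_itv /= => /andP[h1 h2]; apply: dp; clear -x0 yt tp0 h1 h2; lra.
  - apply: derivable_within_continuous => z; rewrite in_itv /= => /andP[h1 h2].
    by have [|] := dp z => //; clear -x0 yt tp0 h1 h2; lra.
  rewrite -subr_le0 E; apply: mulr_le0_ge0 => //; lra.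
have pE : p tp = p 0.
  have : re (c * (F tp - F 0)) = tp * M.
    rewrite FE (_ : c * _ = rc tp * (c * g a)); last by ring.
    by rewrite cE -rcM re_rc.
  by rewrite mulrBr reB /p mulr0 subr0 => h; lra.
have pc s : 0 <= s <= tp -> p s = p 0.
  by move=> /andP[s0 s1]; apply/le_anti; rewrite mono //= -pE mono.
have p't : p' t = 0.
  have dpt : is_derive t 1 p (p' t) by apply: dp; lra.
  have H := iffLR (is_deriveP p t (p' t)) dpt; apply/eqP; rewrite -normr_eq0; apply/eqP/le_anti; rewrite normr_ge0 andbT.
  apply: (@le_eps _ _ 1) => // e e0; have [d d0 Hd] := H e e0.
  pose k := Num.min (d / 2) (tp - t).
  have k0 : 0 < k by rewrite /k lt_min; apply/andP; split; lra.
  have := Hd k; rewrite gtr0_norm // /k gt_min (_ : d / 2 < d); last by lra.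
  move=> /(_ isT); rewrite !pc; last 2 first.
  - lra.
  - have k1 : k <= tp - t by rewrite /k ge_min lexx orbT.
    by move: k0 k1; rewrite -/k; clear -ht; lra.
  by rewrite subrr sub0r normrN normrM -/k (gtr0_norm k0) mulr1 mulrC ler_pM2r.
move: p't; rewrite /p' => /eqP; rewrite subr_eq0 => /eqP <-.
by apply: (le_trans (re_le' _)); rewrite moM mc mul1r.
Qed.

End Mvp.

Section MaxP.
Context {R : realType}.
Local Notation C := (Cx R).
Implicit Types (z w l : C) (x y e d r : R) (g : C -> C) (A K Om : set C).

Definition bdd A := exists M : R, forall z, A z -> modulus z <= M.

Lemma closure_cx A z : closure A z <-> forall e, 0 < e -> exists2 w, A w & modulus (w - z) < e.
Proof.
split.
- move=> H e e0; have [|w [Aw Dw]] := H (D z e); first by apply/nbhs_cx; exists e.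
  by exists w.
- move=> H W /nbhs_cx[e e0 We]; have [w Aw hw] := H e e0.
  by exists w; split => //; apply: We.
Qed.

Lemma compactC A : bdd A -> closed A -> compact A.
Proof.
move=> [M HM] cA.
pose f (p : R * R) : C := pt p.1 p.2.
have fc : continuous f.
  move=> [x y] W /nbhs_cx[e e0 We].
  have e2 : 0 < e / 2 by lra.
  exists (ball x (e / 2), ball y (e / 2)); first by split; exact: nbhsx_ballx.
  move=> [x' y'] [/= h1 h2]; apply: We; rewrite /D /f /=.
  apply: (le_lt_trans (mo_le _)); rewrite reB imB !re_pt !im_pt.
  by move: h1 h2; rewrite /ball /= distrC => h1; rewrite distrC => h2; lra.
have cK : compact (f @` (`[- M, M]%classic `*` `[- M, M]%classic)).
  apply: continuous_compact; first exact: continuous_subspaceT.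
  by apply: compact_setX; exact: segment_compact.
apply: (subclosed_compact cA cK) => z /HM h; exists (re z, im z); last exact: pt_eta.
by split; rewrite /= in_itv /= -ler_norml; [apply: le_trans (re_le _) _|apply: le_trans (im_le _) _].
Qed.

Lemma closed_closureC A : bdd A -> compact (closure A).
Proof.
move=> [M HM]; apply: compactC; last exact: closed_closure.
exists (M + 1) => z /closure_cx /(_ 1 ltr01)[w Aw h].
have := HM _ Aw; have := mo_subr z w; rewrite mo_sym; lra.
Qed.

Lemma within_cont A (u : C -> R) : (forall z, A z -> forall e, 0 < e -> exists2 d, 0 < d &
   forall w, modulus (w - z) < d -> `|u w - u z| < e) -> {within A, continuous u}.
Proof.
move=> H; apply: continuous_in_subspaceT => z; rewrite inE => Az.
by apply/contCR; exact: H.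
Qed.

Lemma max_attained A (u : C -> R) : A !=set0 -> compact A ->
  (forall z, A z -> forall e, 0 < e -> exists2 d, 0 < d &
   forall w, modulus (w - z) < d -> `|u w - u z| < e) ->
  exists2 c, A c & forall w, A w -> u w <= u c.
Proof.
move=> A0 cA uc; have [c] := compact_EVT_max A0 cA (within_cont uc).
by rewrite inE => Ac H; exists c => // w Aw; apply: H; rewrite inE.
Qed.

Lemma mo_cont g z : ccont g z -> forall e, 0 < e -> exists2 d, 0 < d &
   forall w, modulus (w - z) < d -> `|modulus (g w) - modulus (g z)| < e.
Proof.
move=> cg e e0; have [d d0 Hd] := cg e e0; exists d => // w /Hd h.
apply: le_lt_trans h; rewrite ler_norml mo_subr andbT lerNl opprB mo_sym; exact: mo_subr.
Qed.

(** Take, among the maximum points of [|g|], one with largest real part. If it lay in [Om], [|g|]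
    would also be maximal at points of a small circle around it, some of them with larger real
    part. *)
Lemma max_principle Om g M : open Om -> bdd Om ->
  (forall z, closure Om z -> ccont g z) -> hol Om g ->
  (forall z, closure Om z -> ~ Om z -> modulus (g z) <= M) ->
  forall z, closure Om z -> modulus (g z) <= M.
Proof.
move=> oOm bOm cg hg bM z1 cz1; rewrite leNgt; apply/negP => gz1.
have cK := closed_closureC bOm.
have [z cz zmax] := @max_attained (closure Om) (fun z => modulus (g z)) (ex_intro _ _ cz1) cK (fun z h => mo_cont (cg z h)).
set M0 := modulus (g z) in zmax.
have MM0 : M < M0 by apply: lt_le_trans gz1 _; exact: zmax.
pose A := closure Om `&` [set w | M0 <= modulus (g w)].
have cA : compact A.
  apply: subclosed_compact cK _; last by move=> w [].
  move=> w wA; have cw : closure Om w.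
    by apply: closed_closure; apply: closure_subset wA => ? [].
  split => //=; rewrite leNgt; apply/negP => lt.
  have [|d d0 Hd] := mo_cont (cg w cw) (e := M0 - modulus (g w)); first lra.
  have [v [cv /= v1] v2] := iffLR (closure_cx _ _) wA d d0.
  have := Hd v v2; have := ler_norm (modulus (g v) - modulus (g w)); lra.
have rec w : A w -> forall e, 0 < e -> exists2 d, 0 < d &
    forall v, modulus (v - w) < d -> `|re v - re w| < e.
  by move=> _ e e0; exists e => // v; apply: le_lt_trans; rewrite -reB re_le.
have Az : A z by split => //=.
have [a [ca ga] amax] := max_attained (ex_intro _ z Az) cA rec.
have {}ga : modulus (g a) = M0 by apply/le_anti; rewrite ga zmax.
have Oa : Om a.
  by apply: contrapT => h; have := bM a ca h; rewrite ga; lra.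
have [rho rho0 Hrho] := iffLR (open_cx Om) oOm a Oa.
have pi0 := @pi_gt0 R.
have tE : pi *+ 2 = pi + pi :> R by rewrite mulr2n.
(* Any angle strictly between 0 and [pi / 2] works; [mvp_max] leaves out the angle 0. *)
have := @mvp_max R g a rho (rho / 2) M0 _ _ _ _ ga (pi / 4) _.
set b := a + _ => Hb.
have {}Hb : modulus (g b) = M0.
  apply: Hb; [lra|lra|by move=> w /Hrho; exact: hg| |by rewrite tE; clear -pi0; lra].
  by move=> w h; apply: zmax; apply: subset_closure; exact: Hrho.
have Ob : Om b.
  apply: Hrho; rewrite /D /= /b (_ : _ - a = rc (rho / 2) * cis (pi / 4)); last by ring.
  by rewrite moM mo_rc mo_cis mulr1 gtr0_norm; lra.
have := amax b (conj (subset_closure Ob) _); rewrite /= Hb => /(_ (lexx _)).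
rewrite /b /cis !reimE.
have : 0 < cos (pi / 4 : R) by apply: cos_gt0_pihalf; clear -pi0; lra.
move=> c0; have : 0 < rho / 2 * cos (pi / 4) by rewrite mulr_gt0 //; lra.
lra.
Qed.

End MaxP.

(** * Division by polynomials under the maximum principle *)

Section Cont.
Context {R : realType}.
Local Notation C := (Cx R).
Implicit Types (z w l : C) (x y e d r : R) (g : C -> C) (A K Om : set C).

Lemma ccontP g z : ccont g z <-> {for z, continuous g}.
Proof. exact: iff_sym (cont_cx g z). Qed.

Lemma ccont_cst (a z : C) : ccont (fun=> a) z.
Proof. by move=> e e0; exists 1 => // w _; rewrite subrr mo0. Qed.

Lemma ccontM g f z : ccont g z -> ccont f z -> ccont (fun z => g z * f z) z.
Proof. by move=> /ccontP h1 /ccontP h2; apply/ccontP; exact: (@continuousM C C g f z h1 h2). Qed.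

Lemma ccontX g z n : ccont g z -> ccont (fun z => g z ^+ n) z.
Proof.
move=> cg; elim: n => [|n IH]; first exact: ccont_cst.
by under eq_fun do rewrite exprS; exact: ccontM.
Qed.

Lemma ccontV g z : g z != 0 -> ccont g z -> ccont (fun z => (g z)^-1) z.
Proof. by move=> g0 /ccontP h1; apply/ccontP; exact: (@continuousV C C g z g0 h1). Qed.

Lemma hol_cont A g z : hol A g -> A z -> ccont g z.
Proof. by move=> hg /hg[l /hder_cont]. Qed.

(** Continuity of [u] is enough. In [zdiv] this gives differentiability at a common zero without
    knowing that the quotient is holomorphic there. *)
Lemma hder_zmul u w : ccont u w -> hder (fun z => (z - w) * u z) w (u w).
Proof.
move=> cu e e0; have [d d0 Hd] := cu e e0; exists d => // h hd.
have /Hd : modulus (w + h - w) < d by rewrite (_ : w + h - w = h) //; ring.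
move=> /ltW h1; rewrite (_ : _ - _ = h * (u (w + h) - u w)); last by ring.
by rewrite moM mulrC; apply: ler_wpM2r; rewrite ?mo_ge0.
Qed.

Lemma ccont_quot N w l : hder N w l -> N w = 0 ->
  ccont (fun z => if z == w then l else N z / (z - w)) w.
Proof.
move=> hN N0 e e0; have e2 : 0 < e / 2 by lra.
have [d d0 Hd] := hN _ e2; exists d => // z zd; rewrite eqxx.
case: eqP => [_|/eqP zw]; first by rewrite subrr mo0.
have zw0 : z - w != 0 by rewrite subr_eq0.
have m0 : 0 < modulus (z - w) by rewrite mo_gt0.
have := Hd _ zd; rewrite (_ : w + (z - w) = z); last by ring.
rewrite N0 subr0 (_ : N z - _ = (N z / (z - w) - l) * (z - w)); last by field.
rewrite moM ler_pM2r // => h; apply: le_lt_trans h _; lra.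
Qed.

Lemma ccont_neq0 g z : ccont g z -> g z != 0 ->
  exists2 d, 0 < d & forall w, modulus (w - z) < d -> g w != 0.
Proof.
move=> cg g0; have [|d d0 Hd] := cg (modulus (g z)); first by rewrite mo_gt0.
exists d => // w /Hd h; apply/eqP => gw; move: h; rewrite gw sub0r moN ltxx //.
Qed.

Definition zprod (ws : seq C) z : C := \prod_(w <- ws) (z - w).

Lemma zprod_hder ws z : exists l, hder (zprod ws) z l.
Proof.
elim: ws => [|w ws [l IH]].
  exists 0; rewrite (_ : zprod _ = fun=> 1); first exact: hder_cst.
  by apply/funext => v; rewrite /zprod big_nil.
eexists; rewrite (_ : zprod _ = fun z => (z - w) * zprod ws z); last first.
  by apply/funext => v; rewrite /zprod big_cons.
by apply: hderM IH; apply: hderB; [exact: hder_id|exact: hder_cst].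
Qed.

Lemma zprod_eq0 ws z : (zprod ws z == 0) = (z \in ws).
Proof.
rewrite /zprod prodf_seq_eq0; apply/hasP/idP => [[w wws /=]|zws].
  by rewrite subr_eq0 => /eqP ->.
by exists z => //=; rewrite subrr.
Qed.

Lemma zprod_rem ws w z : w \in ws -> zprod ws z = (z - w) * zprod (rem w ws) z.
Proof. by move=> wws; rewrite /zprod (perm_big _ (perm_to_rem wws)) big_cons. Qed.

Lemma pow_le1 (t D0 : R) : 0 <= t -> (forall k : nat, t ^+ k.+1 <= D0) -> t <= 1.
Proof.
move=> t0 H; rewrite leNgt; apply/negP => t1.
have bern k : 1 + k%:R * (t - 1) <= t ^+ k.
  elim: k => [|k IH]; first by rewrite mul0r addr0 expr0.
  rewrite exprS -natr1; have : t * (1 + k%:R * (t - 1)) <= t * t ^+ k by rewrite ler_pM2l //; lra.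
  have : 0 <= k%:R * (t - 1) * (t - 1) by rewrite !mulr_ge0 //; lra.
  move=> h1 h2; apply: le_trans h2; move: h1; set K := k%:R; clear; nra.
have t1' : 0 < t - 1 by lra.
have D00 : 0 <= D0 / (t - 1).
  by rewrite divr_ge0 ?(ltW t1') //; apply: (le_trans _ (H 0%N)); rewrite expr1.
have := archi_boundP D00; set n := Num.bound _; rewrite ltr_pdivrMr // => h.
have := H n; have := bern n.+1; rewrite -natr1; move: h; set K := n%:R; lra.
Qed.

Lemma ccont_ub K g : compact K -> (forall z, K z -> ccont g z) ->
  exists2 M, 0 < M & forall z, K z -> modulus (g z) <= M.
Proof.
move=> cK cg; have [[z0 Kz0]|nK] := EM (K !=set0); last first.
  by exists 1 => // z Kz; exfalso; apply: nK; exists z.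
have [z _ Hz] := @max_attained _ K (fun z => modulus (g z)) (ex_intro _ _ Kz0) cK (fun z h => mo_cont (cg z h)).
exists (modulus (g z) + 1); first by have := mo_ge0 (g z); lra.
by move=> w /Hz; lra.
Qed.

(* [N^(k+1)/P^k] extends holomorphically over the common zeros because [N/P] is bounded there;
   the maximum principle for it and [k -> oo] give the bound without removing singularities. *)
Lemma zdiv Om ws N M : open Om -> bdd Om -> uniq ws -> (forall w, w \in ws -> Om w) ->
  (forall z, closure Om z -> ccont N z) -> hol Om N -> (forall w, w \in ws -> N w = 0) ->
  0 < M ->
  (forall z, closure Om z -> ~ Om z -> modulus (N z) <= M * modulus (zprod ws z)) ->
  forall z, closure Om z -> modulus (N z) <= M * modulus (zprod ws z).
Proof.
move=> oOm bOm uws wsOm cN hN N0 M0 bM z cz.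
have cP v : ccont (zprod ws) v by have [l /hder_cont] := zprod_hder ws v.
have cK := closed_closureC bOm.
have [d d0 Hd] := ccont_ub cK (fun z _ => cP z).
have [zws|zws] := boolP (z \in ws).
  by rewrite N0 // mo0 mulr_ge0 ?mo_ge0 // ltW.
have P0 : 0 < modulus (zprod ws z) by rewrite mo_gt0 zprod_eq0.
suff : modulus (N z) / (M * modulus (zprod ws z)) <= 1.
  by rewrite ler_pdivrMr ?mul1r // mulr_gt0.
apply: (@pow_le1 _ (d / modulus (zprod ws z))).
  by rewrite divr_ge0 ?mo_ge0 // mulr_ge0 ?mo_ge0 // ltW.
move=> k.
pose F v := if v \in ws then 0 else N v ^+ k.+1 / zprod ws v ^+ k.
have Fnear v : v \notin ws -> exists2 r, 0 < r & forall u, modulus (u - v) < r -> F u = N u ^+ k.+1 / zprod ws u ^+ k.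
  move=> vws; have [|r r0 Hr] := ccont_neq0 (cP v); first by rewrite zprod_eq0.
  by exists r => // u /Hr; rewrite zprod_eq0 /F => /negbTE ->.
have cF v : closure Om v -> v \notin ws -> ccont F v.
  move=> cv vws; have [r r0 Hr] := Fnear v vws.
  have : ccont (fun u => N u ^+ k.+1 / zprod ws u ^+ k) v.
    apply: ccontM; first by apply: ccontX; exact: cN.
    apply: ccontV; last exact: ccontX.
    by rewrite expf_eq0 negb_and zprod_eq0 vws orbT.
  move=> H e e0; have [t t0 Ht] := H e e0.
  exists (Num.min t r); first by rewrite lt_min t0.
  by move=> u; rewrite lt_min => /andP[/Ht h /Hr ->]; rewrite Hr // subrr mo0.
have hF : hol Om F.
  move=> v Ov; have [vws|vws] := boolP (v \in ws); last first.
    have [r r0 Hr] := Fnear v vws; have [l hl] := hN v Ov; have [m hm] := zprod_hder ws v.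
    have [l' hl'] := hderX k.+1 hl; have [m' hm'] := hderX k hm.
    have h0 : zprod ws v ^+ k != 0 by rewrite expf_eq0 negb_and zprod_eq0 vws orbT.
    have hV := @hderV R (fun u => zprod ws u ^+ k) v m' h0 hm'.
    exists (l' / zprod ws v ^+ k + N v ^+ k.+1 * (- m' / (zprod ws v ^+ k) ^+ 2)).
    apply: (@hder_eqnear R F (fun u => N u ^+ k.+1 / zprod ws u ^+ k) v _ r r0 Hr).
    exact: (@hderM R (fun u => N u ^+ k.+1) (fun u => (zprod ws u ^+ k)^-1) v _ _ hl' hV).
  have [l hl] := hN v Ov.
  pose q u := if u == v then l else N u / (u - v).
  have cq : ccont q v by apply: ccont_quot => //; exact: N0.
  pose S := zprod (rem v ws).
  have cS : ccont S v by have [m /hder_cont] := zprod_hder (rem v ws) v.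
  have S0 : S v != 0 by rewrite zprod_eq0 mem_rem_uniq // inE eqxx.
  have [r r0 Hr] := ccont_neq0 cS S0.
  exists (q v ^+ k.+1 / S v ^+ k).
  apply: (@hder_eqnear _ _ (fun u => (u - v) * (q u ^+ k.+1 / S u ^+ k)) _ _ r) => //.
    move=> u ur; have Su := Hr u ur; rewrite /F /q; case: eqP => [->|/eqP uv].
      by rewrite vws subrr mul0r.
    have uv0 : u - v != 0 by rewrite subr_eq0.
    rewrite ifF; last first.
      by apply: contraNF Su => uiws; rewrite /S zprod_eq0 mem_rem_uniq // inE uv uiws.
    rewrite (zprod_rem _ vws) -/(S u) !expr_div_n exprMn [(u - v) ^+ k.+1]exprS.
    have h1 : (u - v) ^+ k != 0 by rewrite expf_neq0.
    have h2 : S u ^+ k != 0 by rewrite expf_neq0.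
    by field; rewrite h1 h2 uv0.
  apply: (@hder_zmul (fun u => q u ^+ k.+1 / S u ^+ k)); apply: ccontM; first exact: ccontX.
  by apply: ccontV; [rewrite expf_neq0|exact: ccontX].
have cF' v : closure Om v -> ccont F v.
  move=> cv; have [vws|/cF] := boolP (v \in ws); last exact.
  exact: hol_cont hF (wsOm _ vws).
have := @max_principle _ Om F (M ^+ k.+1 * d) oOm bOm cF' hF.
have bF v : closure Om v -> ~ Om v -> modulus (F v) <= M ^+ k.+1 * d.
  move=> cv nOv; have vws : v \notin ws by apply/negP => /wsOm.
  rewrite /F (negbTE vws) moM moV !moX.
  have Pv : 0 < modulus (zprod ws v) by rewrite mo_gt0 zprod_eq0.
  rewrite ler_pdivrMr ?exprn_gt0 //.
  apply: (@le_trans _ _ ((M * modulus (zprod ws v)) ^+ k.+1)).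
    by apply: lerXn2r; rewrite ?nnegrE ?mo_ge0 //; [rewrite mulr_ge0 ?mo_ge0 // ltW|exact: bM].
  rewrite exprMn -mulrA ler_pM2l ?exprn_gt0 // exprS ler_pM2r ?exprn_gt0 //; exact: Hd.
move=> /(_ bF z cz); rewrite /F (negbTE zws) moM moV !moX.
rewrite ler_pdivrMr ?exprn_gt0 // => h.
rewrite expr_div_n ler_pdivrMr ?exprn_gt0 ?mulr_gt0 //.
apply: (le_trans h); rewrite exprMn [modulus (zprod ws z) ^+ k.+1]exprS.
rewrite le_eqVlt; apply/orP; left; apply/eqP; field; lra.
Qed.

End Cont.

(** * Cauchy estimates on discs *)

Section Disc.
Context {R : realType}.
Local Notation C := (Cx R).
Implicit Types (z w l a : C) (x y e d r rho M : R) (g : C -> C) (A K Om : set C).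

Lemma D_bdd a r : bdd (D a r).
Proof.
exists (modulus a + r) => z; rewrite /D /= => h; have := mo_subr z a; lra.
Qed.

Lemma D_closure a r z : closure (D a r) z -> modulus (z - a) <= r.
Proof.
move=> /closure_cx H; apply/ler_addgt0Pl => e e0; have [w] := H e e0.
rewrite /D /= => h1 h2; have := mo_tri z w a; rewrite (mo_sym z w); lra.
Qed.

Lemma zdiv_disc a r ws N M : uniq ws -> (forall w, w \in ws -> modulus (w - a) < r) ->
  (forall z, modulus (z - a) <= r -> exists l, hder N z l) -> (forall w, w \in ws -> N w = 0) -> 0 < M ->
  (forall z, modulus (z - a) = r -> modulus (N z) <= M * modulus (zprod ws z)) ->
  forall z, modulus (z - a) < r -> modulus (N z) <= M * modulus (zprod ws z).
Proof.
move=> uws wsr hN N0 M0 bM z zr.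
apply: (@zdiv _ (D a r)) => //.
- exact: D_open.
- exact: D_bdd.
- by move=> v /D_closure /hN[l /hder_cont].
- by move=> v h; apply: hN; exact: ltW.
- move=> v /D_closure h1 /negP; rewrite -leNgt => h2; apply: bM; apply/le_anti.
  by rewrite h1.
- exact: subset_closure.
Qed.

(** Cauchy's estimate by division: on the circle of radius [3 * rho / 4] the difference [g v - g w]
    is at most [2 * M] and [|v - w|] at least [rho / 4]. *)
Lemma lip a rho g M z w : 0 < M -> hol (D a rho) g ->
  (forall z, modulus (z - a) < rho -> modulus (g z) <= M) ->
  modulus (z - a) < rho / 2 -> modulus (w - a) < rho / 2 ->
  modulus (g z - g w) <= 8 * M / rho * modulus (z - w).
Proof.
move=> M0 hg gM hz hw.
have rho0 : 0 < rho by have := mo_ge0 (z - a); lra.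
have K0 : 0 < 8 * M / rho by rewrite divr_gt0 // mulr_gt0.
have := @zdiv_disc a (3 * rho / 4) [:: w] (fun v => g v - g w) (8 * M / rho).
have zp v : zprod [:: w] v = v - w by rewrite /zprod big_seq1.
move=> H; rewrite -zp; apply: H => //.
- by move=> v; rewrite inE => /eqP ->; lra.
- move=> v hv; have [|l hl] := hg v; first by rewrite /D /=; lra.
  by exists (l - 0); apply: hderB => //; exact: hder_cst.
- by move=> v; rewrite inE => /eqP ->; rewrite subrr.
- move=> v hv; rewrite zp; apply: (@le_trans _ _ (8 * M / rho * (rho / 4))).
    rewrite (_ : _ / _ * _ = 2 * M); last by field; lra.
    have := moB (g v) (g w); have := gM v; have := gM w; rewrite hv; lra.
  rewrite ler_pM2l //; have := mo_tri v w a; lra.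
- lra.
Qed.

(** The same division for the error of linear interpolation at [w] and [w'], at most
    [2 * M + 10 * M] on the circle. Only the values of [g] at three points occur, so the inequality
    survives pointwise limits. *)
Lemma lip2 a rho g M z w w' : 0 < M -> hol (D a rho) g ->
  (forall z, modulus (z - a) < rho -> modulus (g z) <= M) ->
  modulus (z - a) < rho / 2 -> modulus (w - a) < rho / 2 -> modulus (w' - a) < rho / 2 -> w != w' ->
  modulus (g z - g w - (z - w) * ((g w' - g w) / (w' - w)))
    <= 192 * M / rho ^+ 2 * (modulus (z - w) * modulus (z - w')).
Proof.
move=> M0 hg gM hz hw hw' ww'.
have rho0 : 0 < rho by have := mo_ge0 (z - a); lra.
have K0 : 0 < 192 * M / rho ^+ 2 by apply: divr_gt0; [apply: mulr_gt0; [rewrite ltr0n|exact: M0]|exact: exprn_gt0].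
set dd := (g w' - g w) / (w' - w).
have w'w : w' - w != 0 by rewrite subr_eq0 eq_sym.
have m0 : 0 < modulus (w' - w) by rewrite mo_gt0.
have ddM : modulus dd <= 8 * M / rho.
  rewrite /dd moM moV ler_pdivrMr //; exact: (@lip a rho g M w' w).
have := @zdiv_disc a (3 * rho / 4) [:: w; w'] (fun v => g v - g w - (v - w) * dd) (192 * M / rho ^+ 2).
have zp v : zprod [:: w; w'] v = (v - w) * (v - w') by rewrite /zprod big_cons big_seq1.
move=> H; rewrite -moM -zp; apply: H => //.
- by rewrite /= inE ww'.
- by move=> v; rewrite !inE => /orP[] /eqP ->; lra.
- move=> v hv; have [|l hl] := hg v; first by rewrite /D /=; lra.
  exists (l - 0 - ((1 - 0) * dd + (v - w) * 0)); apply: hderB.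
    by apply: hderB => //; exact: hder_cst.
  apply: hderM; last exact: hder_cst.
  by apply: hderB; [exact: hder_id|exact: hder_cst].
- move=> v; rewrite !inE => /orP[] /eqP ->; first by rewrite !subrr mul0r subr0.
  by rewrite /dd mulrC divfK // subrr.
- move=> v hv; rewrite zp; apply: (@le_trans _ _ (12 * M)).
    have := moB (g v - g w) ((v - w) * dd); have := moB (g v) (g w); have := gM v; have := gM w.
    rewrite hv moM.
    have vw : modulus (v - w) <= 5 / 4 * rho by have := mo_tri v a w; rewrite (mo_sym a w); lra.
    have : modulus (v - w) * modulus dd <= 5 / 4 * rho * (8 * M / rho).
      by apply: ler_pM; rewrite ?mo_ge0.
    rewrite (_ : 5 / 4 * rho * _ = 10 * M); last by field; lra.
    clear -rho0 hw; lra.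
  rewrite moM; apply: (@le_trans _ _ (192 * M / rho ^+ 2 * (rho / 4 * (rho / 4)))).
    rewrite le_eqVlt; apply/orP; left; apply/eqP; field; lra.
  rewrite ler_pM2l //; apply: ler_pM; [lra|lra| |].
    by have := mo_tri v w a; lra.
  by have := mo_tri v w' a; lra.
- lra.
Qed.

Lemma seg_D a rho w z t : modulus (w - a) < rho -> modulus (z - a) < rho -> 0 <= t <= 1 ->
  modulus (w + rc t * (z - w) - a) < rho.
Proof.
move=> hw hz /andP[t0 t1].
rewrite (_ : _ - a = rc (1 - t) * (w - a) + rc t * (z - a)); last by rewrite rcB rc1; ring.
apply: (le_lt_trans (moD _ _)); rewrite !moM !mo_rc !ger0_norm ?subr_ge0 //.
have [->|tn0] := eqVneq t 0; first by rewrite subr0 mul1r mul0r addr0.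
have tp : 0 < t by rewrite lt_neqAle eq_sym tn0.
have : t * modulus (z - a) < t * rho by rewrite ltr_pM2l.
have : (1 - t) * modulus (w - a) <= (1 - t) * rho by rewrite ler_wpM2l ?subr_ge0 // ltW.
lra.
Qed.

Lemma hol_zero_cst a rho g : (forall z, modulus (z - a) < rho -> hder g z 0) ->
  forall z, modulus (z - a) < rho -> g z = g a.
Proof.
move=> hg z hz; apply/eqP; rewrite -subr_eq0 -mo_eq0; apply/eqP/le_anti; rewrite mo_ge0 andbT.
have ha : modulus (a - a) < rho by rewrite subrr mo0; apply: le_lt_trans hz; rewrite mo_ge0.
have H : modulus (g (a + rc 1 * (z - a)) - g (a + rc 0 * (z - a))) <= 0 * (1 - 0).
  apply: (@mvi _ (fun t => g (a + rc t * (z - a))) (fun t => (z - a) * 0)) => // [t ht|t ht].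
    by apply: rder_line; apply: hg; exact: seg_D.
  by rewrite mulr0 mo0.
by move: H; rewrite rc0 rc1 !mul0r mul1r addr0 (_ : a + (z - a) = z) //; ring.
Qed.

End Disc.

(** * Ultrafilter limits, logarithms and Harnack's inequality *)

Section Ultra.
Context {R : realType}.
Local Notation C := (Cx R).
Implicit Types (z w l a : C) (x y e d r rho M : R) (g : C -> C) (A Om : set C) (K : R)
  (U : set_system nat) (u v : nat -> C).

(** Along an ultrafilter every bounded sequence has a limit, so limit functions are defined
    pointwise without choosing subsequences. *)
Definition ulim U u l := forall e, 0 < e -> U [set n | modulus (u n - l) < e].

Lemma closed_disc_compact M : compact [set z : C | modulus z <= M].
Proof.
apply: compactC; first by exists M.
move=> z /closure_cx H /=; apply/ler_addgt0Pl => e e0; have [w /= h1 h2] := H e e0.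
have := mo_subr z w; rewrite mo_sym; lra.
Qed.

Lemma ulim_ex U u M : UltraFilter U -> U [set n | modulus (u n) <= M] -> exists l, ulim U u l.
Proof.
move=> UU UM.
have [l [_ cl]] := @closed_disc_compact M (u @ U) _ UM.
exists l => e e0.
have [//|h] := in_ultra_setVsetC [set n | modulus (u n - l) < e] UU.
have [|w [h1 h2]] := cl (~` D l e) (D l e) h; last by [].
by apply/nbhs_cx; exists e.
Qed.

Lemma ulim_le U u l a b : ProperFilter U -> ulim U u l -> U [set n | modulus (u n - a) <= b] ->
  modulus (l - a) <= b.
Proof.
move=> UU ul Ub; apply/ler_addgt0Pl => e e0.
have [n [/= h1 h2]] := @filter_ex _ _ UU _ (filterI (ul e e0) Ub).
have := mo_tri l (u n) a; rewrite (mo_sym l (u n)); lra.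
Qed.

Lemma ulim_le0 U u l b : ProperFilter U -> ulim U u l -> U [set n | modulus (u n) <= b] -> modulus l <= b.
Proof.
move=> UU ul Ub; rewrite -(subr0 l); apply: (ulim_le (a := 0) UU ul).
by apply: filterS Ub => n /=; rewrite subr0.
Qed.

Lemma ulim_cst U l : Filter U -> ulim U (fun=> l) l.
Proof. by move=> UU e e0; apply: filterE => n /=; rewrite subrr mo0. Qed.

Lemma ulimB U u v l m : Filter U -> ulim U u l -> ulim U v m -> ulim U (fun n => u n - v n) (l - m).
Proof.
move=> UU ul vm e e0; have e2 : 0 < e / 2 by lra.
apply: filterS (filterI (ul _ e2) (vm _ e2)) => n [/= h1 h2].
rewrite (_ : _ - _ = (u n - l) - (v n - m)); last by ring.
have := moB (u n - l) (v n - m); lra.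
Qed.

Lemma ulim_comp U u l g : Filter U -> ccont g l -> ulim U u l -> ulim U (fun n => g (u n)) (g l).
Proof.
move=> UU cg ul e e0; have [d d0 Hd] := cg e e0.
by apply: filterS (ul d d0) => n; exact: Hd.
Qed.

Lemma ulimZ U u l c : Filter U -> ulim U u l -> ulim U (fun n => c * u n) (c * l).
Proof.
move=> UU; apply: (ulim_comp (g := fun z => c * z)).
exact: hder_cont (hderZ c (hder_id l)).
Qed.

Lemma free_ultra : exists U : set_system nat, UltraFilter U /\ \oo `<=` U.
Proof. exact: ultraFilterLemma. Qed.

Lemma free_ge U N : \oo `<=` U -> U [set n | (N <= n)%N].
Proof. by apply; exists N. Qed.

Lemma inv_small e : 0 < e -> exists N, forall n, (N <= n)%N -> (n.+1%:R)^-1 < e :> R.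
Proof.
move=> e0; exists (Num.bound (e^-1)) => n hn.
rewrite invf_plt ?posrE //; apply: (lt_le_trans (archi_boundP _)); first by rewrite invr_ge0 ltW.
by rewrite ler_nat leqW.
Qed.

(** The derivative [l] is an ultrafilter limit of difference quotients towards points [W n] that
    approach [w]; the interpolation inequality with [w' = W n] becomes the quadratic bound. *)
Lemma quot_deriv a r K g : 
  (forall z w w', modulus (z - a) < r -> modulus (w - a) < r -> modulus (w' - a) < r -> w != w' ->
    modulus (g z - g w - (z - w) * ((g w' - g w) / (w' - w))) <= K * (modulus (z - w) * modulus (z - w'))) ->
  0 <= K -> forall w, modulus (w - a) < r -> exists l, forall z, modulus (z - a) < r ->
    modulus (g z - g w - (z - w) * l) <= K * modulus (z - w) ^+ 2.
Proof.
move=> H K0 w wr; set rho := r - modulus (w - a).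
have rho0 : 0 < rho by rewrite /rho; lra.
have [U [UU fU]] := free_ultra.
(* [n.+2] keeps [W n] inside the open disc already for [n = 0]. *)
pose t (n : nat) : R := rho * (n.+2%:R)^-1.
have t0 n : 0 < t n by rewrite /t mulr_gt0 // invr_gt0.
have t1 n : t n < rho.
  by rewrite /t gtr_pMr // invf_lt1 // ltr1n.
pose W n : C := w + rc (t n).
have Wa n : modulus (W n - a) < r.
  rewrite (_ : W n - a = (w - a) + rc (t n)); last by rewrite /W; ring.
  have := moD (w - a) (rc (t n)); rewrite mo_rc gtr0_norm //; have := t1 n; rewrite /rho; lra.
have Ww n : W n - w = rc (t n) by rewrite /W; ring.
have wW n : w != W n by rewrite eq_sym -subr_eq0 Ww rc_eq0 gt_eqF.
pose dl n := (g (W n) - g w) / (W n - w).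
have [l ul] : exists l, ulim U dl l.
  apply: (@ulim_ex _ _ ((K * (t 0%N * rho) + modulus (g (W 0%N) - g w)) / t 0%N)).
  apply: filterE => n /=; rewrite ler_pdivlMr //.
  have := H (W 0%N) w (W n) (Wa 0%N) wr (Wa n) (wW n); rewrite -/(dl n) Ww.
  have E : modulus (W 0%N - W n) <= rho.
    rewrite (_ : W 0%N - W n = rc (t 0%N - t n)); last by rewrite /W rcB; ring.
    rewrite mo_rc ler_norml; have := t0 n; have := t0 0%N; have := t1 n; have := t1 0%N; lra.
  rewrite mo_rc gtr0_norm // => h.
  have := mo_subr (rc (t 0%N) * dl n) (g (W 0%N) - g w); rewrite (mo_sym (rc (t 0%N) * dl n)) moM mo_rc gtr0_norm //.
  have : K * (t 0%N * modulus (W 0%N - W n)) <= K * (t 0%N * rho).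
    by rewrite ler_wpM2l // ler_pM2l.
  lra.
exists l => z za.
have uX : ulim U (fun n => g z - g w - (z - w) * dl n) (g z - g w - (z - w) * l).
  by apply: ulimB; [exact: ulim_cst|exact: ulimZ].
rewrite -subr_le0; apply: (@le_eps _ _ (K * modulus (z - w))); first by rewrite mulr_ge0 ?mo_ge0.
move=> e e0; rewrite lerBlDr; apply: (ulim_le0 _ uX).
have [N HN] : exists N, forall n, (N <= n)%N -> t n <= e.
  have [|N HN] := @inv_small (e / rho); first by rewrite divr_gt0.
  exists N => n hn; have /ltW := HN n.+1 (leqW hn); rewrite ler_pdivlMr //.
  by rewrite /t mulrC.
apply: filterS (free_ge N fU) => n /= hn.
apply: (le_trans (H _ _ _ za wr (Wa n) (wW n))).
have : modulus (z - W n) <= modulus (z - w) + e.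
  have := mo_tri z w (W n); rewrite (mo_sym w) Ww mo_rc gtr0_norm //; have := HN n hn; lra.
move=> h; apply: (@le_trans _ _ (K * (modulus (z - w) * (modulus (z - w) + e)))).
  by rewrite ler_wpM2l // ler_wpM2l ?mo_ge0.
rewrite le_eqVlt; apply/orP; left; apply/eqP; ring.
Qed.

Lemma quad_hder a r K g w l : 0 <= K -> modulus (w - a) < r -> (forall z, modulus (z - a) < r ->
    modulus (g z - g w - (z - w) * l) <= K * modulus (z - w) ^+ 2) -> hder g w l.
Proof.
move=> K0 wr H e e0.
exists (Num.min (r - modulus (w - a)) (e / (K + 1))).
  by rewrite lt_min divr_gt0 ?subr_gt0 ?wr //; lra.
move=> h; rewrite lt_min => /andP[h1]; rewrite ltr_pdivlMr; last by lra.
move=> h2; have := H (w + h); rewrite (_ : w + h - w = h); last by ring.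
have ha : modulus (w + h - a) < r.
  rewrite (_ : w + h - a = (w - a) + h); last by ring.
  have := moD (w - a) h; lra.
move=> /(_ ha) h3; apply: (le_trans h3); rewrite expr2 mulrA ler_wpM2r ?mo_ge0 //.
have := mo_ge0 h; lra.
Qed.

(** The inequality of [lip2] passes to the limit and yields derivatives by [quot_deriv]. *)
Lemma vitali U a rho M (gn : nat -> C -> C) g : UltraFilter U -> 0 < M ->
  U [set n | hol (D a rho) (gn n) /\ forall z, modulus (z - a) < rho -> modulus (gn n z) <= M] ->
  (forall z, modulus (z - a) < rho / 2 -> ulim U (fun n => gn n z) (g z)) ->
  hol (D a (rho / 2)) g.
Proof.
move=> UU M0 UH ug w wa.
have rho0 : 0 < rho by move: wa; rewrite /D /=; have := mo_ge0 (w - a); lra.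
have K0 : 0 <= 192 * M / rho ^+ 2.
  by apply: divr_ge0; [apply: mulr_ge0; [rewrite ler0n|exact: ltW]|apply/exprn_ge0/ltW].
have Q z w0 w' : modulus (z - a) < rho / 2 -> modulus (w0 - a) < rho / 2 -> modulus (w' - a) < rho / 2 -> w0 != w' ->
    modulus (g z - g w0 - (z - w0) * ((g w' - g w0) / (w' - w0))) <= 192 * M / rho ^+ 2 * (modulus (z - w0) * modulus (z - w')).
  move=> hz hw hw' ne.
  have uX : ulim U (fun n => (gn n z - gn n w0) - (z - w0) * ((w' - w0)^-1 * (gn n w' - gn n w0)))
                 ((g z - g w0) - (z - w0) * ((w' - w0)^-1 * (g w' - g w0))).
    by apply: ulimB; [apply: ulimB; exact: ug|do 2 apply: ulimZ; apply: ulimB; exact: ug].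
  rewrite (mulrC (_ - _) (_^-1)).
  apply: (ulim_le0 _ uX); apply: filterS UH => n [/= h1 h2].
  by rewrite (mulrC (_^-1)); exact: (@lip2 _ a rho).
have [l Hl] := quot_deriv Q K0 wa.
by exists l; apply: (quad_hder K0 wa Hl).
Qed.

Definition dv g z : C := xget 0 [set l | hder g z l].

Lemma dvP g z : (exists l, hder g z l) -> hder g z (dv g z).
Proof. by case=> l hl; rewrite /dv; case: xgetP => [m -> //|/(_ l)]. Qed.

Lemma dvE g z l : hder g z l -> dv g z = l.
Proof. by move=> h; apply: (hder_uniq _ h); apply: dvP; exists l. Qed.

(** [dv g] is the pointwise limit of the difference quotients with increment [1 / n.+1], which are
    holomorphic and bounded by [lip]. *)
Lemma dv_hol A g : open A -> hol A g -> hol A (dv g).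
Proof.
move=> /open_cx oA hg a Aa.
have [d1 d10 H1] := oA a Aa.
have [d2 d20 H2] := hol_cont hg Aa ltr01.
pose M := modulus (g a) + 1.
have M0 : 0 < M by rewrite /M; have := mo_ge0 (g a); lra.
pose rho := Num.min d1 d2.
have rho0 : 0 < rho by rewrite /rho lt_min d10.
have hg' : hol (D a rho) g.
  by move=> z; rewrite /D /= /rho lt_min => /andP[/H1 /hg].
have gM z : modulus (z - a) < rho -> modulus (g z) <= M.
  rewrite /rho lt_min => /andP[_ /H2]; have := mo_subr (g z) (g a); rewrite /M; lra.
clearbody rho M.
have [U [UU fU]] := free_ultra.
pose gn (n : nat) z := n.+1%:R * (g (z + (n.+1%:R)^-1) - g z).
have [N HN] := @inv_small (rho / 4) ltac:(lra).
have nb n : (n.+1%:R : C) != 0 by rewrite pnatr_eq0.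
have mn n : modulus ((n.+1%:R)^-1 : C) = (n.+1%:R)^-1 by rewrite moV mo_nat.
have zn n z : (N <= n)%N -> modulus (z - a) < rho / 4 -> modulus (z + (n.+1%:R)^-1 - a) < rho / 2.
  move=> hn hz; rewrite (_ : _ - a = (z - a) + (n.+1%:R)^-1); last by ring.
  have := moD (z - a) ((n.+1%:R)^-1); rewrite mn => h2; apply: (le_lt_trans h2).
  by rewrite (_ : rho / 2 = rho / 4 + rho / 4) ?ltrD //; [exact: HN|field].
have := @vitali U a (rho / 4) (8 * M / rho) gn (dv g) UU.
have K0 : 0 < 8 * M / rho by rewrite divr_gt0 // mulr_gt0.
move=> /(_ K0) V; apply: V.
- apply: filterS (free_ge N fU) => n /= hn; split.
    move=> z hz; have [|l hl] := hg' (z + (n.+1%:R)^-1).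
      rewrite /D /=; have := zn n z hn hz; lra.
    have [|m hm] := hg' z; first by move: hz; rewrite /D /=; lra.
    exists (n.+1%:R * ((1 + 0) * l - m)); apply: hderZ; apply: hderB => //.
    by apply: (@hder_comp _ (fun z => z + (n.+1%:R)^-1) g) => //; apply: hderD; [exact: hder_id|exact: hder_cst].
  move=> z hz; rewrite moM mo_nat mulrC -ler_pdivlMr //.
  have := @lip _ a rho g M (z + (n.+1%:R)^-1) z M0 hg' gM (zn n z hn hz).
  rewrite (_ : z + _ - z = (n.+1%:R)^-1); last by ring.
  by rewrite mn; apply; lra.
- move=> z hz e e0; have [|l hl] := hg' z; first by rewrite /D /=; lra.
  have e2 : 0 < e / 2 by lra.
  have [d d0 Hd] := (dvP (ex_intro _ l hl)) _ e2; have [N' HN'] := inv_small d0.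
  apply: filterS (free_ge N' fU) => n /= hn.
  have := Hd (n.+1%:R)^-1; rewrite mn => /(_ (HN' n hn)).
  rewrite (_ : g _ - g z - _ = (n.+1%:R)^-1 * (gn n z - dv g z)); last first.
    by rewrite /gn mulrBr mulKf.
  rewrite moM mn mulrC ler_pM2r ?invr_gt0 //; lra.
- by rewrite /D /= subrr mo0; lra.
Qed.

(** A primitive [Q] of [dv g / g] makes [g * cexp (- Q)] constant; a logarithm of that constant
    corrects [Q]. The square of half-side [rho / 3] fits between the discs of radii [rho / 4] and
    [rho]. *)
Lemma log_branch a rho g : hol (D a rho) g -> (forall z, modulus (z - a) < rho -> g z != 0) ->
  exists H : C -> C, forall z, modulus (z - a) < rho / 4 -> hder H z (dv g z / g z) /\ cexp (H z) = g z.
Proof.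
move=> hg g0; have [rho0|rho0] := leP rho 0.
  by exists g => z hz; exfalso; have := mo_ge0 (z - a); lra.
have hdv := dv_hol (@D_open R a rho) hg.
have [Q HQ] : exists Q, forall z, re a - rho / 3 < re z < re a + rho / 3 ->
    im a - rho / 3 < im z < im a + rho / 3 -> hder Q z (dv g z / g z).
  apply: (@box_prim _ (fun z => dv g z / g z)) => z hx hy.
  have hz : modulus (z - a) < rho.
    apply: (le_lt_trans (mo_le _)); rewrite reB imB.
    have : `|re z - re a| <= rho / 3 by rewrite ler_norml; lra.
    have : `|im z - im a| <= rho / 3 by rewrite ler_norml; lra.
    lra.
  have [l hl] := hdv z hz; have [m hm] := hg z hz.
  by eexists; apply: (hderM hl); apply: (hderV (g0 z hz) hm).
have dQ z : modulus (z - a) < rho / 4 -> hder Q z (dv g z / g z).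
  move=> hz; have := re_le (z - a); have := im_le (z - a).
  rewrite reB imB !ler_norml => h1 h2; apply: HQ; lra.
have za z : modulus (z - a) < rho / 4 -> modulus (z - a) < rho by lra.
pose G z := g z * cexp (- Q z).
have dG z : modulus (z - a) < rho / 4 -> hder G z 0.
  move=> hz; have [m hm] := hg z (za z hz); have hd := dvP (ex_intro _ m hm).
  have := hderM hd (hder_comp (hderN (dQ z hz)) (hder_cexp (- Q z))).
  congr (hder _ _ _); field; exact: g0 (za z hz).
have GE := hol_zero_cst dG.
have Ga0 : G a != 0.
  by rewrite /G mulf_neq0 ?cexp_neq0 // g0 // subrr mo0.
have [t [_ Gt]] := cexp_ln Ga0.
set c := pt _ _ in Gt.
exists (fun z => Q z + c) => z hz; split.
  rewrite -[X in hder _ _ X]addr0; apply: hderD; [exact: dQ|exact: hder_cst].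
rewrite cexpD -Gt -(GE z hz) /G cexpN mulrCA mulfV ?mulr1 //; exact: cexp_neq0.
Qed.

Definition cj z : C := pt (re z) (- im z).

(** The Moebius map in [S] sends the right half-plane to the unit disc and [H a] to 0; the Schwarz
    lemma is [zdiv_disc] with the single zero [a]. *)
Lemma harnack a rho r H s z : hol (D a rho) H -> (forall z, modulus (z - a) < rho -> 0 < re (H z)) ->
  0 < r -> r < rho -> 0 <= s -> s < 1 -> modulus (z - a) <= s * r ->
  (1 - s) * modulus (H z - H a) <= 2 * s * re (H a).
Proof.
move=> hH Hp r0 rrho s0 s1 hz.
have Ha0 : 0 < re (H a) by apply: Hp; rewrite subrr mo0; lra.
have den w : modulus (w - a) < rho -> H w + cj (H a) != 0.
  move=> hw; apply/eqP => E; have := Hp w hw.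
  have : re (H w + cj (H a)) = 0 by rewrite E.
  rewrite reD re_pt; lra.
have num w : modulus (w - a) < rho -> modulus (H w - H a) <= modulus (H w + cj (H a)).
  move=> hw; rewrite -(@ler_pXn2r _ 2) ?nnegrE ?mo_ge0 // !mo_sqr.
  have -> : re (H w + cj (H a)) = re (H w) + re (H a) by rewrite reD re_pt.
  have -> : im (H w + cj (H a)) = im (H w) - im (H a) by rewrite imD im_pt.
  rewrite reB imB lerD2r.
  have := Hp w hw; move: Ha0; set p := re _; set q := re _; clear; nra.
pose S w := (H w - H a) / (H w + cj (H a)).
have S1 : modulus (S z) <= r^-1 * modulus (z - a).
  have zp w : zprod [:: a] w = w - a by rewrite /zprod big_seq1.
  rewrite -zp; apply: (@zdiv_disc _ a r) => //.
  - by move=> w; rewrite inE => /eqP ->; rewrite subrr mo0.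
  - move=> w hw; have wr : modulus (w - a) < rho by lra.
    have [l hl] := hH w wr.
    have d1 := hderB hl (hder_cst (H a) w); have d2 := hderD hl (hder_cst (cj (H a)) w).
    have dV := @hderV R (fun w => H w + cj (H a)) w _ (den w wr) d2.
    by eexists; exact: (@hderM R (fun w => H w - H a) (fun w => (H w + cj (H a))^-1) w _ _ d1 dV).
  - by move=> w; rewrite inE => /eqP ->; rewrite /S subrr mul0r.
  - by rewrite invr_gt0.
  - move=> w hw; rewrite zp hw mulVf ?gt_eqF // /S moM moV ler_pdivrMr ?mul1r.
      by apply: num; lra.
    by rewrite mo_gt0 den // hw.
  - by apply: (le_lt_trans hz); rewrite gtr_pMl.
have zrho : modulus (z - a) < rho.
  by apply: (le_lt_trans hz); apply: lt_trans rrho; rewrite gtr_pMl.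
have Ss : modulus (S z) <= s.
  by apply: (le_trans S1); rewrite mulrC ler_pdivrMr.
have E : modulus (H z - H a) <= s * modulus (H z + cj (H a)).
  by move: Ss; rewrite /S moM moV ler_pdivrMr // mo_gt0 den.
have : modulus (H z + cj (H a)) <= modulus (H z - H a) + 2 * re (H a).
  rewrite (_ : H z + _ = (H z - H a) + (H a + cj (H a))); last by ring.
  apply: (le_trans (moD _ _)); rewrite lerD2l (_ : H a + _ = rc (2 * re (H a))).
    by rewrite mo_rc ger0_norm // mulr_ge0 // ltW.
  by apply: C_ext; [rewrite reD re_pt re_rc|rewrite imD im_pt im_rc]; ring.
move=> h; have := ler_wpM2l s0 h; lra.
Qed.

End Ultra.

(** * Three circles, Montel's theorem and polynomial growth *)

Section Three.
Context {R : realType}.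
Local Notation C := (Cx R).
Implicit Types (z w l a : C) (x y e d r rho M : R) (g : C -> C) (A B : R) (Om : set C) (U : set_system nat).

Lemma mo_locally z w e : modulus (w - z) < e -> `|modulus w - modulus z| < e.
Proof.
move=> h; apply: le_lt_trans h; rewrite ler_norml mo_subr andbT lerNl opprB mo_sym; exact: mo_subr.
Qed.

Lemma annulus_open a r rho : open [set z | r < modulus (z - a) < rho].
Proof.
apply/open_cx => z /= /andP[h1 h2].
exists (Num.min (modulus (z - a) - r) (rho - modulus (z - a))).
  by rewrite lt_min !subr_gt0 h1.
move=> w; rewrite /D /= lt_min (_ : w - z = (w - a) - (z - a)); last by ring.
move=> /andP[/mo_locally k1 /mo_locally k2]; move: k1 k2; rewrite !ltr_norml.
by move=> /andP[? ?] /andP[? ?]; apply/andP; split; lra.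
Qed.

Lemma annulus_closure a r rho z : closure [set z | r < modulus (z - a) < rho] z ->
  r <= modulus (z - a) <= rho.
Proof.
move=> /closure_cx H; apply/andP; split; apply/ler_addgt0Pl => e e0;
  have [w /= /andP[h1 h2]] := H e e0; rewrite (_ : w - z = (w - a) - (z - a)); do ?[by ring];
  move=> /mo_locally; rewrite ltr_norml => /andP[h3 h4]; lra.
Qed.

(** The exponent that equalises the bounds on the two circles is real; approximating it by [p / q]
    makes [g ^+ q / (z - a) ^+ p] holomorphic on the annulus, and the error vanishes as [q]
    grows. *)
Lemma three_circ a r rho A B g z : 0 < r -> r < rho ->
  (forall z, modulus (z - a) <= rho -> exists l, hder g z l) ->
  (forall z, modulus (z - a) <= rho -> modulus (g z) <= expR A) ->
  (forall z, modulus (z - a) <= r -> modulus (g z) <= expR B) -> B <= A ->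
  r <= modulus (z - a) <= rho ->
  modulus (g z) <= expR (A - (A - B) * (ln (rho / modulus (z - a)) / ln (rho / r))).
Proof.
move=> r0 rrho hg gA gB BA /andP[rt trho]; set t := modulus (z - a) in rt trho *.
have t0 : 0 < t by lra.
have rho0 : 0 < rho by lra.
have [->|gz0] := eqVneq (g z) 0; first by rewrite mo0 expR_ge0.
have mg : 0 < modulus (g z) by rewrite mo_gt0.
set Lam := ln (rho / r); set mu := ln (rho / t).
have Lam0 : 0 < Lam by rewrite ln_gt0 // ltr_pdivlMr ?mul1r.
have mu0 : 0 <= mu by rewrite ln_ge0 // ler_pdivlMr ?mul1r.
have eL : expR Lam = rho / r by rewrite lnK // posrE divr_gt0.
have emu : expR mu = rho / t by rewrite lnK // posrE divr_gt0.
rewrite -[X in X <= _](lnK (x := modulus (g z))) ?posrE // ler_expR.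
set ga := ln (modulus (g z)).
rewrite -subr_le0; apply: (@le_eps _ _ mu mu0) => e e0.
have [q [q0 hq]] : exists q : nat, (0 < q)%N /\ q%:R^-1 <= e :> R.
  by have [N HN] := inv_small e0; exists N.+1; split => //; apply/ltW/HN.
have q0' : 0 < q%:R :> R by rewrite ltr0n.
pose p := Num.truncn (q%:R * (A - B) / Lam).
have /andP[p1 p2] : p%:R <= q%:R * (A - B) / Lam < p.+1%:R.
  by apply: truncn_itv; rewrite divr_ge0 ?mulr_ge0 ?subr_ge0 // ltW.
have {}p1 : p%:R * Lam <= q%:R * (A - B) by rewrite -ler_pdivlMr.
have {}p2 : q%:R * (A - B) <= (p%:R + 1) * Lam by rewrite -ler_pdivrMr // natr1 ltW.
pose Om := [set z | r < modulus (z - a) < rho].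
pose G w := g w ^+ q * ((w - a) ^+ p)^-1.
have wa w : r <= modulus (w - a) -> w - a != 0 by move=> h; rewrite -mo_gt0; lra.
have hG w : r <= modulus (w - a) -> modulus (w - a) <= rho -> exists l, hder G w l.
  move=> h1 h2; have [l hl] := hg w h2; have [l' hl'] := hderX q hl.
  have [m hm] := hderX p (hderB (hder_id w) (hder_cst a w)).
  have h0 : (w - a) ^+ p != 0 by rewrite expf_neq0 // wa.
  have hV := @hderV R (fun w => (w - a) ^+ p) w m h0 hm.
  exists (l' / (w - a) ^+ p + g w ^+ q * (- m / ((w - a) ^+ p) ^+ 2)).
  exact: (@hderM R (fun w => g w ^+ q) (fun w => ((w - a) ^+ p)^-1) w _ _ hl' hV).
have mG w : modulus (G w) = modulus (g w) ^+ q / modulus (w - a) ^+ p.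
  by rewrite /G moM moV !moX.
have := @max_principle R Om G (expR A ^+ q / rho ^+ p) (@annulus_open a r rho).
have bOm : bdd Om.
  by exists (modulus a + rho) => w /= /andP[_ h]; have := mo_subr w a; lra.
move=> /(_ bOm) mp.
have cOm w : closure Om w -> r <= modulus (w - a) <= rho by exact: annulus_closure.
have Gz : modulus (G z) <= expR A ^+ q / rho ^+ p.
  have [zr|zr] := leP rho t.
    have tr : t = rho by apply/le_anti; rewrite trho.
    rewrite mG -/t tr ler_pM2r ?invr_gt0 ?exprn_gt0 //.
    by apply: lerXn2r; rewrite ?nnegrE ?mo_ge0 ?expR_ge0 // gA // -/t tr.
  have bdr w : modulus (w - a) = r -> modulus (G w) <= expR A ^+ q / rho ^+ p.
    move=> hw; rewrite mG hw; apply: (@le_trans _ _ (expR B ^+ q / r ^+ p)).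
      rewrite ler_pM2r ?invr_gt0 ?exprn_gt0 //.
      by apply: lerXn2r; rewrite ?nnegrE ?mo_ge0 ?expR_ge0 // gB // hw.
    rewrite ler_pdivrMr ?exprn_gt0 // mulrAC ler_pdivlMr ?exprn_gt0 //.
    have -> : rho = expR Lam * r by rewrite eL divfK // gt_eqF.
    rewrite exprMn mulrA ler_pM2r ?exprn_gt0 // -!expRM_natl -expRD ler_expR.
    clear -p1; lra.
  have [zr'|zr'] := leP t r.
    by apply: bdr; apply/le_anti; rewrite zr'.
  apply: mp.
  - by move=> w /cOm/andP[h1 h2]; have [l /hder_cont] := hG w h1 h2.
  - by move=> w /= /andP[h1 h2]; apply: hG; exact: ltW.
  - move=> w /cOm/andP[h1 h2] /= h3.
    have [h4|h4] := leP (modulus (w - a)) r; first by apply: bdr; apply/le_anti; rewrite h4.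
    have -> : modulus (G w) = modulus (g w) ^+ q / rho ^+ p.
      rewrite mG; congr (_ / _ ^+ _); apply/le_anti; rewrite h2 /= leNgt; apply/negP => h5.
      by apply: h3; rewrite /Om /= h4 h5.
    rewrite ler_pM2r ?invr_gt0 ?exprn_gt0 //.
    by apply: lerXn2r; rewrite ?nnegrE ?mo_ge0 ?expR_ge0 // gA.
  - by apply: subset_closure; rewrite /Om /= -/t zr zr'.
have {Gz} : modulus (g z) ^+ q <= expR A ^+ q / expR mu ^+ p.
  move: Gz; rewrite mG ler_pdivrMr ?exprn_gt0 // => h; apply: (le_trans h).
  rewrite emu -/t expr_div_n invf_div mulrAC mulrA; exact: lexx.
rewrite -(lnK (x := modulus (g z))) ?posrE // -!expRM_natl -expRN -expRD ler_expR -/ga => h.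
have -> : ga - (A - (A - B) * (mu / Lam)) = (ga * q%:R - (A * q%:R - (q%:R * (A - B)) / Lam * mu)) / q%:R.
  by field; rewrite !gt_eqF.
rewrite ler_pdivrMr //.
have h2 : q%:R * (A - B) / Lam * mu <= (p%:R + 1) * mu.
  by rewrite ler_wpM2r // ler_pdivrMr.
have h3 : 1 <= e * q%:R by rewrite -ler_pdivrMr // mul1r.
have h4 : mu <= e * q%:R * mu by rewrite ler_peMl.
move: h h2 h4; set qR := q%:R; set pR := p%:R; clear; lra.
Qed.

Lemma three_circ_in a r s rho A B g z : 0 < r -> r <= s -> s < rho ->
  (forall z, modulus (z - a) <= rho -> exists l, hder g z l) ->
  (forall z, modulus (z - a) <= rho -> modulus (g z) <= expR A) ->
  (forall z, modulus (z - a) <= r -> modulus (g z) <= expR B) -> B <= A ->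
  modulus (z - a) <= s ->
  modulus (g z) <= expR (A - (A - B) * (ln (rho / s) / ln (rho / r))).
Proof.
move=> r0 rs srho hg gA gB BA zs.
have s0 : 0 < s by lra.
have rrho : r < rho by lra.
have rho0 : 0 < rho by lra.
have Ls : 0 < ln (rho / s) by rewrite ln_gt0 // ltr_pdivlMr ?mul1r.
have Lr : 0 < ln (rho / r) by rewrite ln_gt0 // ltr_pdivlMr ?mul1r.
have [zr|zr] := leP (modulus (z - a)) r.
  apply: (le_trans (gB z zr)); rewrite ler_expR lerBrDr -lerBrDl.
  rewrite -[X in _ <= X]mulr1 ler_wpM2l ?subr_ge0 // ler_pdivrMr // mul1r.
  rewrite ler_ln ?posrE ?divr_gt0 // ler_pM2l // lef_pV2 ?posrE //.
apply: (le_trans (three_circ r0 rrho hg gA gB BA _)).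
  by rewrite (ltW zr) /=; lra.
rewrite ler_expR lerD2l lerN2 ler_wpM2l ?subr_ge0 // ler_pM2r ?invr_gt0 //.
have z0 : 0 < modulus (z - a) by lra.
by rewrite ler_ln ?posrE ?divr_gt0 // ler_pM2l // lef_pV2 ?posrE.
Qed.

(** The limit [G] is taken along an ultrafilter. The common Lipschitz constant makes the convergence
    on the smaller disc uniform: for each accuracy the good indices belong to the ultrafilter, and
    the subsequence is picked from these sets. *)
Lemma montel a rho M (g : nat -> C -> C) : 0 < M -> 0 < rho -> (forall n, hol (D a rho) (g n)) ->
  (forall n z, modulus (z - a) < rho -> modulus (g n z) <= M) ->
  exists phi : nat -> nat, {homo phi : m n / (m < n)%N} /\ exists G : C -> C, forall e, 0 < e ->
   exists N, forall n, (N <= n)%N -> forall z, modulus (z - a) < rho / 3 -> modulus (g (phi n) z - G z) < e.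
Proof.
move=> M0 rho0 hg gM.
have [U [UU fU]] := free_ultra.
have exG z : {l : C | modulus (z - a) < rho -> ulim U (fun n => g n z) l}.
  apply/cid; have [hz|hz] := ltP (modulus (z - a)) rho; last by exists 0.
  have [|l ul] := @ulim_ex _ U (fun n => g n z) M UU; last by exists l.
  by apply: filterE => n /=; exact: gM.
pose G z := sval (exG z).
have HG z : modulus (z - a) < rho -> ulim U (fun n => g n z) (G z) by exact: (svalP (exG z)).
set L := 8 * M / rho.
have L0 : 0 < L by rewrite /L divr_gt0 // mulr_gt0.
have lg n z w : modulus (z - a) < rho / 2 -> modulus (w - a) < rho / 2 ->
    modulus (g n z - g n w) <= L * modulus (z - w) by move=> h1 h2; exact: (lip M0 (hg n) (gM n)).
have lG z w : modulus (z - a) < rho / 2 -> modulus (w - a) < rho / 2 ->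
    modulus (G z - G w) <= L * modulus (z - w).
  move=> h1 h2; apply: (ulim_le0 _ (ulimB _ (HG z _) (HG w _))); [lra|lra|].
  by apply: filterE => n /=; exact: lg.
have unif e : 0 < e -> U [set n | forall z, modulus (z - a) < rho / 3 -> modulus (g n z - G z) < e].
  move=> e0; have [//|h] := in_ultra_setVsetC [set n | forall z, modulus (z - a) < rho / 3 -> modulus (g n z - G z) < e] UU.
  exfalso.
  have ex n : {z : C | modulus (z - a) < rho / 3 /\ ((~` [set n | forall z, modulus (z - a) < rho / 3 -> modulus (g n z - G z) < e]) n -> e <= modulus (g n z - G z))}.
    apply/cid; have [[z [z1 z2]]|H] := EM (exists z, modulus (z - a) < rho / 3 /\ e <= modulus (g n z - G z)).
      by exists z.
    exists a; split; first by rewrite subrr mo0; lra.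
    move=> /= H2; exfalso; apply: H2 => z hz; rewrite ltNge; apply/negP => h2; apply: H.
    by exists z.
  pose zz n := sval (ex n).
  have z1 n : modulus (zz n - a) < rho / 3 by have [] := svalP (ex n).
  have [|zs uz] := @ulim_ex _ U zz (modulus a + rho / 3) UU.
    by apply: filterE => n /=; have := mo_subr (zz n) a; have := z1 n; lra.
  have zsa : modulus (zs - a) <= rho / 3.
    by apply: (ulim_le _ uz); apply: filterE => n /=; apply: ltW.
  have e3 : 0 < e / 4 / L by rewrite divr_gt0 //; lra.
  have e4 : 0 < e / 4 by lra.
  have [|n [/= n1 [n2 n3]]] := @filter_ex _ U _ _ (filterI h (filterI (uz _ e3) (HG zs _ _ e4))); first by lra.
  have [_ /(_ n1)] := svalP (ex n); rewrite -/(zz n) => n4.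
  have := lg n (zz n) zs; have := lG zs (zz n); have := z1 n => z1n.
  rewrite (mo_sym zs (zz n)).
  have h1 : modulus (zz n - a) < rho / 2 by lra.
  have h2 : modulus (zs - a) < rho / 2 by lra.
  move=> /(_ h2 h1) k1 /(_ h1 h2) k2.
  have k3 : L * modulus (zz n - zs) <= e / 4 by rewrite mulrC -ler_pdivlMr // ltW.
  have := mo_tri (g n (zz n)) (g n zs) (G (zz n)); have := mo_tri (g n zs) (G zs) (G (zz n)).
  clear -k1 k2 k3 n3 n4 e0; lra.
have pick k m : {n | (m < n)%N /\ forall z, modulus (z - a) < rho / 3 -> modulus (g n z - G z) < (k.+1%:R)^-1}.
  apply/cid; have k0 : 0 < (k.+1%:R)^-1 :> R by rewrite invr_gt0.
  have [n [/= n1 n2]] := @filter_ex _ U _ _ (filterI (unif _ k0) (free_ge m.+1 fU)).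
  by exists n.
pose phi := fix phi k := if k is j.+1 then sval (pick k (phi j)) else sval (pick 0%N 0%N).
have phiP k z : modulus (z - a) < rho / 3 -> modulus (g (phi k) z - G z) < (k.+1%:R)^-1.
  by case: k => [|k] /=; [have [_] := svalP (pick 0%N 0%N)|have [_] := svalP (pick k.+1 (phi k))]; exact.
exists phi; split.
  apply: homo_ltn; first exact: ltn_trans.
  by move=> k /=; have [] := svalP (pick k.+1 (phi k)).
exists G => e e0; have [N HN] := inv_small e0.
by exists N => n /HN h z hz; apply: lt_trans h; exact: phiP.
Qed.

(* A polynomial bound on arbitrarily large circles forces the remainder of interpolation at [k+1] points to vanish. *)
Lemma entire_poly_growth g k : (forall z, exists l, hder g z l) ->
  (forall r, exists2 s, r < s & forall z, modulus z = s -> modulus (g z) <= s ^+ k) ->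
  exists p : {poly C}, forall z, g z = p.[z].
Proof.
move=> hg H.
have interp (ws : seq C) : uniq ws -> exists p : {poly C}, (size p <= size ws)%N /\ forall w, w \in ws -> p.[w] = g w.
  elim: ws => [|w ws IH]; first by exists 0; rewrite size_poly0.
  move=> /= /andP[wws uws]; have [p [sp Hp]] := IH uws.
  pose q : {poly C} := \prod_(v <- ws) ('X - v%:P).
  have qw v : q.[v] = zprod ws v.
    by rewrite /q horner_prod; apply: eq_bigr => u _; rewrite !hornerE.
  have q0 : q.[w] != 0 by rewrite qw zprod_eq0.
  exists (p + ((g w - p.[w]) / q.[w]) *: q); split.
    apply: (leq_trans (size_polyD _ _)); rewrite geq_max leqW //=.
    by apply: (leq_trans (size_scale_leq _ _)); rewrite size_prod_XsubC.
  move=> v; rewrite inE !hornerE => /orP[/eqP ->|vws].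
    by rewrite divfK // addrC subrK.
  have -> : q.[v] = 0 by apply/eqP; rewrite qw zprod_eq0.
  by rewrite mulr0 addr0 Hp.
(* With [k + 2] nodes, the node polynomial has degree [k + 2] and outgrows both the interpolant, of
   degree at most [k + 1], and the bound [s ^+ k] on [g]. *)
pose ws : seq C := [seq rc (i%:R) | i <- iota 0 k.+2].
have uws : uniq ws by rewrite map_inj_uniq ?iota_uniq // => i j /rc_inj /eqP; rewrite eqr_nat => /eqP.
have [p [sp Hp]] := interp ws uws.
exists p => z.
have hp w : exists l, hder (fun z => p.[z]) w l.
  elim/poly_ind: {sp Hp} p => [|q c [l IH]].
    by exists 0; rewrite (_ : (fun z => _) = fun=> 0) ?(hder_cst) //; [exact: hder_cst|apply/funext => v; rewrite horner0].
  exists (l * w + q.[w] * 1 + 0).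
  rewrite (_ : (fun z => _) = fun z => q.[z] * z + c); last by apply/funext => v; rewrite !hornerE.
  by apply: hderD; [apply: hderM => //; exact: hder_id|exact: hder_cst].
have [P P1 HP] : exists2 P : R, 0 < P & forall s v, 1 <= s -> modulus v = s -> modulus p.[v] <= P * s ^+ k.+1.
  exists ((\sum_(i < size p) modulus p`_i) + 1).
    by apply: ltr_wpDl => //; apply: sumr_ge0 => i _; exact: mo_ge0.
  move=> s v s1 vs; rewrite horner_coef.
  apply: (@le_trans _ _ (\sum_(i < size p) modulus p`_i * s ^+ k.+1)).
    elim/big_ind2: _ => [|x1 x2 y1 y2 h1 h2|i _]; first by rewrite mo0.
      by apply: (le_trans (moD _ _)); exact: lerD.
    rewrite moM moX vs ler_wpM2l ?mo_ge0 //; apply: ler_weXn2l => //.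
    by have := ltn_ord i; move/leq_trans/(_ sp); rewrite size_map size_iota.
  by rewrite -mulr_suml ler_wpM2r ?exprn_ge0 ?lerDl //; lra.
apply/eqP; rewrite -subr_eq0 -mo_eq0; apply/eqP/le_anti; rewrite mo_ge0 andbT.
have wsk w : w \in ws -> modulus w <= k.+1%:R.
  suff /allP H' : all (fun w => modulus w <= k.+1%:R) ws by exact: H'.
  rewrite all_map; apply/allP => i; rewrite mem_iota add0n /= => hi.
  by rewrite mo_rc ger0_norm // ler_nat.
have Pp : 0 < P + 1 by rewrite addr_gt0.
set K := (P + 1) * 2 ^+ k.+2.
have K0 : 0 < K by rewrite /K mulr_gt0 // exprn_gt0.
apply: (@le_eps _ _ (K * modulus (zprod ws z))).
  by apply: mulr_ge0; [exact: ltW|exact: mo_ge0].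
move=> e e0.
have [s sr Hs] := H (Num.max (Num.max 1 (2 * k.+1%:R)) (Num.max (modulus z) (e^-1))).
move: sr; rewrite !gt_max => /andP[/andP[s1 sk] /andP[sz se]].
have s0 : 0 < s by lra.
rewrite mulrA.
have zp v : modulus v = s -> (s / 2) ^+ k.+2 <= modulus (zprod ws v).
  move=> vs; have : forall us : seq C, {subset us <= ws} -> (s / 2) ^+ size us <= modulus (zprod us v).
    elim=> [|u us IH] sub; first by rewrite expr0 /zprod big_nil mo1.
    rewrite /= exprS /zprod big_cons moM; apply: ler_pM; rewrite ?exprn_ge0 //; [lra|lra| |].
      have := wsk u; rewrite sub ?inE ?eqxx // => /(_ isT); have := mo_subr v u; rewrite vs; lra.
    by apply: IH => x xus; apply: sub; rewrite inE xus orbT.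
  by move=> /(_ ws (fun _ h => h)); rewrite size_map size_iota.
have := @zdiv_disc _ 0 s ws (fun v => g v - p.[v]) (e * K) uws.
move=> Z; apply: Z.
- by move=> w /wsk; rewrite subr0; lra.
- move=> v _; have [l hl] := hg v; have [m hm] := hp v; exists (l - m); exact: hderB.
- by move=> w /Hp ->; rewrite subrr.
- by rewrite mulr_gt0.
- move=> v; rewrite subr0 => vs.
  apply: (@le_trans _ _ ((P + 1) * s ^+ k.+1)).
    apply: (le_trans (moB _ _)); have := Hs v vs; have := HP s v (ltW s1) vs.
    have : s ^+ k <= s ^+ k.+1 by apply: ler_weXn2l => //; exact: ltW.
    lra.
  apply: (@le_trans _ _ (e * K * (s / 2) ^+ k.+2)).
    rewrite /K mulrA expr_div_n -mulrA (mulrCA (2 ^+ k.+2)) mulfV ?mulr1 ?expf_neq0 //.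
    rewrite [s ^+ k.+2]exprS mulrA ler_wpM2r ?exprn_ge0 ?(ltW s0) //.
    have : 1 <= e * s by rewrite mulrC -ler_pdivrMr // div1r ltW.
    move=> es; rewrite (_ : e * (P + 1) * s = (P + 1) * (e * s)); last by ring.
    by rewrite ler_peMr //; lra.
  by rewrite ler_wpM2l ?zp // mulr_ge0 // ltW.
- by rewrite subr0.
Qed.

End Three.

(** * Contracting loops of the triangular lattice *)

Ltac split_atoms := repeat (match goal with
  | |- context [@eq_op _ ?x ?y] => case: (@eqVneq int x y) => ?
  | |- context [@Order.lt _ _ ?x ?y] => case: (@ltP _ int x y) => ?
  | |- context [@Order.le _ _ ?x ?y] => case: (@leP _ int x y) => ?
  end; rewrite ?andbF ?andbT ?orbT ?orbF /=; try (exfalso; lia)); try by [].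

Section Walks.

Definition vtx := (int * int)%type.
Implicit Types (u v x y p q : vtx) (A B : seq vtx) (w : nat -> vtx) (n m : nat).

(* Neighbours in the triangular lattice: [u - v] is 0, (1, 0), (0, 1), (1, -1) or the opposite of one of these. *)
Definition adj u v : bool :=
  [&& -1 <= u.1 - v.1, u.1 - v.1 <= 1, -1 <= u.2 - v.2, u.2 - v.2 <= 1,
      -1 <= (u.1 - v.1) + (u.2 - v.2) & (u.1 - v.1) + (u.2 - v.2) <= 1].

Lemma adj_refl u : adj u u.
Proof. by rewrite /adj; lia. Qed.

Lemma adj_sym u v : adj u v = adj v u.
Proof. by rewrite /adj; lia. Qed.

Definition valid A n w := (forall i, (i <= n)%N -> w i \in A) /\ forall i, (i < n)%N -> adj (w i) (w i.+1).

(** The hexagon around [w i] then contains the lattice points of [w i], [w i.+1], [w' i] and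
    [w' i.+1]; by convexity the interpolating homotopy stays in it. *)
Definition step A n w w' := [/\ valid A n w, valid A n w', w' 0%N = w 0%N, w' n = w n &
  forall i, (i < n)%N -> adj (w i) (w' i) /\ adj (w i) (w' i.+1)].

Inductive htp A n : (nat -> vtx) -> (nat -> vtx) -> Prop :=
| htp_refl w w' : (forall i, (i <= n)%N -> w i = w' i) -> htp A n w w'
| htp_step w w1 w2 : step A n w w1 -> htp A n w1 w2 -> htp A n w w2.

Lemma valid_ext A n w w' : (forall i, (i <= n)%N -> w i = w' i) -> valid A n w -> valid A n w'.
Proof.
move=> E [h1 h2]; split=> i hi; first by rewrite -E ?h1.
by rewrite -!E ?h2 // ltnW.
Qed.

Lemma step_ext A n w (v w' : nat -> vtx) : (forall i, (i <= n)%N -> v i = w i) -> step A n v w' -> step A n w w'.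
Proof.
move=> E [h1 h2 h3 h4 h5]; split=> //; rewrite -?E //; first exact: valid_ext h1.
by move=> i hi; rewrite -E ?(ltnW hi) //; exact: h5.
Qed.

Lemma htp_trans A n w1 w2 w3 : htp A n w1 w2 -> htp A n w2 w3 -> htp A n w1 w3.
Proof.
move=> H; elim: H w3 => [w w' E|w w' w'' S _ IH] w3 H3; last exact: htp_step S (IH _ H3).
case: H3 E => [v v' E' E|v v' v'' S H E].
  by apply: htp_refl => i hi; rewrite E ?E'.
apply: htp_step H; apply: step_ext S => i hi; by rewrite E.
Qed.

Lemma valid_sub A B n w : {subset A <= B} -> valid A n w -> valid B n w.
Proof. by move=> AB [h1 h2]; split=> // i /h1 /AB. Qed.

Lemma htp_sub A B n w w' : {subset A <= B} -> htp A n w w' -> htp B n w w'.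
Proof.
move=> AB; elim=> [{}w {}w' E|{}w w1 w2 [h1 h2 h3 h4 h5] _ IH]; first exact: htp_refl.
by apply: htp_step IH; split=> //; exact: valid_sub AB _.
Qed.

Definition splice (p m : nat) w (s : nat -> vtx) i := if (p <= i <= p + m)%N then s (i - p)%N else w i.

Lemma splice_valid A B n (p m : nat) w s : {subset B <= A} -> (p + m <= n)%N -> valid A n w -> valid B m s ->
  s 0%N = w p -> s m = w (p + m)%N -> valid A n (splice p m w s).
Proof.
move=> BA pmn [w1 w2] [s1 s2] s0 sm; split=> i hi; rewrite /splice.
  by case: ifP => h; [apply/BA/s1; lia|exact: w1].
case: ifP => h; case: ifP => h'.
- by rewrite subSn; [apply: s2; lia|lia].
- have -> : i = (p + m)%N by lia.
  by rewrite addKn sm; apply: w2; lia.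
- have E : i.+1 = p by lia.
  by rewrite E subnn s0 -E; apply: w2; lia.
- exact: w2.
Qed.

Lemma htp_splice A B n (p m : nat) w s s' : {subset B <= A} -> (p + m <= n)%N -> valid A n w ->
  htp B m s s' -> valid B m s -> s 0%N = w p -> s m = w (p + m)%N ->
  htp A n (splice p m w s) (splice p m w s').
Proof.
move=> BA pmn vw; elim=> {s s'} [s s' E|s s1 s2 [h1 h2 h3 h4 h5] _ IH] vs s0 sm.
  by apply: htp_refl => i hi; rewrite /splice; case: ifP => h //; apply: E; lia.
apply: htp_step (IH h2 _ _); [|by rewrite h3|by rewrite h4].
have v1 := splice_valid BA pmn vw vs s0 sm.
have v2 := splice_valid BA pmn vw h2 (etrans h3 s0) (etrans h4 sm).
split=> //.
- by rewrite /splice; case: ifP => h //; have -> : (0 - p)%N = 0%N by lia.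
- rewrite /splice; case: ifP => h //.
  by have -> : (n - p)%N = m by lia.
move=> i hi; have [_ /(_ i hi)] := v1; have [_ wi] := vw.
rewrite /splice; case: ifP => h; case: ifP => h' hh.
- by rewrite subSn; [apply: h5; lia|lia].
- split; last by [].
  have -> : (i - p)%N = m by lia.
  by rewrite h4 adj_refl.
- have E : i.+1 = p by lia.
  by rewrite adj_refl E subnn h3 s0 -E; split=> //; apply: wi.
- by rewrite adj_refl hh.
Qed.

(* [y] lies beyond [A] in one of the four coordinate directions; such points are joined to infinity off [A]. *)
Definition out A y := [\/ forall u, u \in A -> u.1 < y.1, forall u, u \in A -> y.1 < u.1,
  forall u, u \in A -> u.2 < y.2 | forall u, u \in A -> y.2 < u.2].

Definition cclosed A (P : vtx -> Prop) := forall u v, u \notin A -> v \notin A -> adj u v -> P u -> P v.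

(* [A] has no holes: from every point off [A] one can walk to a point of [out A] without meeting [A]. *)
Definition esc A := forall x (P : vtx -> Prop), x \notin A -> P x -> cclosed A P -> exists2 y, out A y & P y.

Lemma out_sub A B y : {subset B <= A} -> out A y -> out B y.
Proof.
by move=> BA; case=> h; [constructor 1|constructor 2|constructor 3|constructor 4] => u /BA; exact: h.
Qed.

(* Of the six neighbours of [v], exactly [lft v], [dwn v] and [dwr v] have a smaller [psi], and none has the same. *)
Definition psi u : int := u.1 + 2 * u.2.

Section Parity.

(** Whether the edge crosses the ray running to the right from [p], shifted upwards to between two
    rows so that it meets no vertex. The endpoint on the row of [p] decides; for a closed walk,
    [par] is then the winding number modulo 2. *)
Definition cross p u u' : bool :=
  [&& u.2 == p.2, u'.2 == p.2 + 1 & p.1 < u.1] || [&& u'.2 == p.2, u.2 == p.2 + 1 & p.1 < u'.1].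

Definition par (L : nat) w p := \big[addb/false]_(i < L) cross p (w i) (w i.+1).

Lemma telescope_addb (S : vtx -> bool) L w :
  \big[addb/false]_(i < L) (S (w i) (+) S (w i.+1)) = S (w 0%N) (+) S (w L).
Proof.
elim: L => [|L IH]; first by rewrite big_ord0 addbb.
by rewrite big_ord_recr IH /= -addbA addKb.
Qed.

Lemma cross_right p u u' : adj u u' -> u != (p.1 + 1, p.2) -> u' != (p.1 + 1, p.2) ->
  cross (p.1 + 1, p.2) u u' = cross p u u'.
Proof.
case: u => a b; case: u' => a' b'; case: p => c d; rewrite /adj /cross !xpair_eqE /= => h1 h2 h3; split_atoms.
Qed.

Lemma cross_up p u u' : adj u u' -> u != p -> u' != p -> u != (p.1, p.2 + 1) -> u' != (p.1, p.2 + 1) ->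
  cross p u u' (+) cross (p.1, p.2 + 1) u u' =
  ((p.1 < u.1) && (u.2 == p.2 + 1)) (+) ((p.1 < u'.1) && (u'.2 == p.2 + 1)).
Proof.
case: u => a b; case: u' => a' b'; case: p => c d; rewrite /adj /cross !xpair_eqE /= => h1 h2 h3 h4 h5; split_atoms.
Qed.

Lemma cross_upleft p u u' : adj u u' -> u != p -> u' != p -> u != (p.1 - 1, p.2 + 1) -> u' != (p.1 - 1, p.2 + 1) ->
  cross p u u' (+) cross (p.1 - 1, p.2 + 1) u u' =
  ((p.1 <= u.1) && (u.2 == p.2 + 1)) (+) ((p.1 <= u'.1) && (u'.2 == p.2 + 1)).
Proof.
case: u => a b; case: u' => a' b'; case: p => c d; rewrite /adj /cross !xpair_eqE /= => h1 h2 h3 h4 h5; split_atoms.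
Qed.

(** Up to symmetry [q] is the right, upper or upper left neighbour of [p]. Edge by edge the
    crossings agree, or differ by a term that telescopes around the closed walk. *)
Lemma par_adj A L w p q : valid A L w -> w L = w 0%N -> p \notin A -> q \notin A -> adj p q ->
  par L w p = par L w q.
Proof.
move=> [wA wadj] wc pA qA.
have ne r (i : 'I_L) : r \notin A -> (w i != r) && (w i.+1 != r).
  move=> rA; apply/andP; split; apply: contraNneq rA => <-; apply: wA; have := ltn_ord i; lia.
have main r r' : r \notin A -> r' \notin A ->
    [\/ r' = (r.1 + 1, r.2), r' = (r.1, r.2 + 1) | r' = (r.1 - 1, r.2 + 1)] -> par L w r = par L w r'.
  move=> rA r'A; case=> E; apply/eqP; rewrite -negb_add; apply/negPf; rewrite /par -big_split /=.
  - rewrite big1 // => i _; have /andP[n1 n2] := ne r' i r'A; move: n1 n2; rewrite E => n1 n2.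
    by rewrite cross_right ?addbb //; apply: wadj.
  - pose S := fun u : vtx => (r.1 < u.1) && (u.2 == r.2 + 1).
    transitivity (S (w 0%N) (+) S (w L)); last by rewrite wc addbb.
    rewrite -telescope_addb; apply: eq_bigr => i _.
    have /andP[n1 n2] := ne r' i r'A; have /andP[n3 n4] := ne r i rA; move: n1 n2; rewrite E => n1 n2.
    by rewrite cross_up //; apply: wadj.
  - pose S := fun u : vtx => (r.1 <= u.1) && (u.2 == r.2 + 1).
    transitivity (S (w 0%N) (+) S (w L)); last by rewrite wc addbb.
    rewrite -telescope_addb; apply: eq_bigr => i _.
    have /andP[n1 n2] := ne r' i r'A; have /andP[n3 n4] := ne r i rA; move: n1 n2; rewrite E => n1 n2.
    by rewrite cross_upleft //; apply: wadj.
case: p pA => a b pA; case: q qA => a' b' qA h.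
have : [\/ (a', b') = (a, b), [\/ (a', b') = (a + 1, b), (a', b') = (a, b + 1) | (a', b') = (a - 1, b + 1)] |
  [\/ (a, b) = (a' + 1, b'), (a, b) = (a', b' + 1) | (a, b) = (a' - 1, b' + 1)]].
  move: h; rewrite /adj /= => h.
  have [E1|E1] := eqVneq a' a; have [E2|E2] := eqVneq b' b.
  - by constructor 1; rewrite E1 E2.
  - have [E3|E3] := eqVneq b' (b + 1).
      by constructor 2; constructor 2; rewrite E1 E3.
    by constructor 3; constructor 2; congr pair; lia.
  - have [E3|E3] := eqVneq a' (a + 1).
      by constructor 2; constructor 1; rewrite E2 E3.
    by constructor 3; constructor 1; congr pair; lia.
  - have [E3|E3] := eqVneq b' (b + 1).
      by constructor 2; constructor 3; congr pair; lia.
    by constructor 3; constructor 3; congr pair; lia.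
case=> [->//|H|H]; first exact: main.
by apply/esym/main.
Qed.

(** No edge meets the ray, except when [A] lies to the right of [y]: then every change between the
    two rows counts, and these changes telescope. *)
Lemma par_out A L w y : valid A L w -> w L = w 0%N -> out A y -> par L w y = false.
Proof.
move=> [wA wadj] wc.
have wA1 (i : 'I_L) : w i \in A /\ w i.+1 \in A by split; apply: wA; have := ltn_ord i; lia.
case=> H; rewrite /par.
- by apply: big1 => i _; have [/H h1 /H h2] := wA1 i; rewrite /cross; lia.
- transitivity (((w 0%N).2 <= y.2) (+) ((w L).2 <= y.2)); last by rewrite wc addbb.
  rewrite -(telescope_addb (fun u => u.2 <= y.2)); apply: eq_bigr => i _.
  have [/H h1 /H h2] := wA1 i; have := wadj i (ltn_ord i); rewrite /cross /adj => h3; split_atoms.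
- by apply: big1 => i _; have [/H h1 /H h2] := wA1 i; rewrite /cross; lia.
- by apply: big1 => i _; have [/H h1 /H h2] := wA1 i; rewrite /cross; lia.
Qed.

End Parity.

Definition lft v : vtx := (v.1 - 1, v.2).
Definition dwn v : vtx := (v.1, v.2 - 1).
Definition dwr v : vtx := (v.1 + 1, v.2 - 1).

(* A path from [dwr v] to [lft v] avoiding the extremal vertex [v] closes up to a cycle which crosses
   the ray from [dwn v] exactly once. *)
Lemma no_pinch_path A v : esc A -> v \in A -> (forall u, u \in A -> psi u <= psi v) -> dwn v \notin A ->
  forall m w, (forall i, (i <= m)%N -> w i \in A /\ w i != v) -> (forall i, (i < m)%N -> adj (w i) (w i.+1)) ->
  w 0%N = dwr v -> w m = lft v -> False.
Proof.
move=> eA vA vmax bA m w wA wadj w0 wm.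
pose W i := if i is j.+1 then (if (j <= m)%N then w j else v) else v.
have vW : valid A m.+2 W.
  split; first by move=> [|i] hi //=; case: ifP => // h; have [] := wA i h.
  move=> [|i] hi /=; first by rewrite w0 /adj /=; lia.
  have -> : (i <= m)%N by lia.
  case: ifP => h; first exact: wadj.
  have -> : i = m by lia.
  by rewrite wm /adj /=; lia.
have Wc : W m.+2 = W 0%N by rewrite /= ltnn.
have [||y oy] := eA (dwn v) (fun p => par m.+2 W p = true) bA.
- rewrite /par big_ord_recl big_ord_recr /= ltnn w0 leqnn wm.
  rewrite big1 ?addbF.
    by rewrite /cross /=; lia.
  move=> i _; rewrite /bump /= add1n (ltnW (ltn_ord i)) ltn_ord.
  have [h1 n1] := wA i (ltnW (ltn_ord i)); have [h2 n2] := wA i.+1 (ltn_ord i).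
  have := vmax _ h1; have := vmax _ h2; have := wadj i (ltn_ord i).
  move: n1 n2; case: (w i) => a b; case: (w i.+1) => a' b'; case: (v) => c d.
  rewrite /psi /cross /adj !xpair_eqE /= => h3 h4 h5 h6 h7; split_atoms.
- by move=> p q pA qA pq <-; apply/esym/(par_adj vW Wc).
- by rewrite (par_out vW Wc oy).
Qed.

Definition cst (o : vtx) : nat -> vtx := fun=> o.

(* Homotopies keep the length [n] of a walk, whose steps may be trivial. *)
Definition contractible A := forall n w, valid A n w -> w n = w 0%N -> htp A n w (cst (w 0%N)).

Definition rm v A := [seq u <- A | u != v].

Lemma size_filter_lt (P : pred vtx) A x : x \in A -> ~~ P x -> (size (seq.filter P A) < size A)%N.
Proof.
move=> xA Px; rewrite size_filter -(count_predC P A) -[X in (X < _)%N]addn0 ltn_add2l -has_count.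
by apply/hasP; exists x.
Qed.

(** The upper neighbour of [v] has larger [psi], hence lies off [A], and [v] is joined to the
    outside through it. *)
Lemma esc_rm A v : esc A -> (forall u, u \in A -> psi u <= psi v) -> esc (rm v A).
Proof.
move=> eA vmax x P xA Px cP.
have upA : (v.1, v.2 + 1) \notin A by apply/negP => /vmax; rewrite /psi /=; lia.
have sub u : u \notin A -> u \notin rm v A by apply: contra; rewrite mem_filter => /andP[].
have cP' : cclosed A P by move=> u u' /sub h1 /sub h2; exact: cP.
have oo y : out A y -> out (rm v A) y by apply: out_sub => u; rewrite mem_filter => /andP[].
have [xA'|xA'] := boolP (x \in A); last by have [y /oo] := eA x P xA' Px cP'; exists y.
have xv : x = v by move: xA; rewrite mem_filter xA' andbT negbK => /eqP.
have Pu : P (v.1, v.2 + 1).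
  by apply: (cP x) => //; [exact: sub|rewrite xv /adj /=; lia].
by have [y /oo] := eA _ P upA Pu cP'; exists y.
Qed.

(** Replacing every visit to [v] by [t] is a single [step]. *)
Lemma retract A v t : (forall u, u \in rm v A -> adj u v -> adj u t) -> t \in rm v A -> adj v t ->
  contractible (rm v A) -> forall n w, valid A n w -> w n = w 0%N -> w 0%N != v -> htp A n w (cst (w 0%N)).
Proof.
move=> ut tA vt cA n w [wA wadj] wc w0v.
have sub : {subset rm v A <= A} by move=> u; rewrite mem_filter => /andP[].
pose w' i := if w i == v then t else w i.
have rA i : (i <= n)%N -> w' i \in rm v A.
  by move=> hi; rewrite /w'; case: ifPn => // h; rewrite mem_filter h wA.
have aa i : (i < n)%N -> adj (w i) (w' i.+1).
  move=> hi; rewrite /w'; case: ifPn => [/eqP h|_]; last exact: wadj.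
  have [->//|iv] := eqVneq (w i) v.
  by apply: ut; [rewrite mem_filter iv wA // ltnW|rewrite -h wadj].
have v' : valid (rm v A) n w'.
  split=> // i hi; have := aa i hi; rewrite {2}/w'; case: ifPn => // /eqP iv.
  move=> h; rewrite adj_sym.
  have [E|ne] := boolP (w i.+1 == v); first by rewrite /w' E adj_refl.
  apply: ut; first by apply: rA.
  by rewrite /w' (negbTE ne) adj_sym -iv wadj.
have E0 : w' 0%N = w 0%N by rewrite /w' (negbTE w0v).
have En : w' n = w n by rewrite /w' wc (negbTE w0v).
apply: (htp_step (w1 := w')).
  split=> //; [exact: valid_sub sub v'|].
  move=> i hi; split; last exact: aa.
  by rewrite /w'; case: ifPn => [/eqP ->//|_]; rewrite adj_refl.
rewrite -E0; apply: htp_sub sub _; apply: cA => //; by rewrite En E0.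
Qed.

Section Pinch.
Variables (A : seq vtx) (v : vtx) (Z : pred vtx).
Hypothesis vA : v \in A.
Hypothesis vmax : forall u, u \in A -> psi u <= psi v.
Hypothesis eA : esc A.
Hypothesis bA : dwn v \notin A.
Hypothesis Zv : ~~ Z v.

Definition part (Q : pred vtx) := [seq u <- A | (u == v) || Q u].

(** A point of [A] outside the part escapes upwards: the climb cannot meet [v], as [dwn v] is not in
    [A], nor enter the part, by [noedge]; so it ends by leaving [A]. *)
Lemma esc_part (Q : pred vtx) : (forall u u', u \in rm v A -> u' \in rm v A -> adj u u' -> ~~ Q u -> ~~ Q u') ->
  esc (part Q).
Proof.
move=> noedge x P xA Px cP.
have sub u : u \notin A -> u \notin part Q by apply: contra; rewrite mem_filter => /andP[].
have cP' : cclosed A P by move=> u u' /sub h1 /sub h2; exact: cP.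
have oo y : out A y -> out (part Q) y by apply: out_sub => u; rewrite mem_filter => /andP[].
suff [z zA Pz] : exists2 z, z \notin A & P z by have [y /oo] := eA zA Pz cP'; exists y.
have bound : exists M : int, forall u, u \in A -> u.2 <= M.
  elim: (A) => [|u s [M IH]]; first by exists 0.
  exists (Num.max u.2 M) => z; rewrite inE => /orP[/eqP ->|/IH]; lia.
have [M HM] := bound.
have [k] := ubnP (`|M - x.2|%N); elim: k x xA Px => // k IH x xA Px hk.
have [xA'|xA'] := boolP (x \in A); last by exists x.
have xv : x != v by apply: contraNneq xA => ->; rewrite mem_filter eqxx.
have nQ : ~~ Q x by apply: contra xA => Qx; rewrite mem_filter Qx orbT.
pose x1 : vtx := (x.1, x.2 + 1).
have ax : adj x x1 by rewrite /adj /=; lia.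
have x1A : x1 \notin part Q.
  have [x1A|x1A] := boolP (x1 \in A); last by rewrite mem_filter (negbTE x1A) andbF.
  rewrite mem_filter x1A andbT negb_or.
  have x1v : x1 != v.
    apply: contraNneq bA => <-; rewrite /dwn /x1 /=.
    by rewrite addrK -surjective_pairing.
  by rewrite x1v; apply: (noedge x) => //; rewrite mem_filter ?xv ?x1v.
have [x1A'|x1A'] := boolP (x1 \in A); last by exists x1 => //; apply: (cP x).
apply: (IH x1) => //; first exact: (cP x).
have := HM _ xA'; have := HM _ x1A'; move: hk; rewrite /x1 /=; clear; lia.
Qed.

Hypothesis noedge : forall u u', u \in rm v A -> u' \in rm v A -> adj u u' -> Z u = Z u'.
Hypothesis Zne : exists2 z, z \in A & Z z.
Hypothesis Yne : exists2 y, y \in rm v A & ~~ Z y.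
Hypothesis IH : forall B, (size B < size A)%N -> esc B -> contractible B.

(** [v] is a cut vertex between [Z] and the rest. A walk enters and leaves [Z] only through [v], so
    each excursion lies in the smaller set [part Z] and contracts to [v]; once none is left, the
    walk lies in the other part. *)
Lemma pinch n w : valid A n w -> w n = w 0%N -> w 0%N != v -> ~~ Z (w 0%N) -> htp A n w (cst (w 0%N)).
Proof.
have subP Q : {subset part Q <= A} by move=> u; rewrite mem_filter => /andP[].
have c1 : contractible (part Z).
  apply: IH; last first.
    by apply: esc_part => u u' h1 h2 h3; rewrite (noedge h1 h2 h3).
  have [y] := Yne; rewrite mem_filter => /andP[yv yA] nZ.
  by apply: size_filter_lt yA _; rewrite (negbTE yv).
have c2 : contractible (part (predC Z)).
  apply: IH; last first.
    by apply: esc_part => u u' h1 h2 h3 /=; rewrite (noedge h1 h2 h3).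
  have [z zA Zz] := Zne; apply: size_filter_lt zA _; rewrite /= Zz orbF.
  by apply: contraNneq Zv => <-.
move=> vw wc w0v Z0.
have [k] := ubnP (\sum_(i < n.+1) Z (w i)); elim: k w vw wc w0v Z0 => // k IHk w vw wc w0v Z0 hk.
have [wA wadj] := vw.
have [noZ|] := boolP [forall i : 'I_n.+1, ~~ Z (w i)].
  apply: htp_sub (subP (predC Z)) _; apply: c2 => //; split=> // i hi.
  by rewrite mem_filter wA // andbT /= (forallP noZ (Ordinal (hi : (i < n.+1)%N))) orbT.
rewrite negb_forall => /existsP[[i0 hi0]]; rewrite negbK /= => Zi0.
have exj : exists j, (j <= n)%N && Z (w j) by exists i0; rewrite -ltnS hi0.
have [j /andP[jn Zj] jmin] := ex_minnP exj.
have j0 : (0 < j)%N by case: j Zj {jmin jn} => // h; rewrite h in Z0.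
have edge i : (i < n)%N -> Z (w i) != Z (w i.+1) -> ~~ Z (w i) -> w i = v.
  move=> hi ne nZ; apply/eqP; apply: contraT => iv.
  have i1v : w i.+1 != v by apply: contraNneq Zv => <-; move: ne; rewrite (negbTE nZ); case: (Z _).
  by rewrite (noedge (u := w i) (u' := w i.+1)) ?eqxx ?mem_filter ?iv ?i1v ?wA ?wadj // ltnW in ne.
have edge' i : (i < n)%N -> Z (w i) != Z (w i.+1) -> ~~ Z (w i.+1) -> w i.+1 = v.
  move=> hi ne nZ; apply/eqP; apply: contraT => iv.
  have i1v : w i != v by apply: contraNneq Zv => <-; move: ne; rewrite (negbTE nZ); case: (Z _).
  by rewrite (noedge (u := w i) (u' := w i.+1)) ?eqxx ?mem_filter ?iv ?i1v ?wA ?wadj // ltnW in ne.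
have nZj1 : ~~ Z (w j.-1).
  have j1 : (j.-1 <= n)%N by apply: leq_trans (leq_pred _) jn.
  by apply/negP => h; have := jmin j.-1; rewrite h j1 => /(_ isT); rewrite leqNgt ltn_predL j0.
have wj1 : w j.-1 = v.
  by apply: edge; rewrite ?prednK ?Zj ?(negbTE nZj1).
have exk : exists l, [&& (j <= l)%N, (l <= n)%N & ~~ Z (w l)] by exists n; rewrite jn leqnn wc.
have [l /and3P[jl ln nZl] lmin] := ex_minnP exk.
have jl' : (j < l)%N by rewrite ltn_neqAle jl andbT; apply: contraNneq nZl => <-.
have Zl1 i : (j <= i < l)%N -> Z (w i).
  move=> /andP[ji il]; apply: contraT => h; have := lmin i; rewrite h ji (leq_trans (ltnW il) ln) => /(_ isT).
  by rewrite leqNgt il.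
have wl : w l = v.
  have l0 : (0 < l)%N by apply: leq_ltn_trans jl'.
  have := @edge' l.-1; rewrite prednK //.
  by apply=> //; rewrite ?(negbTE nZl) ?Zl1 //; move: jl' l0 ln; clear; lia.
(* The first excursion, together with the visits to [v] at both its ends. *)
pose p := j.-1; pose m := (l - p)%N; pose s i := w (p + i)%N.
have pm : (p + m = l)%N by rewrite /m subnKC // /p; exact: leq_trans (leq_pred _) jl.
have vs : valid (part Z) m s.
  split=> i hi; last by rewrite /s addnS; apply: wadj; move: hi pm ln; clear; lia.
  rewrite mem_filter /s wA ?andbT; last by move: hi pm ln; clear; lia.
  have [->|i0'] := eqVneq i 0%N; first by rewrite addn0 wj1 eqxx.
  have [->|im] := eqVneq i m; first by rewrite pm wl eqxx.
  by rewrite Zl1 ?orbT //; move: hi im i0' jl' j0; rewrite /m /p; clear; lia.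
have s0 : s 0%N = w p by rewrite /s addn0.
have sm : s m = w (p + m)%N by [].
have hc : htp (part Z) m s (cst v).
  have := c1 m s vs; rewrite sm s0 pm wl wj1; exact.
have pmn : (p + m <= n)%N by rewrite pm.
have H1 := htp_splice (@subP Z) pmn vw hc vs s0 sm.
have vc : valid (part Z) m (cst v).
  by split=> i _; [rewrite mem_filter /cst eqxx|rewrite adj_refl].
set w2 := splice p m w (cst v) in H1.
have v2 : valid A n w2.
  by apply: (splice_valid (@subP Z) pmn vw vc); rewrite ?wj1 ?pm ?wl.
have E0 : w2 0%N = w 0%N.
  rewrite /w2 /splice; case: ifP => // h; rewrite /cst -wj1 /p in h *; congr w; move: h; clear; lia.
have En : w2 n = w n.
  rewrite /w2 /splice; case: ifP => // h; rewrite /cst -wl; congr w; move: h pm ln; clear; lia.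
apply: (htp_trans (w2 := splice p m w s)).
  by apply: htp_refl => i hi; rewrite /splice; case: ifP => // h; rewrite /s subnKC //; case/andP: h.
apply: htp_trans H1 _; rewrite -E0; apply: IHk => //; rewrite ?En ?E0 //.
rewrite ltnS in hk; apply: leq_trans hk.
have jO : (j < n.+1)%N by [].
rewrite (bigD1 (Ordinal jO)) //= [X in (_ < X)%N](bigD1 (Ordinal jO)) //= Zj.
have -> : w2 j = v.
  by rewrite /w2 /splice; case: ifP => // h; exfalso; move: h pm jl'; rewrite /p; clear; lia.
rewrite (negbTE Zv) add0n add1n ltnS; apply: leq_sum => i _.
by rewrite /w2 /splice; case: ifP => // _; rewrite /cst (negbTE Zv).
Qed.

End Pinch.

(** By maximality the neighbours of [v] in [A] are among [lft v], [dwn v] and [dwr v], the middle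
    one being adjacent to the others. So [v] can be pushed to a neighbour, or is never visited,
    unless [lft v] and [dwr v] are in [A] and [dwn v] is not; then [no_pinch_path] makes [v] a cut
    vertex. *)
Lemma peel A v n w : esc A -> (forall B, (size B < size A)%N -> esc B -> contractible B) ->
  v \in A -> (forall u, u \in A -> psi u <= psi v) -> valid A n w -> w n = w 0%N -> w 0%N != v ->
  htp A n w (cst (w 0%N)).
Proof.
move=> eA IH vA vmax vw wc w0v.
have cr : contractible (rm v A).
  by apply: IH; [apply: size_filter_lt vA _; rewrite eqxx|exact: esc_rm].
have nb u : u \in rm v A -> adj u v -> [\/ u = lft v, u = dwn v | u = dwr v].
  rewrite mem_filter => /andP[uv /vmax]; move: uv; case: u => a b; case: (v) => c d.
  rewrite /adj /psi /lft /dwn /dwr xpair_eqE /= => uv h1 h2.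
  have [E|E] := eqVneq a (c - 1); first by constructor 1; congr pair; lia.
  have [E'|E'] := eqVneq a c; first by constructor 2; congr pair; lia.
  by constructor 3; congr pair; lia.
have rmE u : u != v -> (u \in rm v A) = (u \in A) by move=> uv; rewrite mem_filter uv.
have nl : lft v != v by case: (v) => c d; rewrite /lft xpair_eqE /=; lia.
have nd : dwn v != v by case: (v) => c d; rewrite /dwn xpair_eqE /=; lia.
have nr : dwr v != v by case: (v) => c d; rewrite /dwr xpair_eqE /=; lia.
have al : adj v (lft v) by rewrite /adj /=; clear; lia.
have ad : adj v (dwn v) by rewrite /adj /=; clear; lia.
have ar : adj v (dwr v) by rewrite /adj /=; clear; lia.
have ald : adj (lft v) (dwn v) by rewrite /adj /=; clear; lia.
have ard : adj (dwr v) (dwn v) by rewrite /adj /=; clear; lia.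
have [bA|bA] := boolP (dwn v \in A).
  apply: (@retract A v (dwn v)) => //; last by rewrite rmE.
  by move=> u uA uv; case: (nb u uA uv) => ->; rewrite ?adj_refl.
have [aA|aA] := boolP (lft v \in A); have [cA|cA] := boolP (dwr v \in A); last first.
- have wv i : (i <= n)%N -> w i != v.
    elim: i => // i IHi hi; apply/eqP => E; have [wA wadj] := vw.
    have := nb (w i); rewrite mem_filter IHi ?(ltnW hi) // wA ?(ltnW hi) // -E wadj // E.
    move=> /(_ isT isT) [] E'; move: (wA i (ltnW hi)); rewrite E' ?(negbTE aA) ?(negbTE bA) ?(negbTE cA) //.
  apply: (@htp_sub (rm v A)); first by move=> u; rewrite mem_filter => /andP[].
  by apply: cr => //; case: vw => wA wadj; split=> // i hi; rewrite mem_filter wv ?wA.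
- apply: (@retract A v (dwr v)) => //; last by rewrite rmE.
  move=> u uA uv; have uA' : u \in A by move: uA; rewrite mem_filter => /andP[].
  by case: (nb u uA uv) => E; move: uA'; rewrite E ?adj_refl // ?(negbTE aA) ?(negbTE bA).
- apply: (@retract A v (lft v)) => //; last by rewrite rmE.
  move=> u uA uv; have uA' : u \in A by move: uA; rewrite mem_filter => /andP[].
  by case: (nb u uA uv) => E; move: uA'; rewrite E ?adj_refl // ?(negbTE cA) ?(negbTE bA).
(* The vertices joined to [dwr v] within [A] off [v]. Whichever side misses the base point plays the
   role of [Z] in [pinch]. *)
pose X u := `[< exists m s, [/\ forall i, (i <= m)%N -> s i \in A /\ s i != v,
   forall i, (i < m)%N -> adj (s i) (s i.+1), s 0%N = dwr v & s m = u] >].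
have Xv : ~~ X v by apply/negP => /asboolP[m [s [h _ _ E]]]; have [_] := h m (leqnn m); rewrite E eqxx.
have Xc : X (dwr v).
  by apply/asboolP; exists 0%N, (cst (dwr v)); split => // i _; split.
have Xa : ~~ X (lft v).
  by apply/negP => /asboolP[m [s [h1 h2 h3 h4]]]; exact: (@no_pinch_path A v eA vA vmax bA m s).
have Xe u u' : u \in rm v A -> u' \in rm v A -> adj u u' -> X u -> X u'.
  move=> _; rewrite mem_filter => /andP[u'v u'A] auu' /asboolP[m [s [h1 h2 h3 h4]]].
  apply/asboolP; exists m.+1, (fun i => if (i <= m)%N then s i else u'); split => //; last by rewrite ltnn.
    by move=> i hi; case: ifP => // /h1.
  move=> i hi; have im : (i <= m)%N by rewrite -ltnS.
  rewrite im; case: ltnP => h; first exact: h2.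
  have -> : i = m by apply/eqP; rewrite eqn_leq im.
  by rewrite h4.
have Xe' u u' : u \in rm v A -> u' \in rm v A -> adj u u' -> X u = X u'.
  by move=> h1 h2 h3; apply/idP/idP; apply: Xe => //; rewrite adj_sym.
have [Xo|Xo] := boolP (X (w 0%N)).
  pose Y u := (u != v) && ~~ X u.
  apply: (@pinch A v Y) => //.
  - by rewrite /Y eqxx.
  - move=> u u' h1 h2 h3; move: (h1) (h2); rewrite !mem_filter /Y => /andP[-> _] /andP[-> _].
    by rewrite (Xe' u u').
  - by exists (lft v) => //; rewrite /Y nl Xa.
  - by exists (dwr v); rewrite ?rmE // /Y Xc andbF.
  - by rewrite /Y Xo andbF.
apply: (@pinch A v X) => //; first by exists (dwr v).
by exists (lft v); rewrite ?rmE.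
Qed.

(** A lattice automorphism exchanging maxima and minima of [psi], for the case that the base point
    is the maximum. *)
Definition opv u : vtx := (- u.1, - u.2).

Lemma opvK u : opv (opv u) = u.
Proof. by case: u => a b; rewrite /opv /= !opprK. Qed.

Lemma adj_opv u v : adj (opv u) (opv v) = adj u v.
Proof. by rewrite /adj /=; lia. Qed.

Lemma mem_opv A u : (u \in map opv A) = (opv u \in A).
Proof. by rewrite -{1}(opvK u) mem_map //; exact: can_inj opvK. Qed.

Lemma valid_opv A n w : valid A n w -> valid (map opv A) n (opv \o w).
Proof.
by move=> [h1 h2]; split=> i hi; rewrite ?mem_opv /= ?opvK ?adj_opv; [exact: h1|exact: h2].
Qed.

Lemma htp_opv A n w w' : htp A n w w' -> htp (map opv A) n (opv \o w) (opv \o w').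
Proof.
elim=> [{}w {}w' E|{}w w1 w2 [h1 h2 h3 h4 h5] _ IH].
  by apply: htp_refl => i hi /=; rewrite E.
apply: htp_step IH; split; rewrite /= ?h3 ?h4 //; try exact: valid_opv.
by move=> i hi; rewrite !adj_opv; exact: h5.
Qed.

Lemma esc_opv A : esc A -> esc (map opv A).
Proof.
move=> eA x P; rewrite mem_opv => xA Px cP.
have [||y oy Py] := eA (opv x) (fun u => P (opv u)) xA; rewrite ?opvK //.
  by move=> u u' h1 h2 h3; apply: cP; rewrite ?mem_opv ?opvK ?adj_opv.
exists (opv y) => //; case: oy => H; [constructor 2|constructor 1|constructor 4|constructor 3];
  by move=> u; rewrite mem_opv => /H; rewrite /opv /=; lia.
Qed.

Lemma argmaxseq A (f : vtx -> int) : A != [::] -> exists2 v, v \in A & forall u, u \in A -> f u <= f v.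
Proof.
elim: A => // a A IH _; have [->|/IH[v vA Hv]] := eqVneq A [::].
  by exists a; rewrite ?mem_head // => u; rewrite inE => /eqP ->.
have [le|lt] := leP (f a) (f v).
  exists v; first by rewrite inE vA orbT.
  by move=> u; rewrite inE => /orP[/eqP ->|/Hv].
exists a; first exact: mem_head.
by move=> u; rewrite inE => /orP[/eqP -> //|/Hv h]; lia.
Qed.

(** The vertex to be peeled must differ from the base point: the maximum of [psi] or, after
    reflection, the minimum. If the base point is both, [psi] is constant on [A] and any other
    vertex is a maximum. *)
Lemma esc_contractible A : esc A -> contractible A.
Proof.
have [k] := ubnP (size A); elim: k A => // k IHk A hk eA n w vw wc.
have IH B : (size B < size A)%N -> esc B -> contractible B by move=> h; apply: IHk; lia.
have oA : w 0%N \in A by case: vw => h _; apply: h.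
have Ane : A != [::] by case: (A) oA.
have [vM vMA HM] := argmaxseq psi Ane.
have [EM|NM] := eqVneq (w 0%N) vM; last exact: peel eA IH vMA HM vw wc NM.
have [vm vmA Hm] := argmaxseq (fun u => - psi u) Ane.
have [Em|Nm] := eqVneq (w 0%N) vm; last first.
  have E : map opv (map opv A) = A.
    by rewrite -map_comp -[RHS]map_id; apply: eq_map => u /=; rewrite opvK.
  have : htp (map opv A) n (opv \o w) (cst ((opv \o w) 0%N)).
    apply: (@peel _ (opv vm)).
    - exact: esc_opv.
    - by move=> B; rewrite size_map; exact: IH.
    - by rewrite mem_opv opvK.
    - move=> u; rewrite mem_opv => /Hm; rewrite /psi /=; lia.
    - exact: valid_opv.
    - by rewrite /= wc.
    - by rewrite /= (inj_eq (can_inj opvK)).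
  move=> /htp_opv; rewrite E => H.
  apply: (htp_trans (w2 := opv \o (opv \o w))); first by apply: htp_refl => i _ /=; rewrite opvK.
  by apply: htp_trans H _; apply: htp_refl => i _ /=; rewrite /cst opvK.
have [[u uA uo]|no] := pselect (exists2 u, u \in A & u != w 0%N).
  apply: (peel eA IH uA _ vw wc); last by rewrite eq_sym.
  move=> x xA; have := HM x xA; have := Hm u uA; rewrite -EM -Em; lia.
apply: htp_refl => i hi; rewrite /cst; apply/eqP; apply: contraT => h; exfalso; apply: no.
by exists (w i) => //; case: vw => h' _; exact: h'.
Qed.

End Walks.

(** * Domains that are not simply connected have holes *)

Section Conn.
Context {R : realType}.
Local Notation C := (Cx R).
Implicit Types (z w l a : C) (x y e d r s t : R) (U : set C).

Lemma D_center z r : 0 < r -> D z r z.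
Proof. by rewrite /D /= subrr mo0. Qed.

(** Local propagation makes the set where [P] holds both open and closed in [U]. *)
Lemma conn_ind U (P : C -> Prop) : open U -> connected U -> (exists2 z, U z & P z) ->
  (forall z, U z -> exists2 r, 0 < r & D z r `<=` U /\ ((exists2 w, D z r w & P w) -> forall w, D z r w -> P w)) ->
  forall z, U z -> P z.
Proof.
move=> oU cU [z0 Uz0 Pz0] loc.
have : U `&` [set z | P z] = U.
  apply: cU; first by exists z0.
  - exists [set z | exists2 r, 0 < r & forall w, D z r w -> U w /\ P w].
      apply/open_cx => z /= [r r0 Hr]; exists (r / 2); first by lra.
      move=> w hw /=; exists (r / 2); first by lra.
      move=> v hv; apply: Hr; move: hw hv; rewrite /D /= => hw hv; have := mo_tri v w z; lra.
    apply/seteqP; split => z /= [Uz].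
      move=> Pz; split => //; have [r r0 [rU rP]] := loc z Uz; exists r => // w hw; split; first exact: rU.
      by apply: rP hw; exists z => //; exact: D_center.
    by case=> r r0 Hr; have [] := Hr z (D_center z r0).
  - exists (closure (U `&` [set z | P z])); first exact: closed_closure.
    apply/seteqP; split => z /= [Uz].
      by move=> Pz; split => //; apply: subset_closure.
    move=> /closure_cx H; split => //; have [r r0 [rU rP]] := loc z Uz.
    have [w [Uw Pw] hw] := H r r0.
    by apply: rP (D_center z r0); exists w.
by move=> E z Uz; have [] : (U `&` [set z | P z]) z by rewrite E.
Qed.

Definition cl01 := @clampR R 0 1.

Lemma cl01_in t : 0 <= cl01 t <= 1.
Proof. exact: clampR_in. Qed.

Lemma cl01_id t : 0 <= t <= 1 -> cl01 t = t.
Proof. exact: clampR_id. Qed.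

Lemma cl01_le0 t : t <= 0 -> cl01 t = 0.
Proof. by move=> t0; rewrite /cl01 /clampR /Num.min; case: ifPn => ?; rewrite /Num.max; case: ifPn => ?; lra. Qed.

Lemma cl01_ge1 t : 1 <= t -> cl01 t = 1.
Proof. by move=> t0; rewrite /cl01 /clampR /Num.min; case: ifPn => ?; rewrite /Num.max; case: ifPn => ?; lra. Qed.

(** The polygonal line through the [g i] as a sum of clamped ramps: continuity in [x], and jointly
    in [x] and moving vertices, needs no gluing. *)
Definition pl (g : nat -> C) (M : nat) x : C := g 0%N + \sum_(i < M) rc (cl01 (x - i%:R)) * (g i.+1 - g i).

Lemma pl_eval g M x j : (j < M)%N -> j%:R <= x <= j.+1%:R ->
  pl g M x = g j + rc (x - j%:R) * (g j.+1 - g j).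
Proof.
rewrite /pl => jM /andP[jx xj]; rewrite -(big_mkord xpredT (fun i => rc (cl01 (x - i%:R)) * (g i.+1 - g i))).
rewrite (@big_cat_nat _ _ _ j) //= ?(ltnW jM) // (@big_ltn _ _ _ j) //.
rewrite [X in _ + (_ + (_ + X))]big_nat_cond [X in _ + (_ + (_ + X))]big1; last first.
  move=> i /andP[/andP[ji iM] _]; rewrite cl01_le0 ?rc0 ?mul0r // subr_le0; apply: (le_trans xj).
  by rewrite ler_nat.
rewrite big_nat_cond (eq_bigr (fun i => g i.+1 - g i)); last first.
  move=> i /andP[/andP[_ ij] _]; rewrite cl01_ge1 ?rc1 ?mul1r // lerBrDr; apply: le_trans jx.
  by rewrite -[1]/(1%:R) -natrD ler_nat add1n.
rewrite -big_nat_cond telescope_sumr // addr0 cl01_id; last by rewrite subr_ge0 jx lerBlDr -natr1 addrC in xj *.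
by rewrite addrA; congr (_ + _); ring.
Qed.

Lemma pl_index M x : (0 < M)%N -> 0 <= x <= M%:R -> exists2 j, (j < M)%N & j%:R <= x <= j.+1%:R.
Proof.
move=> M0 /andP[x0 xM]; have [E|ne] := eqVneq x M%:R.
  by exists M.-1; rewrite ?prednK // E lexx andbT ler_nat leq_pred.
have xM' : x < M%:R by rewrite lt_neqAle ne.
have /andP[h1 h2] := truncn_itv x0; exists (Num.truncn x); last by rewrite h1 ltW.
by rewrite -(ltr_nat R); apply: le_lt_trans h1 xM'.
Qed.

Lemma pl_const g M x z : (forall i, g i = z) -> pl g M x = z.
Proof.
by move=> E; rewrite /pl E big1 ?addr0 // => i _; rewrite !E subrr mulr0.
Qed.

Lemma rc_cl_cont (a b : R) t0 : {for t0, continuous (fun t : R => rc (cl01 (a * t - b)))}.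
Proof.
apply/contRC => e e0; exists (e / (`|a| + 1)); first by rewrite divr_gt0 // ltr_wpDl.
move=> t; rewrite ltr_pdivlMr; last by rewrite ltr_wpDl.
move=> h; rewrite -rcB mo_rc; apply: (le_lt_trans (clampR_lip _ _ _ _)).
rewrite (_ : _ - _ = (t - t0) * a); last by ring.
rewrite normrM; apply: le_lt_trans h; rewrite mulrDr mulr1 lerDl; exact: normr_ge0.
Qed.

Lemma cont_sum (T : topologicalType) M (F : nat -> T -> C) (x0 : T) :
  (forall i, {for x0, continuous (F i)}) -> {for x0, continuous (fun u => \sum_(i < M) F i u)}.
Proof.
move=> cF; elim: M => [|M IH].
  rewrite (_ : (fun u => _) = fun=> 0); first exact: cst_continuous.
  by apply/funext => u; rewrite big_ord0.
rewrite (_ : (fun u => _) = fun u => (\sum_(i < M) F i u) + F M u); last first.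
  by apply/funext => u; rewrite big_ord_recr.
exact: (@continuousD C C T _ (F M) x0 IH (cF M)).
Qed.

Lemma pl_cont g M (a : R) t0 : {for t0, continuous (fun t => pl g M (a * t))}.
Proof.
apply: (@continuousD C C R (fun=> g 0%N) (fun t => \sum_(i < M) rc (cl01 (a * t - i%:R)) * (g i.+1 - g i)) t0).
  exact: cst_continuous.
apply: (@cont_sum R M (fun i t => rc (cl01 (a * t - i%:R)) * (g i.+1 - g i))) => i.
apply: (@continuousM C R (fun t => rc (cl01 (a * t - i%:R))) (fun=> g i.+1 - g i)).
  exact: rc_cl_cont.
exact: cst_continuous.
Qed.

Definition segin U z w := forall t, 0 <= t <= 1 -> U (z + rc t * (w - z)).

Lemma segin_D U z w r : D z r `<=` U -> D z r w -> segin U z w.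
Proof.
move=> DU hw t ht; apply: DU; rewrite /D /=; apply: seg_D => //.
by rewrite subrr mo0; apply: le_lt_trans hw; exact: mo_ge0.
Qed.

Lemma segin_sym U z w : segin U z w -> segin U w z.
Proof.
move=> H t ht; have := H (1 - t); rewrite (_ : z + _ = w + rc t * (z - w)); last by rewrite rcB rc1; ring.
by apply; lra.
Qed.

Lemma pl_in U g M x : (0 < M)%N -> (forall j, (j < M)%N -> segin U (g j) (g j.+1)) -> 0 <= x <= M%:R -> U (pl g M x).
Proof.
move=> M0 H hx; have [j jM hj] := pl_index M0 hx.
rewrite (pl_eval g jM hj); apply: H => //; move: hj; rewrite -natr1; lra.
Qed.

Lemma connected_path U : open U -> connected U -> Defs.path_connected U.
Proof.
move=> oU cU x y Ux Uy.
have : exists M (g : nat -> C), [/\ (0 < M)%N, g 0%N = x, g M = y & forall j, (j < M)%N -> segin U (g j) (g j.+1)].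
  move: y Uy; apply: conn_ind => //.
    exists x => //; exists 1%N, (fun=> x); split => // j _ t _; by rewrite subrr mulr0 addr0.
  move=> z Uz; have [r r0 rU] := iffLR (open_cx U) oU z Uz; exists r => //; split => //.
  move=> [w hw [M [g [M0 g0 gM gs]]]] v hv.
  exists M.+2, (fun j => if (j <= M)%N then g j else if j == M.+1 then z else v).
  split=> [//|||j]; first by rewrite leq0n.
    by rewrite ifF ?ifF //; lia.
  rewrite ltnS leq_eqVlt => /orP[/eqP ->|jM].
    rewrite ifF ?eqxx ?ifF ?ifF; try lia; exact: segin_D rU hv.
  have jM' : (j <= M)%N by lia.
  rewrite jM'; case: ltnP => h; first exact: gs.
  have -> : j = M by lia.
  by rewrite eqxx gM; apply: segin_sym; exact: segin_D rU hw.
move=> [M [g [M0 g0 gM gs]]].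
exists (fun t => pl g M (M%:R * t)); split.
- split; first by apply: continuous_subspaceT => t; exact: pl_cont.
  move=> t; rewrite in_itv /= => /andP[t0 t1]; apply: pl_in => //.
  by rewrite mulr_ge0 //= -[X in _ <= X]mulr1 ler_wpM2l.
- by rewrite mulr0 (@pl_eval g M 0 0%N) ?lexx //= ?ler01 // subrr rc0 mul0r addr0.
- rewrite mulr1 (@pl_eval g M _ M.-1) ?prednK //.
    have -> : M%:R - M.-1%:R = 1 :> R by rewrite -{1}(prednK M0) -natr1 addrC addKr.
    by rewrite rc1 mul1r addrC subrK.
  by rewrite lexx ler_nat leq_pred.
Qed.

(** For each [t] the points of consecutive loops are joined by segments: [pl] is used in the
    deformation parameter. *)
Lemma chain_null U (ga : nat -> R -> C) M (c : R -> C) : (0 < M)%N ->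
  (forall j, continuous (ga j)) -> (forall j, ga j 0 = c 0) -> (forall j, ga j 1 = c 0) ->
  (forall j t, (j < M)%N -> 0 <= t <= 1 -> segin U (ga j t) (ga j.+1 t)) ->
  (forall t, 0 <= t <= 1 -> ga 0%N t = c t) -> (forall t, 0 <= t <= 1 -> ga M t = c 0) ->
  null_homotopic U c.
Proof.
move=> M0 cga g0 g1 gs gc gM.
exists (fun p => pl (fun j => ga j p.2) M (M%:R * p.1)); split.
- apply: continuous_subspaceT => p.
  have cg i : {for p, continuous (fun q : R * R => ga i q.2)}.
    by apply: (@continuous_comp _ _ _ snd (ga i)); [exact: cvg_snd|exact: cga].
  apply: (@continuousD C C (R * R)%type (fun q => ga 0%N q.2) (fun q => \sum_(i < M) rc (cl01 (M%:R * q.1 - i%:R)) * (ga i.+1 q.2 - ga i q.2)) p).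
    exact: cg.
  apply: (@cont_sum (R * R)%type M (fun i q => rc (cl01 (M%:R * q.1 - i%:R)) * (ga i.+1 q.2 - ga i q.2))) => i.
  apply: (@continuousM C (R * R)%type (fun q => rc (cl01 (M%:R * q.1 - i%:R))) (fun q => ga i.+1 q.2 - ga i q.2)).
    by apply: (@continuous_comp _ _ _ fst (fun s => rc (cl01 (M%:R * s - i%:R)))); [exact: cvg_fst|exact: rc_cl_cont].
  exact: (@continuousB C C (R * R)%type (fun q => ga i.+1 q.2) (fun q => ga i q.2)).
- move=> s t; rewrite !in_itv /= => /andP[s0 s1] /andP[t0 t1]; apply: pl_in => //.
    by move=> j jM; apply: gs => //; rewrite t0.
  by rewrite mulr_ge0 //= -[X in _ <= X]mulr1 ler_wpM2l.
- move=> t; rewrite in_itv /= => ht; split.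
    by rewrite mulr0 (@pl_eval _ M 0 0%N) ?lexx //= ?ler01 // subrr rc0 mul0r addr0 gc.
  rewrite mulr1 (@pl_eval _ M _ M.-1) ?prednK //; last by rewrite lexx ler_nat leq_pred.
  have -> : M%:R - M.-1%:R = 1 :> R by rewrite -{1}(prednK M0) -natr1 addrC addKr.
  by rewrite rc1 mul1r addrC subrK gM.
- move=> s _; split; apply: pl_const => i; [exact: g0|exact: g1].
Qed.

End Conn.

Section Tube.
Context {R : realType}.
Local Notation C := (Cx R).
Implicit Types (z w : C) (e r s t : R) (U : set C).

Lemma seq_cluster (t : nat -> R) : (forall n, 0 <= t n <= 1) ->
  exists2 ts : R, 0 <= ts <= 1 & forall e N, 0 < e -> exists2 n, (N <= n)%N & `|t n - ts| < e.
Proof.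
move=> t01; have [W [UW fW]] := free_ultra.
have [|l ul] := @ulim_ex R W (fun n => rc (t n)) 1 UW.
  by apply: filterE => n /=; have /andP[h1 h2] := t01 n; rewrite mo_rc ger0_norm.
have near e N : 0 < e -> exists2 n, (N <= n)%N & `|t n - re l| < e.
  move=> e0; have [n [/= n1 n2]] := @filter_ex _ _ ultra_proper _ (filterI (ul e e0) (free_ge N fW)).
  by exists n => //; apply: le_lt_trans n1; rewrite -[t n]re_rc -reB re_le.
exists (re l) => //; apply/andP; split; apply/ler_addgt0Pl => e e0;
  have [n _] := near e 0%N e0; have /andP[h1 h2] := t01 n; rewrite ltr_norml => /andP[h3 h4]; lra.
Qed.

Variable c : R -> C.
Hypothesis cc : continuous c.

Lemma path_tube U : open U -> (forall t, 0 <= t <= 1 -> U (c t)) ->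
  exists2 d : R, 0 < d & forall t : R, 0 <= t <= 1 -> D (c t) d `<=` U.
Proof.
move=> /open_cx oU cU; apply: contrapT => no.
have ex (n : nat) : {t : R | 0 <= t <= 1 /\ exists2 w, modulus (w - c t) < (n.+1%:R)^-1 & ~ U w}.
  apply/cid; apply: contrapT => H; apply: no; exists (n.+1%:R)^-1; first by rewrite invr_gt0.
  move=> t ht w hw; apply: contrapT => nU; apply: H; exists t; split => //; by exists w.
have [ts hts near] := seq_cluster (fun n => (svalP (ex n)).1).
have [d d0 Hd] := oU _ (cU ts hts).
have [|e e0 He] := iffLR (contRC c ts) (@cc ts) (d / 2); first by lra.
have [|N HN] := @inv_small R (d / 2); first by lra.
have [n nN /He h] := near e N e0.
have [_ [w hw nUw]] := svalP (ex n).
apply: nUw; apply: Hd; rewrite /D /=.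
have := mo_tri w (c (sval (ex n))) (c ts); have := lt_trans hw (HN n nN); move: h; clear -d0; lra.
Qed.

Lemma unif_cont e : 0 < e -> exists2 n, (0 < n)%N & forall s t, 0 <= s <= 1 -> 0 <= t <= 1 ->
  `|s - t| <= n%:R^-1 -> modulus (c s - c t) < e.
Proof.
move=> e0; apply: contrapT => no.
have ex (n : nat) : {st : R * R | 0 <= st.1 <= 1 /\ [/\ 0 <= st.2 <= 1, `|st.1 - st.2| <= n.+1%:R^-1 & e <= modulus (c st.1 - c st.2)]}.
  apply/cid; apply: contrapT => H; apply: no; exists n.+1 => // s t hs ht st.
  rewrite ltNge; apply/negP => h; apply: H; by exists (s, t).
have [ts hts near] := seq_cluster (fun n => (svalP (ex n)).1).
have [|d d0 Hd] := iffLR (contRC c ts) (@cc ts) (e / 2); first by lra.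
have [|N HN] := @inv_small R (d / 2); first by lra.
have d2 : 0 < d / 2 by lra.
have [n nN h] := near (d / 2) N d2.
have [_ [h1 h2 h3]] := svalP (ex n); have h4 := HN n nN.
have k1 := Hd (sval (ex n)).1; have k2 := Hd (sval (ex n)).2.
have h' : `|(sval (ex n)).1 - ts| < d by apply: lt_trans h _; clear -d0; lra.
have {}k1 := k1 h'.
have {h4}h2 := le_lt_trans h2 h4.
have {}k2 : modulus (c (sval (ex n)).2 - c ts) < e / 2.
  apply: k2; rewrite (_ : _ - ts = ((sval (ex n)).1 - ts) - ((sval (ex n)).1 - (sval (ex n)).2)); last by ring.
  by apply: (le_lt_trans (ler_normB _ _)); move: h h2; clear; lra.
have := mo_tri (c (sval (ex n)).1) (c ts) (c (sval (ex n)).2).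
rewrite (mo_sym (c ts)); move: k1 k2 h3; clear; lra.
Qed.

End Tube.

(** * Hexagonal covers of the plane *)

Section Lattice.
Context {R : realType}.
Local Notation C := (Cx R).
Implicit Types (z w : C) (e r s t x y : R) (U : set C) (u v : vtx).
Variables (o : C) (ep : R).
Hypothesis ep0 : 0 < ep.

Let cx z u : R := re (z - o) / ep - u.1%:~R.
Let cy z u : R := im (z - o) / ep - u.2%:~R.

(* Overlapping hexagons centred at the lattice points [lat u]: already those of radius [2 / 3] cover the plane. *)
Definition hexle (r : R) u : set C := [set z | [&& `|cx z u| <= r, `|cy z u| <= r & `|cx z u + cy z u| <= r]].
Definition hexlt u : set C := [set z | [&& `|cx z u| < 1, `|cy z u| < 1 & `|cx z u + cy z u| < 1]].
Definition lat u : C := o + rc ep * pt u.1%:~R u.2%:~R.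

Lemma cx_lat u v : cx (lat v) u = v.1%:~R - u.1%:~R.
Proof.
rewrite /cx /lat (_ : o + _ - o = rc ep * pt v.1%:~R v.2%:~R); last by ring.
by rewrite reM re_pt im_pt re_rc im_rc mul0r subr0 mulrC mulKf // gt_eqF.
Qed.

Lemma cy_lat u v : cy (lat v) u = v.2%:~R - u.2%:~R.
Proof.
rewrite /cy /lat (_ : o + _ - o = rc ep * pt v.1%:~R v.2%:~R); last by ring.
by rewrite imM re_pt im_pt re_rc im_rc mul0r addr0 mulrC mulKf // gt_eqF.
Qed.

Lemma cx_diff z w u : cx z u - cx w u = re (z - w) / ep.
Proof. by rewrite /cx (_ : z - w = (z - o) - (w - o)) ?reB ?mulrBl; ring. Qed.
Lemma cy_diff z w u : cy z u - cy w u = im (z - w) / ep.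
Proof. by rewrite /cy (_ : z - w = (z - o) - (w - o)) ?imB ?mulrBl; ring. Qed.

(** One of the four corners of the unit cell of [z] serves, according to the fractional parts [s]
    and [t]. *)
Lemma hex_cover z : exists u, hexle (2 / 3) u z.
Proof.
pose X := re (z - o) / ep; pose Y := im (z - o) / ep.
have /andP[a1 a2] := real_floor_itv (num_real X); have /andP[b1 b2] := real_floor_itv (num_real Y).
move: a1 a2 b1 b2; rewrite !intrD !mulr1z; set a := Num.floor X; set b := Num.floor Y => a1 a2 b1 b2.
have key u : `|X - u.1%:~R| <= 2 / 3 -> `|Y - u.2%:~R| <= 2 / 3 -> `|(X - u.1%:~R) + (Y - u.2%:~R)| <= 2 / 3 -> exists u, hexle (2 / 3) u z.
  by move=> h1 h2 h3; exists u; rewrite /hexle /= /cx /cy -/X -/Y h1 h2 h3.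
move: a1 a2 b1 b2 key; clear.
move=> a1 a2 b1 b2 key.
pose s := X - a%:~R; pose t := Y - b%:~R.
have s0 : 0 <= s by rewrite /s; lra.
have s1 : s < 1 by rewrite /s; lra.
have t0 : 0 <= t by rewrite /t; lra.
have t1 : t < 1 by rewrite /t; lra.
have E1 : X - (a + 1)%:~R = s - 1 by rewrite /s intrD mulr1z; ring.
have E2 : Y - (b + 1)%:~R = t - 1 by rewrite /t intrD mulr1z; ring.
clearbody s t.
have [h1|h1] := leP (s + t) (2 / 3).
  by apply: (key (a, b)); rewrite /= ler_norml; lra.
have [h2|h2] := leP (4 / 3) (s + t).
  by apply: (key (a + 1, b + 1)); rewrite /= ?E1 ?E2 ler_norml; lra.
have [h3|h3] := leP (1 / 3) s; have [h4|h4] := leP t (2 / 3).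
- by apply: (key (a + 1, b)); rewrite /= ?E1 ?E2 ler_norml; lra.
- by apply: (key (a, b + 1)); rewrite /= ?E1 ?E2 ler_norml; lra.
- by apply: (key (a, b + 1)); rewrite /= ?E1 ?E2 ler_norml; lra.
- by apply: (key (a, b + 1)); rewrite /= ?E1 ?E2 ler_norml; lra.
Qed.

(** Each coordinate moves by at most a third of the slack, hence their sum by two thirds. *)
Lemma hexle_move z w u r : r < 1 -> modulus (w - z) <= ep * ((1 - r) / 3) -> hexle r u z -> hexlt u w.
Proof.
move=> r1 h; rewrite /hexle /hexlt /=.
have dx := cx_diff w z u; have dy := cy_diff w z u.
have : `|re (w - z) / ep| <= (1 - r) / 3.
  rewrite normrM [`|ep^-1|]gtr0_norm ?invr_gt0 // ler_pdivrMr // mulrC; exact: le_trans (re_le _) h.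
have : `|im (w - z) / ep| <= (1 - r) / 3.
  rewrite normrM [`|ep^-1|]gtr0_norm ?invr_gt0 // ler_pdivrMr // mulrC; exact: le_trans (im_le _) h.
rewrite -dx -dy; move: r1; clear.
set A := cx w u; set A' := cx z u; set B := cy w u; set B' := cy z u.
rewrite !ler_norml !ltr_norml => r1 /andP[? ?] /andP[? ?] /and3P[/andP[? ?] /andP[? ?] /andP[? ?]].
by apply/and3P; split; apply/andP; split; lra.
Qed.

Lemma hexlt_le u : hexlt u `<=` hexle 1 u.
Proof. by move=> z /and3P[h1 h2 h3]; apply/and3P; split; exact: ltW. Qed.

Lemma hexle_lt u r : r < 1 -> hexle r u `<=` hexlt u.
Proof. by move=> r1 z /and3P[h1 h2 h3]; apply/and3P; split; apply: le_lt_trans r1. Qed.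

Lemma hexlt_open u : open (hexlt u).
Proof.
apply/open_cx => z hz.
pose r := Num.max (Num.max `|cx z u| `|cy z u|) `|cx z u + cy z u|.
have r1 : r < 1 by rewrite /r !gt_max; move: hz => /and3P[-> -> ->].
have hr : hexle r u z by rewrite /hexle /= /r !le_max !lexx ?orbT.
exists (ep * ((1 - r) / 3)); first by rewrite mulr_gt0 // divr_gt0 ?subr_gt0.
by move=> w hw; apply: (hexle_move r1 _ hr); exact: ltW.
Qed.

Lemma hexlt_adj u v z : hexlt u z -> hexlt v z -> adj u v.
Proof.
rewrite /hexlt /= /cx /cy; set X := re _ / ep; set Y := im _ / ep => /and3P[h1 h2 h3] /and3P[k1 k2 k3].
have key (m : int) : `|m%:~R : R| < 2 -> (-1 <= m <= 1)%R.
  rewrite ltr_norml => /andP[]; rewrite (_ : - 2 = (-2)%:~R) // ltr_int => a1.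
  rewrite (_ : 2 = 2%:~R) // ltr_int => a2; lia.
move: h1 h2 h3 k1 k2 k3; rewrite !ltr_norml => /andP[? ?] /andP[? ?] /andP[? ?] /andP[? ?] /andP[? ?] /andP[? ?].
have /andP[E1 E2] : -1 <= u.1 - v.1 <= 1 by apply: key; rewrite intrB ltr_norml; apply/andP; split; lra.
have /andP[E3 E4] : -1 <= u.2 - v.2 <= 1 by apply: key; rewrite intrB ltr_norml; apply/andP; split; lra.
have /andP[E5 E6] : -1 <= (u.1 - v.1) + (u.2 - v.2) <= 1.
  by apply: key; rewrite intrD !intrB ltr_norml; apply/andP; split; lra.
by rewrite /adj E1 E2 E3 E4 E5 E6.
Qed.

Lemma adj_hexle u v : adj u v -> hexle 1 u (lat v).
Proof.
rewrite /adj => /and5P[h1 h2 h3 h4 /andP[h5 h6]]; rewrite /hexle /= !cx_lat !cy_lat.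
rewrite -!intrB -intrD.
have key (m : int) : -1 <= m -> m <= 1 -> `|m%:~R : R| <= 1.
  by move=> a b; rewrite ler_norml (_ : -1 = (-1)%:~R) // !ler_int (_ : 1 = 1%:~R) // ler_int a b.
by apply/and3P; split; apply: key; move: h1 h2 h3 h4 h5 h6; clear; lia.
Qed.

Lemma hexle_conv u z w : hexle 1 u z -> hexle 1 u w -> segin (hexle 1 u) z w.
Proof.
move=> hz hw t /andP[t0 t1].
have E1 : cx (z + rc t * (w - z)) u = (1 - t) * cx z u + t * cx w u.
  have := cx_diff (z + rc t * (w - z)) z u; rewrite (_ : z + _ - z = rc t * (w - z)); last by ring.
  rewrite reM re_rc im_rc mul0r subr0 -mulrA -(cx_diff _ _ u) => H.
  by rewrite -(subrK (cx z u) (cx _ u)) H; ring.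
have E2 : cy (z + rc t * (w - z)) u = (1 - t) * cy z u + t * cy w u.
  have := cy_diff (z + rc t * (w - z)) z u; rewrite (_ : z + _ - z = rc t * (w - z)); last by ring.
  rewrite imM re_rc im_rc mul0r addr0 -mulrA -(cy_diff _ _ u) => H.
  by rewrite -(subrK (cy z u) (cy _ u)) H; ring.
move: hz hw; rewrite /hexle /= E1 E2 => /and3P[h1 h2 h3] /and3P[k1 k2 k3].
have key (a b : R) : `|a| <= 1 -> `|b| <= 1 -> `|(1 - t) * a + t * b| <= 1.
  move=> a1 b1; apply: (le_trans (ler_normD _ _)); rewrite !normrM (ger0_norm t0) ger0_norm ?subr_ge0 //.
  have : (1 - t) * `|a| <= (1 - t) * 1 by rewrite ler_wpM2l ?subr_ge0.
  have : t * `|b| <= t * 1 by rewrite ler_wpM2l.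
  lra.
rewrite !key //=.
have -> : (1 - t) * cx z u + t * cx w u + ((1 - t) * cy z u + t * cy w u) =
  (1 - t) * (cx z u + cy z u) + t * (cx w u + cy w u) by ring.
exact: key.
Qed.

Lemma hexle_diam u z w : hexle 1 u z -> hexle 1 u w -> modulus (z - w) <= 4 * ep.
Proof.
move=> /and3P[h1 h2 _] /and3P[k1 k2 _]; apply: (le_trans (mo_le _)).
have key (a : R) : `|a / ep| <= 2 -> `|a| <= 2 * ep.
  by rewrite normrM [`|ep^-1|]gtr0_norm ?invr_gt0 // ler_pdivrMr.
have := key (re (z - w)); rewrite -(cx_diff z w u) => /(_ (le_trans (ler_normB _ _) _)) e1.
have := key (im (z - w)); rewrite -(cy_diff z w u) => /(_ (le_trans (ler_normB _ _) _)) e2.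
have {}e1 := e1 ltac:(lra); have {}e2 := e2 ltac:(lra); lra.
Qed.

Lemma hexle_lat u : hexle 1 u (lat u).
Proof. by apply: adj_hexle; exact: adj_refl. Qed.

Lemma hexle_closure u z : hexle 1 u z -> closure (hexlt u) z.
Proof.
move=> hz; apply/closure_cx => e e0.
have h0 : hexle 0 u (lat u) by rewrite /hexle /= !cx_lat !cy_lat !subrr addr0 normr0 lexx.
pose t := Num.min (1 / 2) (e / (8 * ep)).
have t0 : 0 < t by rewrite /t lt_min divr_gt0 // ?divr_gt0 ?mulr_gt0.
have t1 : t <= 1 / 2 by rewrite /t ge_min lexx.
have t2 : t * (8 * ep) <= e by rewrite -ler_pdivlMr ?mulr_gt0 // /t ge_min lexx orbT.
clearbody t.
exists (z + rc t * (lat u - z)).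
  have E1 : cx (z + rc t * (lat u - z)) u = (1 - t) * cx z u.
    have := cx_diff (z + rc t * (lat u - z)) z u; rewrite (_ : z + _ - z = rc t * (lat u - z)); last by ring.
    rewrite reM re_rc im_rc mul0r subr0 -mulrA -(cx_diff _ _ u) cx_lat subrr => H.
    by rewrite -(subrK (cx z u) (cx _ u)) H; ring.
  have E2 : cy (z + rc t * (lat u - z)) u = (1 - t) * cy z u.
    have := cy_diff (z + rc t * (lat u - z)) z u; rewrite (_ : z + _ - z = rc t * (lat u - z)); last by ring.
    rewrite imM re_rc im_rc mul0r addr0 -mulrA -(cy_diff _ _ u) cy_lat subrr => H.
    by rewrite -(subrK (cy z u) (cy _ u)) H; ring.
  have key (a : R) : `|a| <= 1 -> `|(1 - t) * a| < 1.
    move=> a1; rewrite normrM ger0_norm; last by lra.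
    apply: (@le_lt_trans _ _ ((1 - t) * 1)); last by lra.
    by rewrite ler_wpM2l //; lra.
  by move: hz => /and3P[h1 h2 h3]; rewrite /hexlt /= E1 E2 -mulrDr !key.
rewrite (_ : _ - z = rc t * (lat u - z)); last by ring.
rewrite moM mo_rc gtr0_norm //.
have := hexle_diam (hexle_lat u) hz => h.
have : t * modulus (lat u - z) <= t * (4 * ep) by rewrite ler_pM2l.
lra.
Qed.

Variable U : set C.
(** The negation of what [hole_exists] asserts, where it is assumed for contradiction. *)
Hypothesis fill : forall Om : set C, open Om -> bdd Om -> (forall z, closure Om z -> ~ Om z -> U z) -> Om `<=` U.

Let good u : Prop := hexle 1 u `<=` U.

(** Otherwise the open hexagons of the bad vertices in [P] form a bounded open set. A hexagon around
    one of its boundary points is good, since a bad one would be adjacent to the class and so belong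
    to it; thus the boundary lies in [U], and [fill] makes the hexagon of [x] good. *)
Lemma bad_escape (x : vtx) (P : vtx -> Prop) (N : int) : ~ good x -> P x ->
  (forall u v, ~ good u -> ~ good v -> adj u v -> P u -> P v) ->
  exists2 y, P y & ~ [&& -N <= y.1, y.1 <= N, -N <= y.2 & y.2 <= N].
Proof.
move=> bx Px cP; apply: contrapT => no.
have inb (y : vtx) : P y -> [&& -N <= y.1, y.1 <= N, -N <= y.2 & y.2 <= N].
  by move=> Py; apply: contrapT => h; apply: no; exists y.
pose Om := [set z | exists2 v, ~ good v /\ P v & hexlt v z].
have oOm : open Om.
  apply/open_cx => z [v bv hv]; have [e e0 He] := iffLR (open_cx _) (@hexlt_open v) z hv.
  by exists e => // w /He hw; exists v.
have bOm : bdd Om.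
  exists (modulus o + ep * (2 * `|N|%:~R) + 4 * ep) => z [v [_ /inb /and4P[n1 n2 n3 n4]] /hexlt_le hv].
  have h1 := hexle_diam hv (hexle_lat v).
  have h2 : modulus (lat v) <= modulus o + ep * (2 * `|N|%:~R).
    apply: (le_trans (moD _ _)); rewrite lerD2l moM mo_rc gtr0_norm // ler_pM2l //.
    apply: (le_trans (mo_le _)); rewrite re_pt im_pt.
    have k1 : `|v.1%:~R : R| <= `|N|%:~R by rewrite -intr_norm ler_int; lia.
    have k2 : `|v.2%:~R : R| <= `|N|%:~R by rewrite -intr_norm ler_int; lia.
    lra.
  have := mo_subr z (lat v); lra.
have fr z : closure Om z -> ~ Om z -> U z.
  move=> cz nz; have [u /hexle_lt hu] := hex_cover z.
  have {}hu : hexlt u z by apply: hu; lra.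
  have [e e0 He] := iffLR (open_cx _) (@hexlt_open u) z hu.
  have [w [v [bv Pv] hv] hw] := iffLR (closure_cx _ _) cz e e0.
  have auv : adj v u by apply: (hexlt_adj hv); exact: He.
  have [gu|bu] := pselect (good u); first by apply: gu; exact: hexlt_le.
  by exfalso; apply: nz; exists u => //; split => //; exact: (cP v u).
have OmU := fill oOm bOm fr.
apply: (bx) => z hz; have cz : closure Om z.
  move: (hexle_closure hz); apply: closure_subset => w hw; exists x; [by split|exact: hw].
have [Oz|nOz] := pselect (Om z); [exact: OmU|exact: fr].
Qed.

End Lattice.

Lemma htp_chain A n w w' : htp A n w w' -> exists m (W : nat -> nat -> vtx),
  [/\ W 0%N = w, forall i, (i <= n)%N -> W m i = w' i & forall j, (j < m)%N -> step A n (W j) (W j.+1)].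
Proof.
elim=> [{}w {}w' E|{}w w1 w2 S _ [m [W [W0 Wm Ws]]]].
  by exists 0%N, (fun=> w).
exists m.+1, (fun j => if j is k.+1 then W k else w); split => //.
by move=> [_|j hj]; [rewrite W0|exact: Ws].
Qed.

Definition box (N : nat) : seq vtx :=
  [seq ((i%:Z - N%:Z, j%:Z - N%:Z) : vtx) | i <- iota 0 (2 * N + 1), j <- iota 0 (2 * N + 1)].

Lemma mem_box N (u : vtx) : (u \in box N) = [&& - N%:Z <= u.1, u.1 <= N%:Z, - N%:Z <= u.2 & u.2 <= N%:Z].
Proof.
apply/allpairsP/idP => [[[i j] [/= hi hj ->]]|].
  by move: hi hj; rewrite !mem_iota /=; lia.
move=> /and4P[h1 h2 h3 h4]; exists (absz (u.1 + N%:Z), absz (u.2 + N%:Z)); split; rewrite ?mem_iota /=; [lia|lia|].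
by case: u h1 h2 h3 h4 => a b /= *; congr pair; lia.
Qed.

Section Hole.
Context {R : realType}.
Local Notation C := (Cx R).
Implicit Types (z w : C) (e r s t : R) (U Om : set C).

Lemma path_clamp_cont U (c : R -> C) : path_in U c -> continuous (fun t => c (cl01 t)).
Proof.
move=> [/subspace_continuousP cc _] t; apply/contRC => e e0.
have ht : `[0, 1]%classic (cl01 t) by rewrite /= in_itv /=; exact: cl01_in.
have := cc _ ht (D (c (cl01 t)) e); case.
  by apply/nbhs_cx; exists e.
move=> d /= d0 Hd; exists d => // y hy; apply: Hd => /=; last by rewrite in_itv /=; exact: cl01_in.
rewrite /ball /= distrC; exact: le_lt_trans (clampR_lip _ _ _ _) hy.
Qed.

(** Without a hole the good hexagons of a large box form a set to which [esc_contractible] applies.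
    The loop follows a walk in it, and the combinatorial contraction is realised by polygons. *)
Lemma hole_exists U (c : R -> C) : open U -> path_in U c -> c 0 = c 1 -> ~ null_homotopic U c ->
  exists Om, [/\ open Om, bdd Om, (forall z, closure Om z -> ~ Om z -> U z) & ~ Om `<=` U].
Proof.
move=> oU pc c01 nn; apply: contrapT => no; apply: nn.
have fill Om : open Om -> bdd Om -> (forall z, closure Om z -> ~ Om z -> U z) -> Om `<=` U.
  by move=> h1 h2 h3; apply: contrapT => h4; apply: no; exists Om.
pose ct t := c (cl01 t).
have cct : continuous ct by exact: path_clamp_cont pc.
have Uct t : U (ct t) by apply: pc.2; rewrite in_itv /=; exact: cl01_in.
have [de de0 Hde] := path_tube cct oU (fun t _ => Uct t).
(* Hexagons have diameter at most [4 * ep], half the radius [de] of the tube around the loop. *)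
pose ep := de / 8.
have ep0 : 0 < ep by rewrite /ep divr_gt0.
(* The room between the hexagons of radii [2 / 3] and 1, which the loop must not exceed between two
   sample points. *)
have ep9 : 0 < ep * ((1 - 2 / 3) / 3) by rewrite mulr_gt0 //; lra.
have [n n0 Hn] := unif_cont cct ep9.
have n0' : 0 < n%:R :> R by rewrite ltr0n.
set o := c 0.
have o_lat : lat o ep (0, 0) = o by rewrite /lat /pt /= rc0 mulr0 addr0 mulr0 addr0.
have exu i : {u : vtx | hexle o ep (2 / 3) u (ct (i%:R / n%:R))} by apply/cid; exact: hex_cover.
(* The ends are put at [(0, 0)], whose lattice point is [c 0] itself, so that the walk closes up. *)
pose wv i : vtx := if (i == 0%N) || (i == n) then (0, 0) else sval (exu i).
have hw i : (i <= n)%N -> hexle o ep (2 / 3) (wv i) (ct (i%:R / n%:R)).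
  move=> hi; rewrite /wv; case: ifPn => [h|_]; last exact: (svalP (exu i)).
  have -> : ct (i%:R / n%:R) = o.
    case/orP: h => /eqP ->; first by rewrite mul0r /ct cl01_le0.
    by rewrite divff ?gt_eqF // /ct cl01_ge1.
  by rewrite /hexle /= subrr re0 im0 mul0r subr0 addr0 normr0; apply/and3P; split; lra.
have l23 : 2 / 3 < 1 :> R by lra.
have hwt i t : (i < n)%N -> i%:R <= n%:R * t <= i.+1%:R -> hexlt o ep (wv i) (ct t).
  move=> hi /andP[h1 h2].
  apply: (hexle_move ep0 l23 _ (hw i (ltnW hi))); apply/ltW/Hn.
  - have t0 : 0 <= n%:R * t by apply: le_trans h1.
    have t1 : n%:R * t <= n%:R * 1 by rewrite mulr1; apply: (le_trans h2); rewrite ler_nat.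
    by move: t0 t1; rewrite pmulr_rge0 // ler_pM2l // => -> ->.
  - rewrite divr_ge0 //= ler_pdivrMr // mul1r ler_nat; exact: ltnW.
  - rewrite ger0_norm ?subr_ge0 ?ler_pdivrMr //; last by rewrite mulrC.
    rewrite -(ler_pM2l n0') divff ?gt_eqF // mulrBr mulrC mulrCA divff ?gt_eqF // mulr1 mulrC.
    by rewrite lerBlDl natr1.
have good i : (i <= n)%N -> hexle o ep 1 (wv i) `<=` U.
  move=> hi z hz; apply: (Hde (i%:R / n%:R)).
    by rewrite divr_ge0 //= ler_pdivrMr // mul1r ler_nat.
  rewrite /D /=; apply: (le_lt_trans (hexle_diam ep0 hz _)).
    by apply: hexlt_le; apply: (hexle_lt l23); exact: hw.
  by rewrite /ep; clear -de0; lra.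
have wadj i : (i < n)%N -> adj (wv i) (wv i.+1).
  move=> hi; apply: (@hexlt_adj R o ep ep0 _ _ (ct (i.+1%:R / n%:R))); last by apply: (hexle_lt l23); exact: hw.
  apply: hwt => //; rewrite mulrC divfK ?gt_eqF // lexx andbT ler_nat; exact: leqnSn.
have [N HN] : exists N : nat, forall i, (i <= n)%N -> wv i \in box N.
  exists (\sum_(i < n.+1) (`|(wv i).1| + `|(wv i).2|))%N => i hi.
  have h : (`|(wv i).1| + `|(wv i).2| <= \sum_(i < n.+1) (`|(wv i).1| + `|(wv i).2|))%N.
    have hi' : (i < n.+1)%N by [].
    by rewrite (bigD1 (Ordinal hi')) //= leq_addr.
  rewrite mem_box; move: h; set S := (\sum_(i < n.+1) _)%N; clearbody S; case: (wv i) => a b /=; clear; lia.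
pose A := [seq u <- box N | `[< hexle o ep 1 u `<=` U >]].
have outA y : y \notin box N -> out A y.
  rewrite mem_box => h.
  have inA u : u \in A -> [&& - N%:Z <= u.1, u.1 <= N%:Z, - N%:Z <= u.2 & u.2 <= N%:Z].
    by rewrite mem_filter mem_box => /andP[].
  have [h1|h1] := ltP y.1 (- N%:Z).
    by constructor 2 => u /inA/and4P[k _ _ _]; exact: lt_le_trans h1 k.
  have [h2|h2] := ltP N%:Z y.1.
    by constructor 1 => u /inA/and4P[_ k _ _]; exact: le_lt_trans k h2.
  have [h3|h3] := ltP y.2 (- N%:Z).
    by constructor 4 => u /inA/and4P[_ _ k _]; exact: lt_le_trans h3 k.
  have h4 : N%:Z < y.2 by rewrite ltNge; apply/negP => h4; rewrite h1 h2 h3 h4 in h.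
  by constructor 3 => u /inA/and4P[_ _ _ k]; exact: le_lt_trans k h4.
have eA : esc A.
  move=> x P xA Px cP; have [xb|xb] := boolP (x \in box N); last by exists x => //; exact: outA.
  have bx : ~ hexle o ep 1 x `<=` U.
    by move=> h; move: xA; rewrite mem_filter xb andbT => /negP; apply; apply/asboolP.
  have sub u : ~ hexle o ep 1 u `<=` U -> u \notin A.
    by move=> h; rewrite mem_filter negb_and; apply/orP; left; apply/negP => /asboolP.
  have [|y Py nb] := bad_escape ep0 fill N%:Z bx Px.
    by move=> u v /sub hu /sub hv; exact: cP.
  by exists y => //; apply: outA; rewrite mem_box; apply/negP.
have vw : valid A n wv.
  by split => // i hi; rewrite mem_filter HN // andbT; apply/asboolP; exact: good.
have w0 : wv 0%N = (0, 0) by rewrite /wv eqxx.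
have wn : wv n = (0, 0) by rewrite /wv eqxx orbT.
have /htp_chain[m [W [W0 Wm Ws]]] := esc_contractible eA vw (etrans wn (esym w0)).
have We j : (j <= m)%N -> W j 0%N = (0, 0) /\ W j n = (0, 0).
  elim: j => [|j IH] hj; first by rewrite W0.
  have [_ _ -> -> _] := Ws j hj; apply: IH; exact: ltnW.
have Wg j i : (j <= m)%N -> (i <= n)%N -> hexle o ep 1 (W j i) `<=` U.
  move=> hj hi; have [/(_ i hi) h _] : valid A n (W j).
    by case: j hj => [|j] hj; [rewrite W0|have [] := Ws j hj].
  by move: h; rewrite mem_filter => /andP[/asboolP].
(* Stage 0 is the loop itself, later stages are the polygons of the walks; [minn] repeats the last
   one. *)
pose ga j t : C := if j is k.+1 then pl (fun i => lat o ep (W (minn k m) i)) n (n%:R * t) else ct t.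
have pl0 j : pl (fun i => lat o ep (W (minn j m) i)) n (n%:R * 0) = o.
  rewrite mulr0 (@pl_eval _ _ n 0 0%N) ?lexx //= ?ler01 // subrr rc0 mul0r addr0.
  by have [-> _] := We _ (geq_minr j m).
have pl1 j : pl (fun i => lat o ep (W (minn j m) i)) n (n%:R * 1) = o.
  rewrite mulr1 (@pl_eval _ _ n _ n.-1) ?prednK //; last by rewrite lexx ler_nat leq_pred.
  have -> : n%:R - n.-1%:R = 1 :> R by rewrite -{1}(prednK n0) -natr1 addrC addKr.
  by rewrite rc1 mul1r addrC subrK; have [_ ->] := We _ (geq_minr j m).
have gac j : continuous (ga j) by case: j => [|j]; [exact: cct|move=> t; exact: pl_cont].
apply: (@chain_null _ U ga m.+1 c (ltn0Sn m) gac).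
- by case=> [|j] /=; [rewrite /ct cl01_le0|exact: pl0].
- by case=> [|j] /=; [rewrite /ct cl01_ge1|exact: pl1].
- move=> [|j] t hj ht /=.
    rewrite min0n W0; have [|i hi hit] := @pl_index R n (n%:R * t) n0.
      by case/andP: ht => t0 t1; rewrite mulr_ge0 //= -[X in _ <= X]mulr1 ler_wpM2l.
    rewrite (pl_eval _ hi hit).
    move=> s hs; apply: (good i (ltnW hi)); apply: hexle_conv => //.
      by apply: hexlt_le; exact: hwt.
    apply: hexle_conv => //; [exact: hexle_lat|apply: adj_hexle => //; exact: wadj|].
    by move: hit; rewrite -natr1; clear; lra.
  have jm : (j < m)%N by [].
  rewrite (minn_idPl (ltnW jm)) (minn_idPl jm).
  have [|i hi hit] := @pl_index R n (n%:R * t) n0.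
    by case/andP: ht => t0 t1; rewrite mulr_ge0 //= -[X in _ <= X]mulr1 ler_wpM2l.
  rewrite !(pl_eval _ hi hit).
  have [[_ v1] [_ v2] _ _ /(_ i hi)[s1 s2]] := Ws j jm.
  have hit' : 0 <= n%:R * t - i%:R <= 1 by move: hit; rewrite -natr1; clear; lra.
  move=> s hs; apply: (Wg j i (ltnW jm) (ltnW hi)); apply: hexle_conv => //.
    by apply: hexle_conv => //; [exact: hexle_lat|apply: adj_hexle => //; exact: v1].
  by apply: hexle_conv => //; apply: adj_hexle.
- by move=> t ht /=; rewrite /ct cl01_id.
- move=> t ht /=; rewrite minnn; have [|i hi hit] := @pl_index R n (n%:R * t) n0.
    by case/andP: ht => t0 t1; rewrite mulr_ge0 //= -[X in _ <= X]mulr1 ler_wpM2l.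
  by rewrite (pl_eval _ hi hit) !Wm ?(ltnW hi) // /cst w0 subrr mulr0 addr0.
Qed.

End Hole.

(** * Iterates of an entire function on a hole *)

Lemma homo_ge (phi : nat -> nat) : {homo phi : m n / (m < n)%N} -> forall k, (k <= phi k)%N.
Proof. by move=> h; elim=> // k IH; apply: (leq_ltn_trans IH); exact: h. Qed.

Section UniformCvg.
Context {R : realType}.
Local Notation C := (Cx R).

Lemma uniform_cvgP (W : set C) (u : nat -> C -> C) (g : C -> C) : {uniform W, u @ \oo --> g} <->
  forall e : R, 0 < e -> exists N, forall n, (N <= n)%N -> forall w, W w -> modulus (u n w - g w) < e.
Proof.
split.
- move=> H e e0.
  have [|N _ HN] := H [set h | forall y, W y -> [set p : C * C | modulus (p.2 - p.1) < e] (g y, h y)].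
    apply/uniform_nbhs; exists [set p : C * C | modulus (p.2 - p.1) < e]; split => //.
    rewrite -entourage_ballE; exists (rc e); first by rewrite /= /rc ltcR.
    by move=> [x y]; rewrite /ball /= -normrN opprB norm_mo /rc ltcR.
  by exists N => n hn w Ww; exact: HN.
- move=> H P /uniform_nbhs[E [entE EP]]; move: entE; rewrite -entourage_ballE => -[e /= e0 Ee].
  have [eE er] := pos_rc e0; have [N HN] := H _ er.
  exists N => // n /= hn; apply: EP => y Wy; apply: Ee; rewrite /ball /= -normrN opprB norm_mo eE /rc ltcR.
  exact: HN.
Qed.

End UniformCvg.

Section HolePrinciples.
Context {R : realType}.
Local Notation C := (Cx R).
Implicit Types (z w a x y : C) (e d r rho M T : R) (g : C -> C) (Om K : set C).

Definition fr Om := [set z | closure Om z /\ ~ Om z].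

Lemma fr_compact Om : open Om -> bdd Om -> compact (fr Om).
Proof.
move=> oO bO; apply: (subclosed_compact _ (closed_closureC bO)); last by move=> z [].
rewrite (_ : fr Om = closure Om `&` ~` Om); first by apply: closedI; [exact: closed_closure|exact: open_closedC].
by [].
Qed.

Lemma fr_ne Om : open Om -> bdd Om -> Om !=set0 -> exists z, fr Om z.
Proof.
move=> oO bO [z0 Oz0].
have rec w : closure Om w -> forall e, 0 < e -> exists2 d, 0 < d & forall v, modulus (v - w) < d -> `|re v - re w| < e.
  by move=> _ e e0; exists e => // v; apply: le_lt_trans; rewrite -reB re_le.
have [z cz zmax] := max_attained (ex_intro _ z0 (subset_closure Oz0)) (closed_closureC bO) rec.
exists z; split => // Oz; have [d d0 Hd] := iffLR (open_cx _) oO z Oz.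
have Oz' : Om (z + rc (d / 2)).
  by apply: Hd; rewrite /D /= (_ : z + _ - z = rc (d / 2)) ?mo_rc ?gtr0_norm; [lra|lra|ring].
by have := zmax _ (subset_closure Oz'); rewrite reD re_rc; lra.
Qed.

Lemma compact_ulim W K (u : nat -> C) : UltraFilter W -> compact K -> (forall n, K (u n)) -> exists2 l, K l & ulim W u l.
Proof.
move=> UW cK Ku; have WK : (u @ W) K by apply: (@filterS _ W _ setT); [move=> n _; exact: Ku|exact: filterT].
have [l [Kl cl]] := cK (u @ W) _ WK.
exists l => // e e0; have [//|h] := in_ultra_setVsetC [set n | modulus (u n - l) < e] UW.
have [|w [h1 h2]] := cl (~` D l e) (D l e) h; last by [].
by apply/nbhs_cx; exists e.
Qed.

Lemma compact_ub K (P : C -> nat -> Prop) : compact K -> (forall z k k', (k <= k')%N -> P z k -> P z k') ->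
  (forall z, K z -> exists2 r, 0 < r & exists k, forall w, D z r w -> K w -> P w k) -> exists k, forall z, K z -> P z k.
Proof.
move=> cK mP loc; apply: contrapT => no.
have ex (k : nat) : {z | K z & ~ P z k}.
  by apply: cid2; apply: contrapT => H; apply: no; exists k => z Kz; apply: contrapT => nP; apply: H; exists z.
have [W [UW fW]] := free_ultra.
have [l Kl ul] := compact_ulim UW cK (fun k => s2valP (ex k)).
have [r r0 [k Hk]] := loc l Kl.
have [n [/= n1 n2]] := @filter_ex _ W _ _ (filterI (ul r r0) (free_ge k fW)).
by apply: (s2valP' (ex n)); apply: mP n2 _; apply: Hk => //; exact: s2valP (ex n).
Qed.

Lemma bdd_family (g : nat -> C -> C) K n : compact K -> (forall i z, K z -> ccont (g i) z) ->
  exists2 M, 0 < M & forall i, (i < n)%N -> forall z, K z -> modulus (g i z) <= M.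
Proof.
move=> cK cg; elim: n => [|n [M M0 IH]]; first by exists 1.
have [M' M'0 H'] := ccont_ub cK (cg n).
exists (Num.max M M'); first by rewrite lt_max M0.
move=> i; rewrite ltnS leq_eqVlt => /orP[/eqP ->|hi] z Kz; rewrite le_max; first by rewrite H' ?orbT.
by rewrite IH.
Qed.

Section Entire.
Variable (g : C -> C) (Om : set C).
Hypothesis (gE : forall z, exists l, hder g z l) (oO : open Om) (bO : bdd Om).

Lemma entire_cont z : ccont g z.
Proof. by have [l /hder_cont] := gE z. Qed.

Lemma max_fr M : (forall z, fr Om z -> modulus (g z) <= M) -> forall z, Om z -> modulus (g z) <= M.
Proof.
move=> H z Oz; apply: (max_principle oO bO (g := g)) => //.
- by move=> v _; exact: entire_cont.
- by move=> v h1 h2; apply: H.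
- exact: subset_closure.
Qed.

(** The maximum principle for [1 / (g - w)]. *)
Lemma min_fr T w : 0 < T -> (forall z, fr Om z -> T <= modulus (g z - w)) -> (forall z, Om z -> g z != w) ->
  forall z, Om z -> T <= modulus (g z - w).
Proof.
move=> T0 H nz z Oz.
have nzc v : closure Om v -> g v - w != 0.
  move=> cv; have [Ov|nO] := pselect (Om v); first by rewrite subr_eq0 nz.
  by rewrite -mo_gt0; apply: lt_le_trans (H v _).
have hv v : exists l, hder (fun v => g v - w) v l.
  by have [l hl] := gE v; exists (l - 0); apply: hderB => //; exact: hder_cst.
have mz : 0 < modulus (g z - w) by rewrite mo_gt0 nzc //; exact: subset_closure.
have : modulus ((g z - w)^-1) <= T^-1.
  apply: (max_principle oO bO (g := fun v => (g v - w)^-1)) => //.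
  - by move=> v cv; apply: ccontV; [exact: nzc|have [l /hder_cont] := hv v].
  - move=> v Ov; have [l hl] := hv v; exists (- l / (g v - w) ^+ 2).
    exact: (@hderV R (fun v => g v - w) v l (nzc v (subset_closure Ov)) hl).
  - move=> v cv nO; rewrite moV lef_pV2 ?posrE //; first exact: H.
    by rewrite mo_gt0 nzc.
  - exact: subset_closure.
by rewrite moV lef_pV2 ?posrE.
Qed.

(** Omission spreads: if [v] is omitted on [Om], [min_fr] bounds [|g - v|] below by [T - |v|] there,
    so the disc of that radius around [v] is omitted as well. Short steps along the segment from [w]
    to 0 make 0 omitted, whence [T <= |g x|]. *)
Lemma cover_disc T x : (forall z, fr Om z -> T <= modulus (g z)) -> Om x -> modulus (g x) < T ->
  forall w, modulus w < T -> exists2 y, Om y & g y = w.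
Proof.
move=> H Ox gx w wT; apply: contrapT => no.
pose omit v := forall y, Om y -> g y != v.
have omw : omit w by move=> y Oy; apply/eqP => E; apply: no; exists y.
have step v v' : modulus v < T -> omit v -> modulus (v' - v) < T - modulus v -> omit v'.
  move=> vT ov h y Oy; apply/eqP => E.
  have := @min_fr (T - modulus v) v; rewrite subr_gt0 vT => /(_ isT) M.
  have {}M := M _ ov y Oy; move: M; rewrite E.
  have frv z : fr Om z -> T - modulus v <= modulus (g z - v).
    by move=> /H h'; have := mo_subr (g z) v; lra.
  by move=> /(_ frv); lra.
have T0 : 0 < T by apply: le_lt_trans gx; exact: mo_ge0.
pose n := (Num.bound (modulus w / (T - modulus w))).+1.
have n0 : 0 < n%:R :> R by rewrite ltr0n.
have nw : modulus w / n%:R < T - modulus w.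
  have := archi_boundP (_ : 0 <= modulus w / (T - modulus w)).
  rewrite divr_ge0 ?mo_ge0 ?subr_ge0 ?(ltW wT) // => /(_ isT).
  rewrite !ltr_pdivrMr ?subr_gt0 // => h; apply: (lt_le_trans h).
  by rewrite mulrC ler_pM2l ?subr_gt0 // ler_nat leqnSn.
have chain k : (k <= n)%N -> omit (rc (1 - k%:R / n%:R) * w).
  elim: k => [|k IH] hk; first by rewrite mul0r subr0 rc1 mul1r.
  have kn : 0 <= (1 - k%:R / n%:R : R) <= 1.
    by rewrite subr_ge0 ler_pdivrMr // mul1r ler_nat (ltnW hk) /= lerBlDr lerDl divr_ge0.
  have kw : modulus (rc (1 - k%:R / n%:R) * w) <= modulus w.
    by rewrite moM mo_rc ger0_norm; [rewrite ler_piMl ?mo_ge0 //; case/andP: kn|case/andP: kn].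
  apply: (step (rc (1 - k%:R / n%:R) * w)); [lra|exact: IH (ltnW hk)|].
  rewrite (_ : _ - _ = rc (- n%:R^-1) * w); last by rewrite -mulrBl -rcB -natr1; congr (rc _ * _); field; lra.
  rewrite moM mo_rc normrN gtr0_norm ?invr_gt0 // mulrC; lra.
have := chain n (leqnn n); rewrite divff ?gt_eqF // subrr rc0 mul0r => o0.
have := @min_fr T 0 T0 _ o0 x Ox; rewrite subr0 => M.
by have : T <= modulus (g x); [apply: M => z /H; rewrite subr0|lra].
Qed.

End Entire.
End HolePrinciples.

(** * Boundedness of iterates along the Fatou set *)

Section Fatou.
Context {R : realType}.
Local Notation C := (Cx R).
Implicit Types (z w a x y : C) (e d r rho M T B : R) (Om K V : set C).
Variable f : C -> C.
Hypothesis fE : forall z, exists l, hder f z l.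

Local Notation it n := (iter n f).

Lemma iter_hder n z : exists l, hder (it n) z l.
Proof.
elim: n => [|n [l IH]]; first by exists 1; exact: hder_id.
by have [m hm] := fE (it n z); exists (l * m); exact: (hder_comp IH hm).
Qed.

Lemma iter_cont n z : ccont (it n) z.
Proof. by have [l /hder_cont] := iter_hder n z. Qed.

(** A sequence of iterates bounded at [w] and tending to infinity at [w'] has no subsequence of the
    kinds that normality provides. *)
Lemma fatou_pt z : fatou_set f z -> exists V, [/\ open V, V z &
  forall w w', V w -> V w' -> forall T, exists B, forall n, (0 < n)%N -> modulus (it n w) < T -> modulus (it n w') <= B].
Proof.
move=> [V [oV Vz] nV]; exists V; split => // w w' Vw Vw' T; apply: contrapT => no.
have ex (k : nat) : {n | [/\ (0 < n)%N, modulus (it n w) < T & k%:R < modulus (it n w')]}.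
  apply/cid; apply: contrapT => H; apply: no; exists k%:R => n n0 h; rewrite leNgt; apply/negP => h'.
  by apply: H; exists n.
(* The normal family consists of the iterates of order [n.+1], hence the predecessor. *)
pose m k := (sval (ex k)).-1.
have mS k : (m k).+1 = sval (ex k) by rewrite /m prednK //; have [] := svalP (ex k).
have [k|phi [phi_inc [[g Hg]|Hinf]]] := nV (fun k => iter (m k).+1 f).
- by exists (m k).
- have phi_ge := homo_ge phi_inc.
  have [W W1 /uniform_cvgP/(_ 1 ltr01)[N HN]] := Hg w' Vw'.
  have W' : W w' by exact: nbhs_singleton W1.
  pose k := maxn N (Num.bound (modulus (g w') + 1)).
  have := HN k (leq_maxl _ _) w' W'; rewrite /= -iterS mS; have [_ _] := svalP (ex (phi k)).
  have kb : modulus (g w') + 1 < (phi k)%:R.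
    apply: (lt_le_trans (archi_boundP _)); first by have := mo_ge0 (g w'); lra.
    by rewrite ler_nat (leq_trans _ (phi_ge k)) // leq_maxr.
  have := mo_subr (iter (sval (ex (phi k))) f w') (g w'); lra.
- have [W W1 /(_ T)[N _ HN]] := Hinf w Vw.
  have W' : W w by exact: nbhs_singleton W1.
  by have := HN N (leqnn N) w W'; rewrite /= -iterS mS; have [_ h _] := svalP (ex (phi N)); lra.
Qed.

(** The locally uniform form of the same alternative, needed for the compactness argument in
    [compact_bound]. *)
Lemma fatou_nbhd z T : fatou_set f z -> exists2 r, 0 < r & exists B, forall n, (0 < n)%N ->
  (forall w, modulus (w - z) < r -> modulus (it n w) <= B) \/ (forall w, modulus (w - z) < r -> T <= modulus (it n w)).
Proof.
move=> [V [oV Vz] nV]; apply: contrapT => no.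
have ex (k : nat) : {p : nat * (C * C) | [/\ (0 < p.1)%N, modulus (p.2.1 - z) < k.+1%:R^-1, modulus (p.2.2 - z) < k.+1%:R^-1,
    k%:R < modulus (it p.1 p.2.1) & modulus (it p.1 p.2.2) < T]}.
  apply/cid; apply: contrapT => H; apply: no; exists k.+1%:R^-1; first by rewrite invr_gt0.
  exists k%:R => n n0; apply: contrapT => H2; apply: H.
  have /existsNP[w1 H1] : ~ (forall w, modulus (w - z) < k.+1%:R^-1 -> modulus (it n w) <= k%:R) by move=> h; apply: H2; left.
  have /existsNP[w2 H3] : ~ (forall w, modulus (w - z) < k.+1%:R^-1 -> T <= modulus (it n w)) by move=> h; apply: H2; right.
  move/not_implyP: H1 => [a1 /negP]; rewrite -ltNge => a2.
  move/not_implyP: H3 => [b1 /negP]; rewrite -ltNge => b2.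
  by exists (n, (w1, w2)).
pose m k := (sval (ex k)).1.-1.
have mS k : (m k).+1 = (sval (ex k)).1 by rewrite /m prednK //; have [] := svalP (ex k).
have [k|phi [phi_inc H]] := nV (fun k => iter (m k).+1 f); first by exists (m k).
have phi_ge := homo_ge phi_inc.
have small r : 0 < r -> exists N, forall k, (N <= k)%N -> (phi k).+1%:R^-1 < r :> R.
  move=> r0; have [N HN] := inv_small r0; exists N => k hk; apply: HN; exact: leq_trans (phi_ge k).
case: H => [[g Hg]|Hinf].
- have [W /nbhs_cx[r r0 Wr] /uniform_cvgP/(_ 1 ltr01)[N HN]] := Hg z Vz.
  have [d d0 Hd] := iter_cont (m (phi N)).+1 z ltr01.
  have [N' HN'] := small (Num.min r d) ltac:(by rewrite lt_min r0).
  (* The 3 collects three errors below 1: from the late iterate at [w] to the limit at [w], from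
     there to a fixed iterate at [w], and from [w] to [z] under that iterate. *)
  pose B := modulus (it (m (phi N)).+1 z) + 3.
  pose k := maxn (maxn N N') (Num.bound B).
  have kN : (N <= k)%N by rewrite /k; lia.
  have kN' : (N' <= k)%N by rewrite /k; lia.
  have [_ p1 _ p2 _] := svalP (ex (phi k)); set w := (sval (ex (phi k))).2.1 in p1 p2.
  have := lt_trans p1 (HN' k kN'); rewrite lt_min => /andP[wr wd].
  have h1 := HN N (leqnn N) w (Wr w wr); have h2 := HN k kN w (Wr w wr); have h3 := Hd w wd.
  move: h1 h2; rewrite /= -!iterS !mS; rewrite mS in h3 => h1 h2.
  have kb : B < (phi k)%:R.
    apply: (lt_le_trans (archi_boundP _)); first by rewrite /B; have := mo_ge0 (it (m (phi N)).+1 z); lra.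
    by rewrite ler_nat (leq_trans _ (phi_ge k)) // leq_maxr.
  move: kb p2; rewrite /B mS.
  have := mo_subr (iter (sval (ex (phi k))).1 f w) (g w).
  have := mo_subr (g w) (iter (sval (ex (phi N))).1 f w).
  have := mo_subr (iter (sval (ex (phi N))).1 f w) (iter (sval (ex (phi N))).1 f z).
  rewrite (mo_sym (g w)); move: h1 h2 h3; clear; lra.
- have [W /nbhs_cx[r r0 Wr] /(_ T)[N _ HN]] := Hinf z Vz.
  have [N' HN'] := small r r0.
  pose k := maxn N N'.
  have [_ _ p1 _ p2] := svalP (ex (phi k)); set w := (sval (ex (phi k))).2.2 in p1 p2.
  have := HN k (leq_maxl _ _) w (Wr w (lt_trans p1 (HN' k (leq_maxr _ _)))).
  by rewrite /= -iterS mS; lra.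
Qed.

Variable U : set C.
Hypothesis (oU : open U) (cU : connected U) (UF : U `<=` fatou_set f).

Lemma conn_bound z1 z2 T : U z1 -> U z2 -> exists B, forall n, (0 < n)%N -> modulus (it n z1) < T -> modulus (it n z2) <= B.
Proof.
move=> U1 U2; move: z2 U2 T; apply: conn_ind => //.
  by exists z1 => // T; exists T => n _ /ltW.
move=> z Uz; have [V [oV Vz HV]] := fatou_pt (UF Uz).
have [r1 r10 H1] := iffLR (open_cx _) oV z Vz; have [r2 r20 H2] := iffLR (open_cx _) oU z Uz.
have sub w : D z (Num.min r1 r2) w -> V w /\ U w.
  by rewrite /D /= lt_min => /andP[/H1 ? /H2 ?].
exists (Num.min r1 r2); first by rewrite lt_min r10.
split; first by move=> w /sub[].
move=> [w /sub[Vw _] Pw] w' /sub[Vw' _] T.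
have [B HB] := Pw T; have [B' HB'] := HV w w' Vw Vw' (B + 1).
by exists B' => n n0 /(HB n n0) h; apply: HB' => //; lra.
Qed.

(** Bounds are passed from the given point to a nearby cluster point, along [U] to a second cluster
    point, and from there to the other point. *)
Lemma compact_bound K T : compact K -> K `<=` U -> exists B, forall n, (0 < n)%N ->
  (exists2 z, K z & modulus (it n z) < T) -> forall z, K z -> modulus (it n z) <= B.
Proof.
move=> cK KU; apply: contrapT => no.
have ex (k : nat) : {p : nat * (C * C) | [/\ (0 < p.1)%N, K p.2.1, K p.2.2,
    modulus (it p.1 p.2.1) < T & k%:R < modulus (it p.1 p.2.2)]}.
  apply/cid; apply: contrapT => H; apply: no; exists k%:R => n n0 [z Kz zT] z' Kz'.
  by rewrite leNgt; apply/negP => h; apply: H; exists (n, (z, z')).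
have [W [UW fW]] := free_ultra.
have [z1 K1 u1] := compact_ulim (u := fun k => (sval (ex k)).2.1) UW cK (fun k => let: And5 _ h _ _ _ := svalP (ex k) in h).
have [z2 K2 u2] := compact_ulim (u := fun k => (sval (ex k)).2.2) UW cK (fun k => let: And5 _ _ h _ _ := svalP (ex k) in h).
have [r1 r10 [B1 H1]] := fatou_nbhd T (UF (KU _ K1)).
have [B2 H2] := conn_bound (B1 + 1) (KU _ K1) (KU _ K2).
have [r2 r20 [B3 H3]] := fatou_nbhd (B2 + 1) (UF (KU _ K2)).
pose N := Num.bound (Num.max B3 0).
have [k [/= k1 [k2 k3]]] := @filter_ex _ W _ _ (filterI (u1 _ r10) (filterI (u2 _ r20) (free_ge N fW))).
have [n0 _ _ p1 p2] := svalP (ex k); move: k1 k2 n0 p1 p2; set n := (sval (ex k)).1.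
set w1 := _.2.1; set w2 := _.2.2 => k1 k2 n0 p1 p2.
have a1 : modulus (it n z1) <= B1.
  case: (H1 n n0) => h; first by apply: h; rewrite subrr mo0.
  by have := h w1 k1; lra.
have a2 : modulus (it n z2) <= B2 by apply: H2 => //; lra.
have a3 : modulus (it n w2) <= B3.
  case: (H3 n n0) => h; first exact: h.
  by have := h z2; rewrite subrr mo0 => /(_ r20); lra.
have : B3 < k%:R.
  apply: (@lt_le_trans _ _ N%:R); last by rewrite ler_nat.
  apply: (le_lt_trans _ (archi_boundP _)); by rewrite le_max lexx ?orbT.
lra.
Qed.

End Fatou.

Lemma subseq_ex (P : nat -> Prop) : (forall N, exists2 k, (N <= k)%N & P k) ->
  exists phi : nat -> nat, {homo phi : m n / (m < n)%N} /\ forall k, P (phi k).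
Proof.
move=> H; have ex N : {k | (N <= k)%N & P k} by apply: cid2; exact: H.
pose phi := fix phi k := if k is j.+1 then s2val (ex (phi j).+1) else s2val (ex 0%N).
exists phi; split; first by apply: homo_ltn; [exact: ltn_trans|move=> i /=; exact: (s2valP (ex (phi i).+1))].
by case=> [|k]; [exact: (s2valP' (ex 0%N))|exact: (s2valP' (ex (phi k).+1))].
Qed.

(** * Escape to infinity on the boundary of a hole *)

Section Hole.
Context {R : realType}.
Local Notation C := (Cx R).
Implicit Types (z w a x y : C) (e d r rho M T B : R) (K V : set C).
Variable f : C -> C.
Hypothesis fE : forall z, exists l, hder f z l.

Local Notation it n := (iter n f).

Variable Om : set C.
Hypothesis (oO : open Om) (bO : bdd Om).

(** A bound on [Om] gives convergent subsequences by [montel], so normality reduces to an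
    alternative between bounds. *)
Lemma normal_crit :
  (forall m : nat -> nat, (forall k, (0 < m k)%N) -> exists phi : nat -> nat, {homo phi : i j / (i < j)%N} /\
    ((exists B, forall k z, Om z -> modulus (it (m (phi k)) z) <= B) \/
     (forall T, exists N, forall k, (N <= k)%N -> forall z, Om z -> T <= modulus (it (m (phi k)) z)))) ->
  Om `<=` fatou_set f.
Proof.
move=> H p Op; have [rho rho0 Hr] := iffLR (open_cx _) oO p Op.
have r3 : 0 < rho / 3 by lra.
have sub z : D p (rho / 3) z -> Om z by rewrite /D /= => h; apply: Hr; rewrite /D /=; lra.
have nV z : D p (rho / 3) z -> nbhs z (D p (rho / 3)) by move=> h; apply: open_nbhs_nbhs; split => //; exact: D_open.
exists (D p (rho / 3)); first by split; [exact: D_open|exact: D_center].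
move=> u hu; have ex k : {n | iter n.+1 f = u k} by apply: cid; have [n _ h] := hu k; exists n.
have [k|phi [phi_inc [[B HB]|Hi]]] := H (fun k => (sval (ex k)).+1); first by [].
- have M0 : 0 < Num.max B 1 by rewrite lt_max ltr01 orbT.
  have [|n z hz|phi2 [phi2_inc [G HG]]] := @montel R p rho (Num.max B 1) (fun k => u (phi k)) M0 rho0.
  + move=> n z _; rewrite -(svalP (ex (phi n))); exact: iter_hder.
  + by rewrite le_max -(svalP (ex (phi n))) HB //; apply: Hr.
  exists (phi \o phi2); split; first by move=> i j /phi2_inc /phi_inc.
  left; exists G => z hz; exists (D p (rho / 3)); first exact: nV.
  apply/uniform_cvgP => e e0; have [N HN] := HG e e0; exists N => n hn w hw; exact: HN.
- exists phi; split => //; right => z hz; exists (D p (rho / 3)); first exact: nV.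
  move=> M; have [N HN] := Hi (M + 1); exists N => // n /= hn w hw.
  have := HN n hn w (sub w hw); have := congr1 (fun g => g w) (esym (svalP (ex (phi n)))) => /= ->; rewrite /=; lra.
Qed.

Variable U : set C.
Hypothesis (oU : open U) (cU : connected U) (UF : U `<=` fatou_set f).
(** Expresses that [U] is a whole component of the Fatou set. *)
Hypothesis Umax : forall z r, (exists2 w, D z r w & U w) -> D z r `<=` fatou_set f -> D z r `<=` U.
Hypothesis (frU : fr Om `<=` U) (nOU : ~ Om `<=` U).

(** Otherwise the part of [Om] outside [U] is open with boundary in [U]; but [U] is open and
    disjoint from it. *)
Lemma hole_fatou : ~ Om `<=` fatou_set f.
Proof.
move=> OF; apply: nOU => z0 Oz0; apply: contrapT => nU0.
pose A := [set z | Om z /\ ~ U z].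
have oA : open A.
  apply/open_cx => z [Oz nUz]; have [r r0 Hr] := iffLR (open_cx _) oO z Oz.
  exists r => // w hw; split; first exact: Hr.
  move=> Uw; apply: nUz; apply: (@Umax z r); [by exists w|by move=> v /Hr /OF|exact: D_center].
have [|z [cz nz]] := fr_ne oA _ (ex_intro _ z0 (conj Oz0 nU0)).
  by have [M HM] := bO; exists M => z [/HM].
have Uz : U z.
  have cO : closure Om z by apply: closureS cz => w [].
  by have [Oz|nO] := pselect (Om z); [apply: contrapT => nU; apply: nz|apply: frU].
have [r r0 Hr] := iffLR (open_cx _) oU z Uz.
by have [w [_ nUw] hw] := iffLR (closure_cx _ _) cz r r0; apply: nUw; exact: Hr.
Qed.

Lemma hole_ne : Om !=set0.
Proof. by apply: contrapT => h; apply: nOU => z Oz; exfalso; apply: h; exists z. Qed.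

Lemma not_all_bdd B : ~ forall n z, (0 < n)%N -> Om z -> modulus (it n z) <= B.
Proof.
move=> H; apply: hole_fatou; apply: normal_crit => m m0; exists id; split => //; left.
by exists B => k z; exact: H.
Qed.

(* If minima over the boundary bounded the iterates below on [Om] as well, every sequence of iterates would have a
   subsequence that is bounded on [Om] or tends to infinity there. *)
Lemma not_all_min T0 : ~ forall n T, (0 < n)%N -> T0 <= T -> (forall z, fr Om z -> T <= modulus (it n z)) ->
   forall z, Om z -> T <= modulus (it n z).
Proof.
move=> H; apply: hole_fatou; apply: normal_crit => m m0.
have [[T HT]|no] := pselect (exists T, forall N, exists2 k, (N <= k)%N & exists2 z, fr Om z & modulus (it (m k) z) < T).
- have [phi [phi_inc HP]] := subseq_ex HT; exists phi; split => //; left.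
  have [B HB] := compact_bound fE oU cU UF T (fr_compact oO bO) frU.
  exists B => k; apply: (max_fr _ oO bO); first exact: iter_hder.
  by move=> z fz; apply: HB.
- exists id; split => //; right => T.
  have [N HN] : exists N, forall k, (N <= k)%N -> forall z, fr Om z -> Num.max T T0 <= modulus (it (m k) z).
    apply: contrapT => no2; apply: no; exists (Num.max T T0) => N; apply: contrapT => no3; apply: no2; exists N.
    move=> k hk z fz; rewrite leNgt; apply/negP => h; apply: no3; exists k => //; by exists z.
  exists N => k hk z Oz; apply: (@le_trans _ _ (Num.max T T0)); first by rewrite le_max lexx.
  by apply: H => //; [rewrite le_max lexx orbT|exact: HN].
Qed.

(** Otherwise infinitely many iterates are at most [R0] on [Om]. If some [f^n] maps [Om] over the
    disc of radius [R0 + 1], a later such iterate shows that some [f^p] maps this disc into itself,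
    and all iterates are bounded on [Om]. If none does, large minima over the boundary bound the
    iterates below on [Om]. Both are excluded. *)
Lemma fr_infty T : exists N, forall n, (N <= n)%N -> forall z, fr Om z -> T <= modulus (it n z).
Proof.
apply: contrapT => no.
have [B HB] := compact_bound fE oU cU UF T (fr_compact oO bO) frU.
pose R0 := Num.max B 1.
have R01 : 1 <= R0 by rewrite le_max lexx orbT.
have often N : exists2 n, (N < n)%N & forall z, Om z -> modulus (it n z) <= R0.
  apply: contrapT => H; apply: no; exists N.+1 => n hn z fz; rewrite leNgt; apply/negP => h.
  apply: H; exists n => //; apply: (max_fr _ oO bO); first exact: iter_hder.
  move=> w fw; rewrite le_max HB //; [by apply: leq_trans hn|by exists z].
have [[n cov]|ncov] := pselect (exists n, forall w, modulus w < R0 + 1 -> exists2 y, Om y & it n y = w).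
- have [m nm Hm] := often n; pose p := (m - n)%N; have p0 : (0 < p)%N by rewrite /p; lia.
  have step w : modulus w < R0 + 1 -> modulus (it p w) <= R0.
    by move=> /cov[y Oy <-]; rewrite -iterD /p subnK ?Hm // ltnW.
  have cD : compact (closure (D 0 (R0 + 1) : set C)) by apply: closed_closureC; exact: D_bdd.
  have [M1 M10 HM1] := bdd_family p cD (fun i z _ => iter_cont fE i z).
  have all_bd j w : modulus w < R0 + 1 -> modulus (it j w) <= M1.
    elim/ltn_ind: j w => j IH w hw; have [jp|pj] := ltnP j p.
      by apply: HM1 => //; apply: subset_closure; rewrite /D /= subr0.
    rewrite -(subnK pj) iterD; apply: IH; first by lia.
    have := step w hw; lra.
  have [M2 M20 HM2] := bdd_family m (closed_closureC bO) (fun i z _ => iter_cont fE i z).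
  apply: (@not_all_bdd (Num.max M1 M2)) => j z j0 Oz; rewrite le_max; have [jm|mj] := ltnP j m.
    by rewrite HM2 ?orbT //; exact: subset_closure.
  by rewrite -(subnK mj) iterD all_bd //; have := Hm z Oz; lra.
- apply: (@not_all_min (R0 + 1)) => n T' n0 hT hfr z Oz; rewrite leNgt; apply/negP => h.
  apply: ncov; exists n => w hw; apply: (cover_disc (iter_hder fE n) oO bO hfr Oz h); lra.
Qed.

(** [cover_disc] needs a point of [Om] with a small value. A zero of [f^n] in [Om] provides one for
    the next iterate, namely [f 0], and the disc covered then contains 0 again. If late iterates had
    no zero in [Om], the minimum principle would contradict [not_all_min]. *)
Lemma fr_cover : exists N, forall n, (N <= n)%N -> forall T, (forall z, fr Om z -> T <= modulus (it n z)) ->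
  forall w, modulus w < T -> exists2 y, Om y & it n y = w.
Proof.
have [N HN] := fr_infty (modulus (f 0) + 1).
have fp := mo_ge0 (f 0).
have [[n nN [y Oy y0]]|no] := pselect (exists2 n, (N <= n)%N & exists2 y, Om y & it n y = 0).
- have step k y' : (N <= k)%N -> Om y' -> it k y' = 0 -> forall T, (forall z, fr Om z -> T <= modulus (it k.+1 z)) ->
    forall w, modulus w < T -> exists2 y, Om y & it k.+1 y = w.
    move=> Nk Oy' y'0 T hT w wT.
    have h1 z : fr Om z -> Num.max T (modulus (f 0) + 1) <= modulus (it k.+1 z).
      by move=> fz; rewrite ge_max hT // HN // ltnW.
    apply: (cover_disc (iter_hder fE k.+1) oO bO h1 Oy').
      by rewrite iterS y'0 lt_max; apply/orP; right; lra.
    by rewrite lt_max wT.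
  have ex k : (n <= k)%N -> exists2 y, Om y & it k y = 0.
    elim: k => [|k IH]; first by rewrite leqn0 => /eqP <-; exists y.
    rewrite leq_eqVlt => /orP[/eqP <-|]; first by exists y.
    rewrite ltnS => nk; have [y' Oy' y'0] := IH nk.
    apply: (step k y' (leq_trans nN nk) Oy' y'0 (modulus (f 0) + 1)); last by rewrite mo0; lra.
    by move=> z; apply: HN; rewrite ltnW // ltnS (leq_trans nN nk).
  exists n.+1 => k nk; have [|y' Oy' y'0] := ex k.-1; first by lia.
  have kk : k = k.-1.+1 by lia.
  by rewrite kk; apply: (step _ y') => //; lia.
- have [M M0 HM] := bdd_family N (fr_compact oO bO) (fun i z _ => iter_cont fE i z).
  (* Above [M] the boundary condition cannot hold for the iterates before [N]. *)
  exfalso; apply: (@not_all_min (M + 1)) => n T n0 hT hfr z Oz.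
  have [nN|Nn] := ltnP n N.
    by have [w fw] := fr_ne oO bO hole_ne; have := HM n nN w fw; have := hfr w fw; lra.
  have T0 : 0 < T by lra.
  have := @min_fr R (it n) Om (iter_hder fE n) oO bO T 0 T0.
  rewrite -(subr0 (it n z)); apply => //; first by move=> w fw; rewrite subr0 hfr.
  by move=> y Oy; apply/eqP => h; apply: no; exists n => //; exists y.
Qed.

Lemma comp_infty z T : U z -> exists N, forall n, (N <= n)%N -> T <= modulus (it n z).
Proof.
move=> Uz; have [w fw] := fr_ne oO bO hole_ne.
have [B HB] := conn_bound oU cU UF T Uz (frU fw).
have [N HN] := fr_infty (B + 1); exists N.+1 => n hn; rewrite leNgt; apply/negP => /(HB n (leq_ltn_trans (leq0n _) hn)).
by have := HN n (ltnW hn) w fw; lra.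
Qed.

End Hole.

(** * Covering and growth estimates *)

Section Analytic.
Context {R : realType}.
Local Notation C := (Cx R).
Implicit Types (z w a x y : C) (e d r s rho M T B X : R) (g G H : C -> C).

(** [|g| > 1] makes the real part of the logarithm positive. Here [rho / 4] is the radius of
    [log_branch], [rho / 8] that used in Harnack, and [s <= 1 / 2] turns [2 * s / (1 - s)] into
    [4 * s]. *)
Lemma branch_harnack a rho g : 0 < rho -> hol (D a rho) g -> (forall z, modulus (z - a) < rho -> 1 < modulus (g z)) ->
  exists H, [/\ hol (D a (rho / 4)) H,
    forall z, modulus (z - a) < rho / 4 -> cexp (H z) = g z /\ 0 < re (H z) &
    forall s z, 0 <= s -> s <= 1 / 2 -> modulus (z - a) <= s * (rho / 8) -> modulus (H z - H a) <= 4 * s * re (H a)].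
Proof.
move=> rho0 hg g1; have [z /g1 h|H HH] := log_branch hg.
  by rewrite -mo_gt0; apply: lt_trans h.
have hH : hol (D a (rho / 4)) H by move=> z /HH[h _]; eexists; exact: h.
have Hp z : modulus (z - a) < rho / 4 -> cexp (H z) = g z /\ 0 < re (H z).
  move=> hz; have [_ E] := HH z hz; split => //; rewrite -expR_gt1 -mo_cexp E; apply: g1.
  by have := mo_ge0 (z - a); lra.
exists H; split => // s z s0 s2 hz.
have re0 : 0 < re (H a) by have [|] := Hp a; rewrite ?subrr ?mo0; lra.
have := @harnack R a (rho / 4) (rho / 8) H s z hH (fun z h => (Hp z h).2).
move=> /(_ ltac:(lra) ltac:(lra) s0 ltac:(lra) hz) h.
have m0 := mo_ge0 (H z - H a); move: h re0 s0 s2 m0; clear => h re0 s0 s2 m0.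
have : 1 / 2 * modulus (H z - H a) <= (1 - s) * modulus (H z - H a) by rewrite ler_wpM2r //; lra.
lra.
Qed.

(* Were [x] omitted, Harnack applied to the positive function [ln (2 B / |G - x|)], large at [a], would make [G - x] small near [a]. *)
Lemma cover_small a rho G B e : 0 < rho -> 0 < B -> 0 < e -> hol (D a rho) G ->
  (forall z, modulus (z - a) < rho -> modulus (G z) <= B) -> G a = 0 ->
  (exists2 y, modulus (y - a) <= rho / 64 & e <= modulus (G y)) ->
  forall x, modulus x < B -> modulus x < e / 2 -> modulus x < e ^+ 2 / (8 * B) -> exists2 w, modulus (w - a) < rho & G w = x.
Proof.
move=> rho0 B0 e0 hG GB Ga [y ya ey] x xB xe xe2; apply: contrapT => no.
have aa : modulus (a - a) < rho by rewrite subrr mo0.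
have x0 : 0 < modulus x by rewrite mo_gt0; apply/eqP => x0; apply: no; exists a => //; rewrite Ga.
have nz z : modulus (z - a) < rho -> G z - x != 0.
  by move=> hz; rewrite subr_eq0; apply/eqP => E; apply: no; exists z.
pose g z := rc (2 * B) * (G z - x)^-1.
have hg : hol (D a rho) g.
  move=> z hz; have [l hl] := hG z hz; have h1 := hderB hl (hder_cst x z).
  have h2 := @hderV R (fun z => G z - x) z _ (nz z hz) h1.
  by eexists; exact: hderZ h2.
have mg z : modulus (z - a) < rho -> modulus (g z) = 2 * B / modulus (G z - x).
  by move=> hz; rewrite /g moM moV mo_rc gtr0_norm //; lra.
have g1 z : modulus (z - a) < rho -> 1 < modulus (g z).
  move=> hz; rewrite mg // ltr_pdivlMr ?mo_gt0 ?nz // mul1r.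
  by have := moB (G z) x; have := GB z hz; lra.
have [H [hH HE Hh]] := branch_harnack rho0 hg g1.
have ya' : modulus (y - a) < rho / 4 by lra.
have [Ea Pa] := HE a ltac:(rewrite subrr mo0; lra); have [Ey Py] := HE y ya'.
(* [rho / 64] is one eighth of the Harnack radius: [re H] drops at most by half from [a] to [y], so
   [|g a|] is at most the square of [|g y|]. *)
have := Hh (1 / 8) y ltac:(lra) ltac:(lra) ltac:(lra).
have := re_le (H y - H a); rewrite reB ler_norml => /andP[k1 k2] k3.
have k4 : re (H a) <= re (H y) + re (H y) by lra.
have : modulus (g a) <= modulus (g y) * modulus (g y).
  by rewrite -Ea -Ey !mo_cexp -expRD ler_expR.
rewrite !mg //; last lra.
rewrite Ga sub0r moN; set m := modulus (G y - x) => k5.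
have m0 : 0 < m by rewrite mo_gt0 nz //; lra.
have me : e / 2 < m by rewrite /m; have := mo_subr (G y) x; have := moB (G y) x; move: ey xe; clear; have := mo_tri (G y) x 0; rewrite !subr0; lra.
move: k5; rewrite mulrACA -invfM ler_pdivrMr // [leRHS]mulrAC ler_pdivlMr ?mulr_gt0 //.
move: xe2; rewrite ltr_pdivlMr ?mulr_gt0 // => xe2 k5.
have : 2 * B * (m * m) <= 2 * B * (2 * B * modulus x) by rewrite [X in _ <= X]mulrA.
rewrite ler_pM2l; last by lra.
have : (e / 2) * (e / 2) < m * m by apply: ltr_pM => //; lra.
by rewrite expr2 in xe2; move: xe2; clear; lra.
Qed.

Lemma disc_le g r M : (forall z, exists l, hder g z l) -> 0 < r -> (forall z, modulus z = r -> modulus (g z) <= M) ->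
  forall z, modulus z <= r -> modulus (g z) <= M.
Proof.
move=> gE r0 H z zr; have [zr'|] := ltP (modulus z) r; last by move=> h; apply: H; apply: le_anti; rewrite zr.
apply: (@max_principle R (D 0 r) g M (@D_open R 0 r) (@D_bdd R 0 r)).
- by move=> w _; have [l /hder_cont] := gE w.
- by move=> w _; exact: gE.
- by move=> w /D_closure; rewrite /D /= subr0 => h /negP; rewrite -leNgt => h2; apply: H; apply: le_anti; rewrite h.
- by apply: subset_closure; rewrite /D /= subr0.
Qed.

(** Points of the circle through [cexp a] have logarithms within distance 4 of [a]. Harnack for a
    logarithm of [g \o cexp] at the relative distance [s = 32 / r] costs the factor [1 + 4 * s]. *)
Lemma circle_bound g a r : (forall z, exists l, hder g z l) -> 64 <= r ->
  (forall z, modulus (z - a) < r -> 1 < modulus (g (cexp z))) ->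
  forall w, modulus w <= expR (re a) -> modulus (g w) <= expR ((1 + 128 / r) * ln (modulus (g (cexp a)))).
Proof.
move=> gE r64 g1; have r0 : 0 < r by lra.
apply: disc_le => //; first exact: expR_gt0.
have hg : hol (D a r) (g \o cexp).
  by move=> z _; have [l hl] := gE (cexp z); eexists; exact: hder_comp (hder_cexp z) hl.
have [H [hH HE Hh]] := branch_harnack r0 hg g1 => w hw.
have w0 : w * (cexp a)^-1 != 0.
  by rewrite mulf_neq0 ?invr_neq0 ?cexp_neq0 // -mo_gt0 hw expR_gt0.
have [t [/andP[t1 t2] E]] := cexp_ln w0.
have {}E : w = cexp (a + pt 0 t).
  have e0 : ln (modulus (w * (cexp a)^-1)) = 0 by rewrite moM moV hw mo_cexp divff ?ln1 // gt_eqF ?expR_gt0.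
  by rewrite cexpD -e0 -E mulrCA divff ?cexp_neq0 // mulr1.
have ht : modulus (a + pt 0 t - a) <= 4.
  rewrite addrC addKr (_ : pt 0 t = ii * rc t); last by apply: C_ext; rewrite ?re_pt ?im_pt ?reM ?imM ?re_rc ?im_rc /ii /=; ring.
  rewrite moM mo_ii mul1r mo_rc ler_norml; have := pihalf_lt2 R; lra.
have s1 : 32 / r <= 1 / 2 by rewrite ler_pdivrMr //; lra.
have s2 : 4 <= 32 / r * (r / 8) by rewrite mulrA divfK ?gt_eqF //; lra.
have h := Hh (32 / r) (a + pt 0 t) ltac:(rewrite divr_ge0 //; lra) s1 (le_trans ht s2).
have [Ea Pa] := HE a ltac:(rewrite subrr mo0; lra).
have [Et Pt] := HE (a + pt 0 t) ltac:(lra).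
rewrite E -[g _]Et mo_cexp ler_expR -[g (cexp a)]Ea mo_cexp expRK.
have := re_le (H (a + pt 0 t) - H a); rewrite reB ler_norml => /andP[_ k].
by rewrite mulrDl mul1r (_ : 128 / r = 4 * (32 / r)); [move: k h; clear; lra|field; lra].
Qed.

(** Three circles with the unit circle as the innermost: log M at radius [expR b] lies below the
    chord between the exponents 0 and [a]; [B] absorbs the bound on the unit disc. *)
Lemma hadamard g : (forall z, exists l, hder g z l) -> exists2 B : R, 0 <= B & forall (a b : R) X, 0 < b -> b <= a -> 0 <= X ->
  (forall w, modulus w <= expR a -> modulus (g w) <= expR X) ->
  forall w, modulus w <= expR b -> modulus (g w) <= expR (X * (b / a) + B).
Proof.
move=> gE; have cD : compact (closure (D 0 2 : set C)) by apply: closed_closureC; exact: D_bdd.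
have [|M M0 HM] := ccont_ub cD (g := g); first by move=> w _; have [l /hder_cont] := gE w.
pose B := Num.max (ln M) 0; have B0 : 0 <= B by rewrite le_max lexx orbT.
have g1 w : modulus (w - 0) <= 1 -> modulus (g w) <= expR B.
  rewrite subr0 => hw; apply: (@le_trans _ _ M).
    by apply: HM; apply: subset_closure; rewrite /D /= subr0; lra.
  by rewrite -[leLHS]lnK ?posrE // ler_expR le_max lexx.
exists B => // a b X b0 ba X0 HX w hw.
have a0 : 0 < a by lra.
have [BX|XB] := leP B X; last first.
  apply: (le_trans (HX w _)); first by apply: le_trans hw _; rewrite ler_expR.
  have h : 0 <= X * (b / a) by rewrite mulr_ge0 // divr_ge0 // ltW.
  rewrite ler_expR; lra.
move: ba; rewrite le_eqVlt => /orP[/eqP E|ba].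
  by apply: (le_trans (HX w _)); [rewrite -E|rewrite ler_expR E divff ?gt_eqF // mulr1; lra].
have := @three_circ_in R 0 1 (expR b) (expR a) X B g w ltr01.
rewrite -expR0 ler_expR ltr_expR => /(_ (ltW b0) ba (fun z _ => gE z)) h.
apply: le_trans (h _ _ BX _) _.
- by move=> z; rewrite subr0; exact: HX.
- by move=> z; rewrite expR0; exact: g1.
- by rewrite subr0.
rewrite ler_expR expR0 divr1 expRK ln_div ?posrE ?expR_gt0 // !expRK.
rewrite (_ : (a - b) / a = 1 - b / a); last by field; lra.
have h2 : 0 <= b / a <= 1 by rewrite divr_ge0 ?(ltW b0) ?(ltW a0) //= ler_pdivrMr // mul1r ltW.
have : B * (1 - b / a) <= B by rewrite ler_piMr //; lra.
by rewrite mulrBl; lra.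
Qed.

End Analytic.

(** * Slowly drifting sequences and real parts of holomorphic functions *)

Section Drift.
Context {R : realType}.
Implicit Types (q L u : nat -> R) (K c : R) (N : nat).

(* [u n - 2 K / L n] is nondecreasing. *)
Lemma drift_cvg u L K c N : 0 <= K -> (forall n, (N <= n)%N -> u n <= c) ->
  (forall n, (N <= n)%N -> 0 < L n /\ 2 * L n <= L n.+1) -> (forall T, exists M, forall n, (M <= n)%N -> T <= L n) ->
  (forall n, (N <= n)%N -> u n - K / L n <= u n.+1) -> exists l : R, u n @[n --> \oo] --> l.
Proof.
move=> K0 uc L2 Linf ud.
have KL n : (N <= n)%N -> K / L n.+1 <= K / L n / 2.
  move=> hn; have [L0 h] := L2 n hn; rewrite -mulrA -invfM ler_wpM2l // lef_pV2 ?posrE //; lra.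
have KL0 n : (N <= n)%N -> 0 <= K / L n by move=> hn; have [L0 _] := L2 n hn; rewrite divr_ge0 // ltW.
pose v n := u (n + N)%N - 2 * (K / L (n + N)%N).
have vc : cvgn v.
  apply: nondecreasing_is_cvgn.
    apply/nondecreasing_seqP => n; rewrite /v addSn; have nN := leq_addl n N.
    have := KL _ nN; have := ud _ nN; lra.
  exists c => _ [n _ <-]; have nN := leq_addl n N.
  rewrite /v; have := KL0 _ nN; have := uc _ nN; lra.
exists (limn v + 2 * 0); rewrite -(cvg_shiftn N).
have -> : (fun n => u (n + N)%N) = (fun n => v n + 2 * (K / L (n + N)%N)).
  by apply/funext => n; rewrite /v subrK.
apply: cvgD => //; apply: cvgM; first exact: cvg_cst.
apply/cvgrPdist_lt => e e0.
have [M HM] := Linf (K / e + 1); exists M => // n /= Mn.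
have nN := leq_addl n N; have [L0 _] := L2 _ nN.
rewrite sub0r normrN ger0_norm ?KL0 // ltr_pdivrMr // mulrC -ltr_pdivrMr //.
have := HM (n + N)%N (leq_trans Mn (leq_addr _ _)); lra.
Qed.

(** The truncations of [q] and [1 / q] from below at 1 satisfy the drift condition at every late
    [n], on whichever side of 1 [q n] lies, and [q] is their quotient. *)
Lemma ratio_cvg q L K c N : 0 <= K -> (forall n, (N <= n)%N -> [/\ 0 < q n, q n <= c & (q n)^-1 <= c]) ->
  (forall n, (N <= n)%N -> 0 < L n /\ 2 * L n <= L n.+1) -> (forall T, exists M, forall n, (M <= n)%N -> T <= L n) ->
  (forall n, (N <= n)%N -> 1 <= q n -> q n - K / L n <= q n.+1) ->
  (forall n, (N <= n)%N -> q n <= 1 -> (q n)^-1 - K / L n <= (q n.+1)^-1) -> exists l : R, q n @[n --> \oo] --> l.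
Proof.
move=> K0 qc L2 Linf q1 q2.
have KL0 n : (N <= n)%N -> 0 <= K / L n by move=> hn; have [L0 _] := L2 n hn; rewrite divr_ge0 // ltW.
have [n hn|n hn|a ua] := @drift_cvg (fun n => Num.max (q n) 1) L K (Num.max c 1) N K0 _ L2 Linf.
- by have [_ h _] := qc n hn; rewrite ge_max !le_max h lexx orbT.
- rewrite lerBlDr ge_max; apply/andP; split; last first.
    by apply: (@le_trans _ _ (Num.max (q n.+1) 1)); [rewrite le_max lexx orbT|rewrite lerDl KL0].
  have [h|h] := leP 1 (q n).
    by rewrite -lerBlDr le_max q1.
  apply: (@le_trans _ _ (Num.max (q n.+1) 1)); last by rewrite lerDl KL0.
  by rewrite le_max (ltW h) orbT.
have [n hn|n hn|b vb] := @drift_cvg (fun n => Num.max (q n)^-1 1) L K (Num.max c 1) N K0 _ L2 Linf.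
- by have [_ _ h] := qc n hn; rewrite ge_max !le_max h lexx orbT.
- rewrite lerBlDr ge_max; apply/andP; split; last first.
    by apply: (@le_trans _ _ (Num.max (q n.+1)^-1 1)); [rewrite le_max lexx orbT|rewrite lerDl KL0].
  have [h|h] := leP (q n) 1.
    by rewrite -lerBlDr le_max q2.
  apply: (@le_trans _ _ (Num.max (q n.+1)^-1 1)); last by rewrite lerDl KL0.
  have [q0 _ _] := qc n hn.
  by rewrite le_max invf_le1 ?(ltW h) ?orbT.
have b1 : 1 <= b by apply: cvgr_to_ge vb _; exists 0%N => // n _; rewrite /= le_max lexx orbT.
exists (a * b^-1); apply: (@cvg_trans _ ((fun n => Num.max (q n) 1 * (Num.max (q n)^-1 1)^-1) @ \oo)); last first.
  by apply: cvgM => //; apply: cvgV => //; rewrite gt_eqF //; lra.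
apply: near_eq_cvg; exists N => // n /= hn; have [q0 _ _] := qc n hn.
have [h|h] := leP (q n) 1.
  have i1 : 1 <= (q n)^-1 by rewrite invf_ge1.
  by rewrite mul1r (max_idPl i1) invrK.
by rewrite (_ : Num.max _ 1 = 1) ?divr1 //; apply/max_idPr; rewrite invf_le1 // ltW.
Qed.

End Drift.

Section Harmonic.
Context {R : realType}.
Local Notation C := (Cx R).
Implicit Types (z w v : C) (r : R) (G : C -> C) (h : C -> R) (U : set C).

(** This class is stable under partial derivatives: along [v] the derivative of [re G] is
    [re (dv G * v)]. *)
Definition re_hol U h := forall z, U z -> exists2 r, 0 < r & D z r `<=` U /\
  exists2 G, hol (D z r) G & forall w, D z r w -> h w = re (G w).

Lemma along_der r G z v l h : 0 < r -> hder G z l -> (forall w, D z r w -> h w = re (G w)) -> modulus v = 1 ->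
  is_derive (0 : R) (1 : R) (along v h z) (re (l * v)).
Proof.
move=> r0 hG hE v1; apply/is_deriveP => e e0; have [d d0 Hd] := hG e e0.
exists (Num.min d r); first by rewrite lt_min d0.
move=> k; rewrite lt_min => /andP[kd kr].
have mk : modulus (rc k * v) = `|k| by rewrite moM v1 mulr1 mo_rc.
have := Hd (rc k * v); rewrite mk => /(_ kd); apply: le_trans.
have Ek : along v h z (0 + k) = re (G (z + rc k * v)).
  by rewrite add0r; apply: hE; rewrite /D /= addrAC subrr add0r mk.
have E0 : along v h z 0 = re (G z).
  by rewrite -[in RHS](addr0 z) -(mul0r v); apply: hE; rewrite /D /= mul0r addr0 subrr mo0.
rewrite Ek E0 (_ : _ - _ - _ = re (G (z + rc k * v) - G z - rc k * v * l)); first exact: re_le.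
by rewrite !reB -mulrA (reM (rc k)) re_rc im_rc mul0r subr0 (mulrC v).
Qed.

Lemma partial_re r G z v h w : hol (D z r) G -> (forall w, D z r w -> h w = re (G w)) -> modulus v = 1 -> D z r w ->
  is_derive (0 : R) (1 : R) (along v h w) (partial v h w) /\ partial v h w = re (dv G w * v).
Proof.
move=> hG hE v1 Dw; have [d d0 Hd] := iffLR (open_cx _) (@D_open R z r) w Dw.
have H := along_der d0 (dvP (hG w Dw)) (fun x hx => hE x (Hd x hx)) v1.
have E : partial v h w = re (dv G w * v) by rewrite /partial derive1E (@derive_val _ _ _ _ _ _ _ H).
by rewrite E.
Qed.

Lemma re_hol_partial U h v : re_hol U h -> modulus v = 1 -> re_hol U (partial v h).
Proof.
move=> H v1 z Uz; have [r r0 [rU [G hG hE]]] := H z Uz; exists r => //; split => //.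
exists (fun w => dv G w * v); last by move=> w Dw; have [] := partial_re hG hE v1 Dw.
move=> w Dw; have [l hl] := dv_hol (@D_open R z r) hG Dw.
by eexists; exact: (@hderM R (dv G) (fun=> v) w _ _ hl (hder_cst v w)).
Qed.

Lemma re_hol_C1 U h : re_hol U h -> C1_on U h.
Proof.
move=> H v hv; have v1 : modulus v = 1 by case: hv => ->; [exact: mo1|exact: mo_ii].
split=> [z Uz|z].
  have [r r0 [rU [G hG hE]]] := H z Uz; have [h1 _] := partial_re hG hE v1 (D_center z r0).
  exact: (@ex_derive _ _ _ _ _ _ _ h1).
rewrite inE => Uz; have [r r0 [rU [G hG hE]]] := re_hol_partial H v1 Uz.
apply/contCR => e e0; have [d d0 Hd] := hol_cont hG (D_center z r0) e0.
exists (Num.min d r); first by rewrite lt_min d0.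
move=> w; rewrite lt_min => /andP[wd wr]; rewrite (hE w wr) (hE z (D_center z r0)) -reB.
by apply: le_lt_trans (re_le _) _; exact: Hd.
Qed.

Lemma re_hol_harmonic U h : re_hol U h -> harmonic_on U h.
Proof.
move=> H; have i1 : modulus ('i%C : C) = 1 by exact: mo_ii.
split; first by split; [exact: re_hol_C1|split; apply/re_hol_C1/re_hol_partial => //; exact: mo1].
move=> z Uz; have [r r0 [rU [G hG hE]]] := H z Uz.
have second v : modulus v = 1 -> partial v (partial v h) z = re (dv (dv G) z * v * v).
  move=> v1; have hG' : hol (D z r) (fun w => dv G w * v).
    move=> w Dw; have [l hl] := dv_hol (@D_open R z r) hG Dw.
    by eexists; exact: (@hderM R (dv G) (fun=> v) w _ _ hl (hder_cst v w)).
  have [_ ->] := partial_re hG' (fun w Dw => (partial_re hG hE v1 Dw).2) v1 (D_center z r0).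
  congr (re (_ * v)); apply: dvE.
  have := @hderM R (dv G) (fun=> v) z _ _ (dvP (dv_hol (@D_open R z r) hG (D_center z r0))) (hder_cst v z).
  by rewrite mulr0 ?addr0 ?add0r.
rewrite !second ?mo1 // !mulr1 -mulrA (_ : 'i%C * 'i%C = -1 :> C); last exact: iiK.
by rewrite mulrN1 reN subrr.
Qed.

End Harmonic.

(** * Growth of the iterates along the component *)

Section Rigid.
Context {R : realType}.
Local Notation C := (Cx R).
Implicit Types (z w x : C) (d r k : R) (G : C -> C).

(** Harnack for [G - (k - e)], whose real part is the constant [e], as [e] tends to 0. *)
Lemma re_const w d k G : hol (D w d) G -> (forall x, D w d x -> re (G x) = k) ->
  forall x, modulus (x - w) <= d / 4 -> G x = G w.
Proof.
move=> hG Gk x hx; have [d0|d0] := ltP 0 d; last first.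
  have : modulus (x - w) <= 0 by lra.
  by move=> h; have /eqP : modulus (x - w) = 0 by [apply: le_anti; rewrite mo_ge0 h]; rewrite mo_eq0 subr_eq0 => /eqP ->.
apply/eqP; rewrite -subr_eq0 -mo_eq0; apply/eqP/le_anti; rewrite mo_ge0 andbT.
apply: (@le_eps _ _ 2) => // e e0.
have hH : hol (D w d) (fun x => G x - rc (k - e)).
  by move=> v /hG[l hl]; exists (l - 0); apply: hderB => //; exact: hder_cst.
have Hp v : modulus (v - w) < d -> 0 < re (G v - rc (k - e)).
  by move=> h; rewrite reB re_rc Gk //; lra.
have := @harnack R w d (d / 2) _ (1 / 2) x hH Hp ltac:(lra) ltac:(lra) ltac:(lra) ltac:(lra) ltac:(lra).
rewrite /= reB re_rc (Gk w (D_center w d0)) (_ : G x - _ - (G w - _) = G x - G w); last by ring.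
by move: (modulus _) => m; clear; lra.
Qed.

(** Identity theorem by three circles: [G - G w] vanishes on the inner disc, so its bound [expR B]
    there may be chosen arbitrarily small. *)
Lemma hol_const_ext z r w d G : 0 < d -> hol (D z r) G -> modulus (w - z) < r / 4 ->
  (forall x, modulus (x - w) <= d -> G x = G w) -> forall x, modulus (x - z) < r / 4 -> G x = G w.
Proof.
move=> d0 hG wz Gw x xz; apply/eqP; rewrite -subr_eq0 -mo_eq0; apply/eqP/le_anti; rewrite mo_ge0 andbT.
have r0 : 0 < r by have := mo_ge0 (w - z); lra.
have sub v : modulus (v - w) <= 5 / 8 * r -> D z r v by rewrite /D /= => h; have := mo_tri v w z; lra.
have hF v : modulus (v - w) <= 5 / 8 * r -> exists l, hder (fun v => G v - G w) v l.
  by move=> /sub/hG[l hl]; exists (l - 0); apply: hderB => //; exact: hder_cst.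
have cD : compact (closure (D w (5 / 8 * r))) by apply: closed_closureC; exact: D_bdd.
have [|M M0 HM] := ccont_ub cD (g := fun v => G v - G w).
  by move=> v /D_closure/hF[l /hder_cont].
pose d' := Num.min d (r / 4); have d'0 : 0 < d' by rewrite lt_min d0; lra.
pose M' := M + modulus (G w) * 2 + 1.
have xw : modulus (x - w) <= r / 2 by have := mo_tri x z w; rewrite (mo_sym z w); lra.
have [cb|] := ltP (modulus (G x - G w)) 0; first exact: ltW.
move=> _; apply: (@le_eps _ _ 1) => // e e0; rewrite mulr1.
pose A := ln M.
have bA v : modulus (v - w) <= 5 / 8 * r -> modulus (G v - G w) <= expR A.
  move=> h; rewrite /A lnK ?posrE //; have [h'|h'] := ltP (modulus (v - w)) (5 / 8 * r).
    by apply: HM; apply: subset_closure.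
  apply: HM; apply/closure_cx => e' e'0; pose t := Num.min (1 / 2) (e' / (2 * (r + 1))).
  have t0 : 0 < t by rewrite lt_min; apply/andP; split; [lra|rewrite divr_gt0 //; lra].
  have t1 : t <= 1 / 2 by rewrite ge_min lexx.
  have t2 : t * (2 * (r + 1)) <= e' by rewrite -ler_pdivlMr; [rewrite ge_min lexx orbT|lra].
  exists (w + rc (1 - t) * (v - w)).
    rewrite /D /= addrC addKr moM mo_rc ger0_norm; last lra.
    have -> : modulus (v - w) = 5 / 8 * r by apply: le_anti; rewrite h h'.
    by rewrite gtr_pMl; lra.
  rewrite (_ : _ - v = rc (- t) * (v - w)); last by rewrite rcB rcN rc1; ring.
  rewrite moM mo_rc normrN gtr0_norm //; apply: le_lt_trans (_ : t * r < _).
    by rewrite ler_wpM2l ?(ltW t0) //; lra.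
  by apply: lt_le_trans t2; rewrite ltr_pM2l //; lra.
pose th := ln (5 / 8 * r / (r / 2)) / ln (5 / 8 * r / d').
have d'r : d' <= r / 4 by rewrite ge_min lexx orbT.
have th0 : 0 < th by rewrite divr_gt0 // ln_gt0 // ltr_pdivlMr; lra.
(* Chosen so that interpolation between [A] and [B] with weight [th] is at most [ln e]. *)
pose B := Num.min A (A - (A - ln e) / th).
have := @three_circ_in R w d' (r / 2) (5 / 8 * r) A B (fun v => G v - G w) x d'0 ltac:(lra) ltac:(lra) hF bA.
rewrite -/th => /(_ _ _ xw) h; apply: le_trans (h _ _) _.
- move=> v hv; rewrite Gw ?subrr ?mo0 ?expR_ge0 //; apply: (le_trans hv); by rewrite ge_min lexx.
- by rewrite ge_min lexx.
rewrite -[leRHS]lnK ?posrE // ler_expR.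
have : B <= A - (A - ln e) / th by rewrite ge_min lexx orbT.
move=> h2; have : (A - ln e) / th <= A - B by lra.
by rewrite ler_pdivrMr //; move: (ln e) => le; clear; lra.
Qed.

End Rigid.

Section Dyn.
Context {R : realType}.
Local Notation C := (Cx R).
Implicit Types (z w a x y : C) (e d r s rho M T B : R) (K V : set C) (n k N : nat).
Variable f : C -> C.
Hypothesis (fE : forall z, exists l, hder f z l) (fT : ~ exists p : {poly C}, forall z, f z = p.[z]).
Variable Om : set C.
Hypothesis (oO : open Om) (bO : bdd Om).
Variable U : set C.
Hypothesis (oU : open U) (cU : connected U) (UF : U `<=` fatou_set f).
Hypothesis Umax : forall z r, (exists2 w, D z r w & U w) -> D z r `<=` fatou_set f -> D z r `<=` U.
Hypothesis (frU : fr Om `<=` U) (nOU : ~ Om `<=` U).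

Local Notation it n := (iter n f).
Local Ltac lra' := clear -fE fT oO bO oU cU UF Umax frU nOU; lra.

Definition lg n z := ln (modulus (it n z)).

Lemma lgK n z : 0 < lg n z -> expR (lg n z) = modulus (it n z).
Proof.
move=> h; apply: lnK; rewrite posrE lt_neqAle mo_ge0 andbT; apply/eqP => E.
by move: h; rewrite /lg -E ln0 ?ltxx.
Qed.

Lemma lg_le n z T : lg n z <= T -> modulus (it n z) <= expR T.
Proof.
move=> h; have [m0|m0] := ltP 0 (modulus (it n z)); last exact: le_trans m0 (expR_ge0 _).
by rewrite -[leLHS]lnK ?posrE // ler_expR.
Qed.

(** Escape at [z] and [compact_bound] make [|f^n|] at least 2 on a whole disc, where
    [branch_harnack] applies. *)
Lemma local_log z : U z -> exists2 r, 0 < r & D z r `<=` U /\ exists N, forall n, (N <= n)%N -> exists H : C -> C,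
  [/\ hol (D z r) H, forall w, D z r w -> cexp (H w) = it n w /\ 0 < re (H w) &
   forall s w, 0 <= s -> s <= 1 / 2 -> modulus (w - z) <= s * r -> modulus (H w - H z) <= 4 * s * re (H z)].
Proof.
move=> Uz; have [d d0 Hd] := iffLR (open_cx _) oU z Uz.
have cK : compact (closure (D z (d / 2))) by apply: closed_closureC; exact: D_bdd.
have KU : closure (D z (d / 2)) `<=` U by move=> w /D_closure h; apply: Hd; rewrite /D /=; lra.
have [B HB] := compact_bound fE oU cU UF 2 cK KU.
have [N HN] := comp_infty fE oO bO oU cU UF Umax frU nOU (B + 1) Uz.
have d2 : 0 < d / 2 by lra.
exists (d / 2 / 8); first lra.
split; first by move=> w; rewrite /D /= => h; apply: Hd; rewrite /D /=; lra.
exists N.+1 => n hn; have hg : hol (D z (d / 2)) (it n) by move=> w _; exact: iter_hder.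
have g1 w : modulus (w - z) < d / 2 -> 1 < modulus (it n w).
  move=> hw; apply: (@lt_le_trans _ _ 2); first lra.
  rewrite leNgt; apply/negP => h.
  have cw : closure (D z (d / 2)) w by exact: subset_closure.
  have := HB n (leq_ltn_trans (leq0n _) hn) (ex_intro2 _ _ w cw h) z (subset_closure (D_center z d2)).
  by have := HN n (ltnW hn); lra.
have [H [hH HE Hh]] := branch_harnack d2 hg g1.
have sub w : D z (d / 2 / 8) w -> D z (d / 2 / 4) w by rewrite /D /=; lra.
by exists H; split => [w /sub /hH|w /sub /HE|].
Qed.

Lemma local_equi z e : U z -> 0 < e -> exists2 r, 0 < r & D z r `<=` U /\ exists N, forall n, (N <= n)%N ->
  forall w, D z r w -> 0 < lg n w /\ `|lg n w - lg n z| <= e * lg n z.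
Proof.
move=> Uz e0; have [r r0 [rU [N HN]]] := local_log Uz.
pose s := Num.min (1 / 2) (e / 4); have s0 : 0 < s by rewrite lt_min; lra.
have s1 : s <= 1 / 2 by rewrite ge_min lexx.
have s2 : s <= e / 4 by rewrite ge_min lexx orbT.
have sr : s * r <= r by rewrite ler_piMl //; lra.
exists (s * r); first exact: mulr_gt0.
have sub w : D z (s * r) w -> D z r w by rewrite /D /=; lra.
split; first by move=> w /sub/rU.
exists N => n hn w hw; have [H [hH HE Hh]] := HN n hn.
have lgE v : D z r v -> lg n v = re (H v) by move=> /HE[E _]; rewrite /lg -E mo_cexp expRK.
have [_ p0] := HE w (sub w hw); rewrite (lgE w (sub w hw)) (lgE z (D_center z r0)).
split => //; have [_ q0] := HE z (D_center z r0).
have := Hh s w (ltW s0) s1 (ltW hw); have := re_le (H w - H z); rewrite reB.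
have : 4 * s * re (H z) <= e * re (H z) by rewrite ler_wpM2r //; lra.
by move: `|_| (modulus _) => u v; lra'.
Qed.

Variable z0 : C.
Hypothesis Uz0 : U z0.

Local Ltac lra'' := clear -fE fT oO bO oU cU UF Umax frU nOU Uz0; lra.

(** [k] serves both as comparison constant and as starting index, which makes the property monotone
    in [k] as [compact_ub] requires. *)
Definition comparable_growth z k := forall n, (k <= n)%N -> [/\ 0 < lg n z, lg n z <= k%:R * lg n z0 & lg n z0 <= k%:R * lg n z].

Lemma lg_base_gt0 : exists N, forall n, (N <= n)%N -> 0 < lg n z0.
Proof. by have [r r0 [_ [N HN]]] := local_equi Uz0 ltr01; exists N => n /HN h; have [] := h z0 (D_center z0 r0). Qed.

Lemma lg_base_infty T : exists N, forall n, (N <= n)%N -> T <= lg n z0.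
Proof.
have [N HN] := comp_infty fE oO bO oU cU UF Umax frU nOU (expR T) Uz0.
by exists N => n /HN h; rewrite /lg -[leLHS]expRK ler_ln ?posrE ?expR_gt0 //; apply: lt_le_trans h; exact: expR_gt0.
Qed.

Lemma comparable_growth_mono z k k' : (k <= k')%N -> comparable_growth z k -> comparable_growth z k'.
Proof.
move=> kk h n hn; have [a b c] := h n (leq_trans kk hn).
have kR : k%:R <= k'%:R :> R by rewrite ler_nat.
have L0 : 0 <= lg n z0.
  by rewrite leNgt; apply/negP => L0; have : k%:R * lg n z0 <= 0 by [rewrite mulr_ge0_le0 // ltW]; lra.
split => //; [apply: (le_trans b)|apply: (le_trans c)]; by rewrite ler_wpM2r // ltW.
Qed.

Lemma comparable_growth_near z : U z -> exists2 r, 0 < r & D z r `<=` U /\ exists N, forall w w' k, D z r w -> D z r w' ->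
  comparable_growth w k -> comparable_growth w' (4 * k + N).
Proof.
move=> Uz; have [r r0 [rU [N HN]]] := local_equi Uz (ltac:(lra) : 0 < 1 / 2 :> R).
exists r => //; split => //; exists N => w w' k Dw Dw' h n hn.
have [|w0 w1] := HN n _ w Dw; first by lia.
have [|w'0 w'1] := HN n _ w' Dw'; first by lia.
have [|a b c] := h n _; first by lia.
move: w1 w'1; rewrite !ler_norml natrD natrM => /andP[w1 w2] /andP[w'1 w'2].
have N0 : 0 <= N%:R :> R by [].
have k0 : 0 <= k%:R :> R by [].
have L0 : 0 <= lg n z0.
  by rewrite leNgt; apply/negP => L0; have : k%:R * lg n z0 <= 0 by [rewrite mulr_ge0_le0 // ltW]; lra.
have e1 : 0 <= N%:R * lg n z0 by rewrite mulr_ge0.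
have e2 : 0 <= N%:R * lg n w' by rewrite mulr_ge0 // ltW.
split => //; rewrite mulrDl -mulrA.
  by move: b w1 w2 w'1 w'2 e1; lra''.
have : k%:R * lg n w <= k%:R * (4 * lg n w') by rewrite ler_wpM2l //; move: w1 w2 w'1 w'2; lra''.
by move: c e2; lra''.
Qed.

Lemma comparable_growth_ex z : U z -> exists k, comparable_growth z k.
Proof.
move: z; apply: conn_ind => //.
  have [N HN] := lg_base_gt0; exists z0 => //; exists N.+1 => n hn; have L0 := HN n (ltnW hn).
  by split => //; rewrite ler_peMl ?(ltW L0) // ler1n.
move=> z Uz; have [r r0 [rU [N HN]]] := comparable_growth_near Uz; exists r => //; split => //.
by move=> [w Dw [k hk]] w' Dw'; exists (4 * k + N)%N; exact: HN hk.
Qed.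

Lemma comparable_growth_compact K : compact K -> K `<=` U -> exists k, forall z, K z -> comparable_growth z k.
Proof.
move=> cK KU; apply: compact_ub => //; first exact: comparable_growth_mono.
move=> z /KU Uz; have [r r0 [rU [N HN]]] := comparable_growth_near Uz; exists r => //.
have [k hk] := comparable_growth_ex Uz; exists (4 * k + N)%N => w Dw _; exact: HN (D_center z r0) Dw hk.
Qed.

Lemma hole_growth : exists2 k, (0 < k)%N & forall n, (k <= n)%N -> (forall z, Om z -> modulus (it n z) <= expR (k%:R * lg n z0)) /\
  (forall w, modulus w < expR (lg n z0 / k%:R) -> exists2 y, Om y & it n y = w).
Proof.
have [k Hk] := comparable_growth_compact (fr_compact oO bO) frU.
have [N HN] := fr_cover fE oO bO oU cU UF Umax frU nOU.
have Hk' : forall z, fr Om z -> comparable_growth z (maxn k N).+1.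
  by move=> z /Hk; apply: comparable_growth_mono; lia.
exists (maxn k N).+1 => // n hn; split.
  apply: (max_fr (iter_hder fE n) oO bO) => z /Hk'/(_ n hn)[_ h _]; exact: lg_le.
apply: HN; first by lia.
move=> z /Hk'/(_ n hn)[h1 _ h2]; rewrite -lgK // ler_expR ler_pdivrMr ?ltr0n //; by rewrite mulrC.
Qed.

(** With [v = lg n z0 / k], [f^n] maps [Om] over the circle of radius [expR (v - 1)], where [|f|]
    somewhere exceeds the power [m] of the radius since [f] is no polynomial. But [f^(n+1)] is at
    most [expR (k * lg n.+1 z0)] on [Om], and [m] can be as large as desired. *)
Lemma lg_base_growth A : exists N, forall n, (N <= n)%N -> A * lg n z0 <= lg n.+1 z0.
Proof.
have [k k0 Hk] := hole_growth; have kR : 0 < k%:R :> R by rewrite ltr0n.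
(* The factor 2 pays for replacing [v - 1] by [v / 2]. *)
pose m := Num.bound (2 * k%:R * k%:R * `|A|).
have mA : 2 * k%:R * k%:R * `|A| < m%:R by apply: archi_boundP; rewrite !mulr_ge0.
have [r Hr] : exists r : R, forall s, r < s -> exists2 w, modulus w = s & s ^+ m < modulus (f w).
  apply: contrapT => no; apply: fT; apply: (entire_poly_growth (k := m) fE) => r.
  apply: contrapT => no2; apply: no; exists r => s rs; apply: contrapT => no3; apply: no2; exists s => // w ws.
  by rewrite leNgt; apply/negP => h; apply: no3; exists w.
have [N HN] := lg_base_infty (2 * k%:R * (`|r| + 1)).
exists (maxn N k) => n hn; have nN : (N <= n)%N by lia.
have nk : (k <= n)%N by lia.
have L1 := HN n nN; have r0 := normr_ge0 r; have rr := ler_norm r.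
have Lk : 2 * (`|r| + 1) <= lg n z0 / k%:R by rewrite ler_pdivlMr //; move: L1; lra''.
set v := lg n z0 / k%:R in Lk *.
have [|w ws fw] := Hr (expR (v - 1)); first by have := expR_ge1Dx (v - 1); lra.
have [|y Oy yw] := (Hk n nk).2 w; first by rewrite ws ltr_expR -/v; lra.
have := (Hk n.+1 (leqW nk)).1 y Oy; rewrite iterS yw => h.
have := lt_le_trans fw h; rewrite -expRM_natl ltr_expR => {h}h.
have Lv : lg n z0 = k%:R * v by rewrite /v mulrC divfK // gt_eqF.
rewrite -(ler_pM2l kR); apply: le_trans (ltW h); rewrite Lv.
have v0 : 0 <= v by lra.
have m0 : 0 <= m%:R :> R by [].
apply: (@le_trans _ _ (m%:R * (v / 2))); last by rewrite ler_wpM2l //; lra.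
apply: (@le_trans _ _ (2 * k%:R * k%:R * `|A| * (v / 2))); last by rewrite ler_wpM2r ?(ltW mA) //; lra.
have : k%:R * k%:R * (A * v) <= k%:R * k%:R * (`|A| * v).
  by rewrite ler_wpM2l ?mulr_ge0 ?(ltW kR) // ler_wpM2r // ler_norm.
by move: (`|A|) => B; lra''.
Qed.

(* Around a preimage of 0 under [f^m] in [Om], the iterate [f^(m+1)] takes values already taken by [f^m] on [Om]; there the
   iterates lag one step behind. *)
Lemma small_disc : exists z1 r k, [/\ 0 < r, D z1 r `<=` Om & forall n, (k <= n)%N -> forall w, D z1 r w ->
  modulus (it n.+1 w) <= expR (k%:R * lg n z0)].
Proof.
have [k k0 Hk] := hole_growth; have kR : 0 < k%:R :> R by rewrite ltr0n.
have [N HN] := lg_base_infty (k%:R * modulus (f 0)); have [N' HN'] := lg_base_gt0.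
pose m := maxn N' (maxn N k); have mk : (k <= m)%N by rewrite /m; lia.
have [|z1 Oz1 E1] := (Hk m mk).2 0; first by rewrite mo0 expR_gt0.
have [d d0 Hd] := iter_cont fE m.+1 z1 ltr01.
have [r r0 Hr] := iffLR (open_cx _) oO z1 Oz1.
exists z1, (Num.min d r), m; split; first by rewrite lt_min d0.
  by move=> w; rewrite /D /= lt_min => /andP[_ /Hr].
move=> n hn w; rewrite /D /= lt_min => /andP[/Hd h _].
move: h; rewrite [X in _ - X]iterS E1 => h.
have [|y Oy Ey] := (Hk m mk).2 (it m.+1 w).
  apply: (@lt_le_trans _ _ (1 + modulus (f 0))); first by have := mo_subr (it m.+1 w) (f 0); lra.
  apply: le_trans (expR_ge1Dx _); rewrite lerD2l ler_pdivlMr // mulrC; apply: HN; rewrite /m; lia.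
have E : it n.+1 w = it n y.
  by rewrite -[in RHS](subnK hn) iterD Ey -iterD addnS subnK.
rewrite -iterS E; apply: (le_trans ((Hk n (leq_trans mk hn)).1 y Oy)); rewrite ler_expR ler_wpM2r ?ler_nat //.
by apply/ltW/HN'; move: hn; rewrite /m; lia.
Qed.

(** The ratio [lg n z / lg n z0] tends to [T] along [W], written without division. *)
Definition lim_at (W : set_system nat) z T := forall e, 0 < e -> W [set n | `|lg n z - T * lg n z0| <= e * lg n z0].

Definition bounded_on (W : set_system nat) A T := W [set n | forall w, A w -> modulus (it n w) <= expR (T * lg n z0)].

Definition slow W z := exists2 r : R, 0 < r & exists2 T : R, T < 1 & bounded_on W (D z r) T.

Section Ultra.
Variable W : set_system nat.
Hypothesis (UW : UltraFilter W) (fW : \oo `<=` W).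

Lemma eventually_lg_gt0 : exists2 A, W A & forall n, A n -> 0 < lg n z0.
Proof. by have [N HN] := lg_base_gt0; exists [set n | (N <= n)%N]; [exact: free_ge|exact: HN]. Qed.

Lemma lim_at_z0 : lim_at W z0 1.
Proof.
have [A WA HA] := eventually_lg_gt0; move=> e e0; apply: filterS WA => n /HA h /=.
by rewrite mul1r subrr normr0 mulr_ge0 // ltW.
Qed.

Lemma lim_at_uniq z T T' : lim_at W z T -> lim_at W z T' -> T = T'.
Proof.
move=> h h'; apply/eqP; rewrite -subr_eq0 -normr_eq0; apply/eqP/le_anti; rewrite normr_ge0 andbT.
apply: (@le_eps _ _ 2) => // e e0; have [A WA HA] := eventually_lg_gt0.
have [n [/= a [b /HA c]]] := filter_ex (filterI (h e e0) (filterI (h' e e0) WA)).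
rewrite -(ler_pM2r c) -(gtr0_norm c) -normrM (gtr0_norm c).
rewrite (_ : (T - T') * _ = (lg n z - T' * lg n z0) - (lg n z - T * lg n z0)); last by ring.
apply: (le_trans (ler_normB _ _)); by move: a b; move: `|_| `|_| => u v; lra''.
Qed.

(** Points of [K] where the bound fails would cluster at some [l] in [K]; [local_equi] carries the
    limit 1 at [l] over to them. *)
Lemma lim_at_compact K e : compact K -> K `<=` U -> (forall z, K z -> lim_at W z 1) -> 0 < e -> e <= 1 -> bounded_on W K (1 + e).
Proof.
move=> cK KU K1 e0 e1; have [//|no] := in_ultra_setVsetC [set n | forall w, K w -> modulus (it n w) <= expR ((1 + e) * lg n z0)] UW.
have [[k0 Kk0]|K0] := pselect (K !=set0); last first.
  by apply: (filterS _ no) => n _ w Kw; exfalso; apply: K0; exists w.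
have ex n : {w | K w & (exists2 v, K v & expR ((1 + e) * lg n z0) < modulus (it n v)) -> expR ((1 + e) * lg n z0) < modulus (it n w)}.
  apply: cid2; have [[v Kv hv]|nv] := pselect (exists2 v, K v & expR ((1 + e) * lg n z0) < modulus (it n v)); first by exists v.
  by exists k0.
have [l Kl ul] := compact_ulim UW cK (fun n => s2valP (ex n)).
have e4 : 0 < e / 4 by lra.
have [r r0 [rU [N HN]]] := local_equi (KU l Kl) e4; have [A WA HA] := eventually_lg_gt0.
have [n [/= n1 [n2 [n3 [n4 /HA n5]]]]] := @filter_ex _ W _ _ (filterI no (filterI (ul r r0) (filterI (free_ge N fW) (filterI (K1 l Kl _ e4) WA)))).
exfalso; apply: n1 => w Kw; rewrite leNgt; apply/negP => h.
have := s2valP' (ex n) (ex_intro2 _ _ w Kw h); apply/negP; rewrite -leNgt; apply: lg_le.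
have [_] := HN n n3 (s2val (ex n)) n2; move: n4; rewrite !ler_norml => /andP[_ a] /andP[_ b].
have b' : lg n (s2val (ex n)) <= (1 + e / 4) * lg n l by lra.
apply: (le_trans b'); apply: (@le_trans _ _ ((1 + e / 4) * ((1 + e / 4) * lg n z0))).
  by rewrite ler_wpM2l; lra.
by rewrite mulrA ler_wpM2r ?(ltW n5) //; nra.
Qed.

(** Three circles around [a]: with exponent [T < 1] inside and [1 + e] outside, the exponent on the
    middle disc stays below 1 once [e] is small against [(1 - T) * th]. The slow disc gained around
    [z] has a radius that depends only on [rho]. *)
Lemma slow_spread z rho a : 0 < rho -> (forall e, 0 < e -> e <= 1 -> bounded_on W (D z rho) (1 + e)) ->
  modulus (a - z) < rho / 4 -> slow W a -> slow W z.
Proof.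
move=> rho0 Hb az [r r0 [T T1 WT]].
pose r' := Num.min (r / 2) (rho / 8); have r'0 : 0 < r' by rewrite lt_min; apply/andP; split; lra.
have r'r : r' <= r / 2 by rewrite ge_min lexx.
have r'rho : r' <= rho / 8 by rewrite ge_min lexx orbT.
pose th := ln (rho / 2 / (rho / 3)) / ln (rho / 2 / r').
have th0 : 0 < th by rewrite divr_gt0 // ln_gt0 // ltr_pdivlMr; lra.
have th1 : 0 < (1 - T) * th by rewrite mulr_gt0 //; lra.
pose e := Num.min 1 ((1 - T) * th / 2); have e0 : 0 < e by rewrite lt_min; apply/andP; split; lra.
have e1 : e <= 1 by rewrite ge_min lexx.
have e2 : e <= (1 - T) * th / 2 by rewrite ge_min lexx orbT.
exists (rho / 24); first lra.
exists (1 - (1 - T) * th / 2); first lra.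
have [A WA HA] := eventually_lg_gt0.
apply: filterS (filterI WA (filterI WT (Hb e e0 e1))) => n /= [/HA L0 [h1 h2]] w hw.
have wa : modulus (w - a) <= rho / 3 by move: hw; rewrite /D /=; have := mo_tri w z a; rewrite (mo_sym z a); lra.
apply: (le_trans (@three_circ_in R a r' (rho / 3) (rho / 2) ((1 + e) * lg n z0) (T * lg n z0) (it n) w r'0 _ _ _ _ _ _ wa)).
- lra.
- lra.
- by move=> v _; exact: iter_hder.
- by move=> v hv; apply: h2; rewrite /D /=; have := mo_tri v a z; lra.
- by move=> v hv; apply: h1; rewrite /D /=; lra.
- by rewrite ler_pM2r //; lra.
rewrite -/th ler_expR (_ : _ - _ * th = (1 + e - (1 + e - T) * th) * lg n z0); last by ring.
rewrite ler_pM2r //.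
have : 0 <= e * th by rewrite mulr_ge0 // ltW.
by move: e2; lra''.
Qed.

(** The slow points of [Om] form an open set, nonempty by [small_disc]. By [slow_spread] a boundary
    point of it is slow as well, so it lies outside [Om] and hence in [U], where slowness
    contradicts the limit 1. *)
Lemma ratio_not_const : ~ forall z, U z -> lim_at W z 1.
Proof.
move=> H1.
have near z : closure Om z -> exists2 rho : R, 0 < rho & forall e, 0 < e -> e <= 1 -> bounded_on W (D z rho) (1 + e).
  move=> cz; have [Oz|nO] := pselect (Om z).
    have [rho rho0 Hr] := iffLR (open_cx _) oO z Oz; exists rho => // e e0 e1.
    apply: filterS (lim_at_compact (fr_compact oO bO) frU (fun v fv => H1 v (frU fv)) e0 e1) => n /= h w /Hr Ow.
    by apply: (max_fr (iter_hder fE n) oO bO h).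
  have [d d0 Hd] := iffLR (open_cx _) oU z (frU (conj cz nO)).
  exists (d / 2); first lra.
  move=> e e0 e1; have cK : compact (closure (D z (d / 2))) by apply: closed_closureC; exact: D_bdd.
  have KU : closure (D z (d / 2)) `<=` U by move=> w /D_closure h; apply: Hd; rewrite /D /=; lra.
  apply: filterS (lim_at_compact cK KU (fun v fv => H1 v (KU v fv)) e0 e1) => n /= h w Dw.
  by apply: h; exact: subset_closure.
have slow_open z r T w : bounded_on W (D z r) T -> T < 1 -> D z r w -> slow W w.
  move=> b T1 Dw; have [d d0 Hd] := iffLR (open_cx _) (@D_open R z r) w Dw.
  exists d => //; exists T => //; apply: filterS b => n /= h v /Hd; exact: h.
pose S := [set z | Om z /\ slow W z].
have oS : open S.
  apply/open_cx => z [Oz [r r0 [T T1 b]]]; have [d d0 Hd] := iffLR (open_cx _) oO z Oz.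
  exists (Num.min d r); first by rewrite lt_min d0.
  by move=> w; rewrite /D /= lt_min => /andP[/Hd Ow wr]; split => //; apply: slow_open b T1 _.
have [z1 [r1 [k [r10 sub Hk]]]] := small_disc.
have S1 : S z1.
  split; first exact/sub/D_center.
  exists r1 => //; exists (1 / 2); first lra.
  have [N HN] := lg_base_growth (2 * k%:R).
  apply: filterS (free_ge (maxn k N).+1 fW) => -[//|n] /= hn w Dw.
  have nk : (k <= n)%N by lia.
  have nN : (N <= n)%N by lia.
  apply: (le_trans (Hk n nk w Dw)); rewrite ler_expR; have := HN n nN; lra.
have [|z [cz nz]] := fr_ne oS _ (ex_intro _ z1 S1).
  by have [M HM] := bO; exists M => z [/HM].
have cO : closure Om z by apply: closureS cz => w [].
have [rho rho0 Hb] := near z cO.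
have [a [_ sa] az] := iffLR (closure_cx _ _) cz (rho / 4) ltac:(lra).
have sz := slow_spread rho0 Hb az sa.
have Uz : U z by apply: frU; split => // Oz; apply: nz.
have [r r0 [T T1 b]] := sz; have [A WA HA] := eventually_lg_gt0.
have [d d0 [_ [N' HN']]] := local_equi Uz ltr01.
have e0 : 0 < (1 - T) / 2 by lra.
have [n [/= n1 [n2 [/HA n3 n4]]]] := @filter_ex _ W _ _ (filterI (H1 z Uz _ e0) (filterI b (filterI WA (free_ge N' fW)))).
have [l0 _] := HN' n n4 z (D_center z d0).
have := n2 z (D_center z r0); rewrite -lgK // ler_expR.
move: n1; rewrite mul1r ler_norml => /andP[a1 _] a2.
have : (1 - T) * lg n z0 <= (1 - T) / 2 * lg n z0 by lra.
by rewrite ler_pM2r //; lra.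
Qed.

End Ultra.

Section Ultra2.
Variable W : set_system nat.
Hypothesis (UW : UltraFilter W) (fW : \oo `<=` W).

(* [G] is, up to an additive constant, the limit along [W] of [(H_n - H_n z) / log |f^n z0|], with [H_n] a branch of [log f^n] near [z]. *)
Lemma local_hol z : U z -> exists2 r : R, 0 < r & D z r `<=` U /\ exists2 G, hol (D z r) G &
  forall w, D z r w -> lim_at W w (re (G w)).
Proof.
move=> Uz; have [r r0 [rU [N HN]]] := local_log Uz.
have ex n : {H : C -> C | (N <= n)%N -> [/\ hol (D z r) H, forall w, D z r w -> cexp (H w) = it n w /\ 0 < re (H w) &
   forall s w, 0 <= s -> s <= 1 / 2 -> modulus (w - z) <= s * r -> modulus (H w - H z) <= 4 * s * re (H z)]}.
  by apply: cid; have [hn|] := leqP N n; [have [H h] := HN n hn; exists H|exists id].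
have [k0 hk] := comparable_growth_ex Uz; pose k : R := k0%:R; have [A WA HA] := eventually_lg_gt0 fW.
have lgE n w : (N <= n)%N -> D z r w -> lg n w = re (sval (ex n) w).
  by move=> hn Dw; have [_ /(_ w Dw)[E _] _] := svalP (ex n) hn; rewrite /lg -E mo_cexp expRK.
pose gn n w := rc (lg n z0)^-1 * (sval (ex n) w - sval (ex n) z).
pose A' := [set n | [/\ (N <= n)%N, (k0 <= n)%N & A n]].
have WA' : W A' by apply: filterS (filterI (free_ge N fW) (filterI (free_ge k0 fW) WA)) => n [? []].
have r2 : 0 < r / 2 by lra.
have sub w : D z (r / 2) w -> D z r w by rewrite /D /=; lra.
have k00 : 0 <= k by [].
have gb n w : A' n -> D z (r / 2) w -> modulus (gn n w) <= 2 * k.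
  move=> [nN nk /HA L0] Dw; have [_ _ Hb] := svalP (ex n) nN.
  rewrite /gn moM mo_rc gtr0_norm ?invr_gt0 // mulrC ler_pdivrMr //.
  have := Hb (1 / 2) w ltac:(lra) ltac:(lra) ltac:(move: Dw; rewrite /D /=; lra).
  rewrite -lgE //; last exact: D_center.
  by have [_ b _] := hk n nk; rewrite -/k in b; move: b; move: (lg n z) (lg n z0) (modulus _) => u v m; lra''.
have ex2 w : {l | D z (r / 2) w -> ulim W (fun n => gn n w) l}.
  apply: cid; have [Dw|nD] := pselect (D z (r / 2) w); last by exists 0.
  have [|l hl] := @ulim_ex R W (fun n => gn n w) (2 * k) UW; last by exists l.
  by apply: filterS WA' => n An; exact: gb.
have k1 : 0 < 2 * k + 1 by lra.
have hG : hol (D z (r / 2 / 2)) (fun w => sval (ex2 w)).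
  apply: (@vitali R W z (r / 2) (2 * k + 1) gn _ UW k1).
  - apply: filterS WA' => n An; split; last by move=> w Dw; have := gb n w An Dw; lra.
    move=> w /sub Dw; have [nN _ _] := An; have [hH _ _] := svalP (ex n) nN; have [l hl] := hH w Dw.
    by eexists; apply: hderZ; apply: hderB hl (hder_cst _ _).
  - by move=> w Dw; apply: (svalP (ex2 w)); rewrite /D /=; have := mo_ge0 (w - z); lra.
have [|c hc] := @ulim_ex R W (fun n => rc (lg n z / lg n z0)) k UW.
  apply: filterS WA' => n [nN nk /HA L0] /=; have [a b _] := hk n nk.
  by rewrite mo_rc ger0_norm ?divr_ge0 ?(ltW L0) ?(ltW a) // ler_pdivrMr.
exists (r / 4); first lra.
have sub4 w : D z (r / 4) w -> D z (r / 2) w by rewrite /D /=; have := mo_ge0 (w - z); lra.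
split; first by move=> w /sub4/sub/rU.
exists (fun w => sval (ex2 w) + c).
  move=> w Dw; have [|l hl] := hG w; first by move: Dw; rewrite /D /=; lra.
  by exists (l + 0); apply: hderD => //; exact: hder_cst.
move=> w /sub4 Dw e e0; have e2 : 0 < e / 2 by lra.
apply: filterS (filterI WA' (filterI (svalP (ex2 w) Dw _ e2) (hc _ e2))) => n [[nN nk /HA L0] [/= h1 h2]].
have := re_le (gn n w - sval (ex2 w)); have := re_le (rc (lg n z / lg n z0) - c).
rewrite !reB re_rc reD.
have -> : re (gn n w) = (lg n w - lg n z) / lg n z0.
  by rewrite /gn reM re_rc im_rc mul0r subr0 reB -!lgE ?D_center 1?mulrC //; [exact: D_center|exact: sub].
move=> a b; rewrite -ler_pdivrMr // -(gtr0_norm L0) -normrV ?unitfE ?gt_eqF // -normrM (gtr0_norm L0).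
rewrite (_ : (_ - _) / _ = ((lg n w - lg n z) / lg n z0 - re (sval (ex2 w))) + (lg n z / lg n z0 - re c)); last first.
  by field; rewrite gt_eqF.
by apply: (le_trans (ler_normD _ _)); move: a b h1 h2; move: `|_| `|_| (modulus _) (modulus _) => u v u' v'; lra''.
Qed.

(** Otherwise the ratios near [z] share one limit [k]; by [re_const] and [hol_const_ext] the
    functions of [local_hol] carry this value over all of [U]. At [z0] the limit is 1, so
    [ratio_not_const] applies. *)
Lemma local_nonconst z d : U z -> 0 < d ->
  ~ forall w, D z d w -> U w -> forall e, 0 < e -> W [set n | `|lg n w - lg n z| <= e * lg n z0].
Proof.
move=> Uz d0 H; have [r r0 [rU [G hG HG]]] := local_hol Uz.
pose k := re (G z).
have limz : forall w, U w -> exists2 d : R, 0 < d & forall v, D w d v -> lim_at W v k.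
  apply: conn_ind => //.
    exists z => //; have [d' d'0 Hd'] := iffLR (open_cx _) oU z Uz.
    exists (Num.min d d'); first by rewrite lt_min d0.
    move=> v; rewrite /D /= lt_min => /andP[v1 v2] e e0; have e2 : 0 < e / 2 by lra.
    apply: filterS (filterI (H v v1 (Hd' v v2) _ e2) (HG z (D_center z r0) _ e2)) => n [/= h1 h2].
    rewrite (_ : _ - _ = (lg n v - lg n z) + (lg n z - k * lg n z0)); last by ring.
    by apply: (le_trans (ler_normD _ _)); move: h1 h2; rewrite -/k; move: `|_| `|_| => u v'; lra''.
  move=> w Uw; have [r' r'0 [r'U [G' hG' HG']]] := local_hol Uw.
  have sub v : D w (r' / 4) v -> D w r' v by rewrite /D /=; have := mo_ge0 (v - w); lra.
  exists (r' / 4); first lra.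
  split; first by move=> v /sub/r'U.
  move=> [v Dv [t t0 Ht]] v' Dv'.
  have [t' t'0 Ht'] := iffLR (open_cx _) (@D_open R w r') v (sub v Dv).
  have m0 : 0 < Num.min t t' by rewrite lt_min t0.
  have sub2 x : D v (Num.min t t') x -> D v t x /\ D w r' x by rewrite /D /= lt_min => /andP[? /Ht' ?].
  have hGv : hol (D v (Num.min t t')) G' by move=> x /sub2[_ /hG'].
  have Gk x : D v (Num.min t t') x -> re (G' x) = k.
    by move=> /sub2[/Ht h1 /HG' h2]; apply: (lim_at_uniq UW fW h2 h1).
  have m4 : 0 < Num.min t t' / 4 by lra.
  have cst := hol_const_ext m4 hG' Dv (re_const hGv Gk).
  have [t2 t20 Ht2] := iffLR (open_cx _) (@D_open R w (r' / 4)) v' Dv'.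
  exists t2 => // x /Ht2 Dx; rewrite -(Gk v (D_center v m0)) -(cst x Dx); exact/HG'/sub.
have k1 : 1 = k.
  by have [t t0 Ht] := limz z0 Uz0; apply: (lim_at_uniq UW fW (lim_at_z0 UW fW) (Ht z0 (D_center z0 t0))).
apply: (ratio_not_const UW fW) => w Uw; have [t t0 Ht] := limz w Uw; rewrite k1; exact/Ht/D_center.
Qed.

End Ultra2.

(** If it fails, there are arbitrarily late [n] whose oscillation is below any given multiple of
    [lg n z0]; an ultrafilter finer than this sequence of indices contradicts [local_nonconst]. *)
Lemma oscillation z d : U z -> 0 < d -> D z d `<=` U -> exists2 e : R, 0 < e & exists N, forall n, (N <= n)%N ->
  exists2 y, D z d y & e * lg n z0 <= `|lg n y - lg n z|.
Proof.
move=> Uz d0 dU; apply: contrapT => no.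
have ex (j : nat) : {n | (j <= n)%N & forall y, D z d y -> `|lg n y - lg n z| <= j.+1%:R^-1 * lg n z0}.
  apply: cid2; apply: contrapT => H; apply: no; exists j.+1%:R^-1; first by rewrite invr_gt0.
  exists j => n hn; apply: contrapT => H2; apply: H; exists n => // y Dy.
  by rewrite leNgt; apply/negP => /ltW h; apply: H2; exists y.
pose F : set_system nat := (fun j => s2val (ex j)) @ \oo.
have [W [UW FW]] := @ultraFilterLemma _ F _.
have fW : \oo `<=` W.
  by move=> A [N _ HN]; apply: FW; exists N => // j /= hj; apply: HN; apply: leq_trans hj (s2valP (ex j)).
apply: (local_nonconst UW fW Uz d0) => w Dw _ e e0; apply: FW.
have [N HN] := inv_small e0; have [N' HN'] := lg_base_gt0.
exists (maxn N N') => // j /= hj; apply: (le_trans (s2valP' (ex j) w Dw)).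
rewrite ler_wpM2r //; last by apply/ltW/HN; lia.
by apply/ltW/HN'; apply: leq_trans (s2valP (ex j)); lia.
Qed.

(** [cover_small] for the branch divided by [lg n z0]; [oscillation] provides its large value,
    uniformly in [n]. *)
Lemma log_cover z : U z -> exists2 r : R, 0 < r & D z r `<=` U /\ exists2 al : R, 0 < al & exists N, forall n, (N <= n)%N ->
  exists H : C -> C, (forall w, D z r w -> cexp (H w) = it n w /\ 0 < re (H w)) /\
    forall x, modulus x < al * lg n z0 -> exists2 w, D z r w & H w = H z + x.
Proof.
move=> Uz; have [r r0 [rU [N HN]]] := local_log Uz.
have [k0 hk] := comparable_growth_ex Uz; pose k : R := k0%:R.
have sub d w : d <= r -> D z d w -> D z r w by rewrite /D /=; lra.
(* [cover_small] on the disc of radius [r / 2] wants its large value within distance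
   [r / 2 / 64]. *)
have [||e e0 [N2 HN2]] := @oscillation z (r / 2 / 64) Uz; first lra.
  by move=> w Dw; apply: rU; apply: sub Dw; lra.
have [N3 HN3] := lg_base_gt0.
pose B := 2 * k + 1; have k00 : 0 <= k by [].
have B0 : 0 < B by rewrite /B; lra.
pose al := Num.min B (Num.min (e / 2) (e ^+ 2 / (8 * B))).
have al0 : 0 < al by rewrite !lt_min B0 !divr_gt0 ?exprn_gt0 //; lra.
exists (r / 2); first lra.
split; first by move=> w Dw; apply: rU; apply: sub Dw; lra.
exists al => //; exists (maxn (maxn N N2) (maxn N3 k0)) => n.
rewrite !geq_max => /andP[/andP[nN nN2] /andP[nN3 nk0]].
have [H [hH HE Hb]] := HN n nN.
have L0 : 0 < lg n z0 by exact: HN3.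
have [_ b _] := hk n nk0.
have lgE v : D z r v -> lg n v = re (H v) by move=> /HE[E _]; rewrite /lg -E mo_cexp expRK.
exists H; split; first by move=> w Dw; apply: HE; apply: sub Dw; lra.
move=> x hx; pose G w := rc (lg n z0)^-1 * (H w - H z).
have r2 : 0 < r / 2 by lra.
have hG : hol (D z (r / 2)) G.
  move=> w Dw; have [|l hl] := hH w; first by apply: sub Dw; lra.
  by eexists; apply: hderZ; apply: hderB hl (hder_cst _ _).
have mG w : modulus (G w) = modulus (H w - H z) / lg n z0 by rewrite /G moM mo_rc gtr0_norm ?invr_gt0 // mulrC.
have GB w : modulus (w - z) < r / 2 -> modulus (G w) <= B.
  move=> hw; rewrite mG ler_pdivrMr //; have := Hb (1 / 2) w ltac:(lra) ltac:(lra) ltac:(lra).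
  rewrite -lgE; last exact: D_center.
  by rewrite -/k in b; move: b L0; rewrite /B; move: (lg n z) (lg n z0) (modulus _) => u v m; lra''.
have Gz : G z = 0 by rewrite /G subrr mulr0.
have [y Dy hy] := HN2 n nN2.
have Gy : exists2 y, modulus (y - z) <= r / 2 / 64 & e <= modulus (G y).
  exists y; first exact: ltW.
  rewrite mG ler_pdivlMr //; apply: (le_trans hy); rewrite !lgE ?D_center //; [|exact: D_center|by apply: sub Dy; lra].
  by rewrite -reB; exact: re_le.
pose x' := rc (lg n z0)^-1 * x.
have mx : modulus x' < al by rewrite /x' moM mo_rc gtr0_norm ?invr_gt0 // mulrC ltr_pdivrMr.
move: mx; rewrite !lt_min => /and3P[x1 x2 x3].
have [w Dw Ew] := cover_small r2 B0 e0 hG GB Gz Gy x1 x2 x3.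
exists w => //; move: Ew; rewrite /G /x' => /(mulfI _) h.
have {}h : H w - H z = x by apply: h; rewrite rc_eq0 invr_eq0 gt_eqF.
by rewrite -h addrC subrK.
Qed.

(** Every [v] within [al * lg n z0] of a logarithm of [f^n z] is a logarithm of some [f^n y] with
    [y] near [z], so [f (cexp v) = f^(n+1) y] has modulus above 1; the radius in [circle_bound] is
    thus proportional to [lg n z0]. *)
Lemma circle_max z : U z -> exists k, forall n, (k <= n)%N -> forall w, modulus w <= modulus (it n z) ->
  modulus (f w) <= expR ((1 + k%:R / lg n z0) * lg n.+1 z).
Proof.
move=> Uz; have [r r0 [rU [al al0 [N HN]]]] := log_cover Uz.
have [N1 HN1] := lg_base_infty (64 / al); have [N2 HN2] := lg_base_gt0.
pose k := maxn (maxn N N1) (maxn N2 (Num.bound (128 / al))); exists k => n hn w hw.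
have L0 : 0 < lg n z0 by apply: HN2; move: hn; rewrite /k; lia.
have L64 : 64 <= al * lg n z0 by rewrite mulrC -ler_pdivrMr //; apply: HN1; move: hn; rewrite /k; lia.
have [|H [HE Hc]] := HN n; first by move: hn; rewrite /k; lia.
have [|H' [HE' _]] := HN n.+1; first by move: hn; rewrite /k; lia.
have [Ez pz] := HE z (D_center z r0); have [Ez' pz'] := HE' z (D_center z r0).
have g1 v : modulus (v - H z) < al * lg n z0 -> 1 < modulus (f (cexp v)).
  move=> /Hc[y Dy Ey]; have -> : v = H y by rewrite Ey addrC subrK.
  have [-> _] := HE y Dy; have [E p] := HE' y Dy.
  by rewrite -iterS -E mo_cexp expR_gt1.
have hw' : modulus w <= expR (re (H z)) by rewrite -mo_cexp Ez.
apply: (le_trans (circle_bound fE L64 g1 hw')); rewrite Ez -iterS ler_expR.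
have lz : 0 <= lg n.+1 z by rewrite /lg -Ez' mo_cexp expRK ltW.
rewrite ler_wpM2r // lerD2l -(mulrC (lg n z0)) invfM mulrA [leLHS]mulrAC ler_wpM2r ?invr_ge0 ?(ltW L0) //.
apply: (le_trans (ltW (archi_boundP _))); first by rewrite divr_ge0 // ltW.
by rewrite ler_nat /k !leq_max leqnn !orbT.
Qed.

(** Write [a], [b] for [lg n x], [lg n y] and [a'], [b'] for the next values. Then log M is at most
    [X = (1 + k1 / lg n z0) * a'] at radius [expR a], and [hadamard] gives [b' <= X * (b / a) + B].
    Multiplying by [a / (b * b')] leaves errors of order [1 / lg n z0]. *)
Lemma ratio_drift x y : U x -> U y -> exists k, forall n, (k <= n)%N -> lg n y <= lg n x ->
  lg n x / lg n y - k%:R / lg n z0 <= lg n.+1 x / lg n.+1 y.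
Proof.
move=> Ux Uy; have [B B0 HB] := hadamard fE.
have [k1 Hk1] := circle_max Ux; have [kx Hkx] := comparable_growth_ex Ux; have [ky Hky] := comparable_growth_ex Uy.
have [N1 HN1] := lg_base_growth 1; have [N2 HN2] := lg_base_gt0.
pose K : R := k1%:R * (kx%:R * ky%:R) + B * (kx%:R * ky%:R) * ky%:R.
pose k := maxn (maxn (maxn k1 kx) (maxn ky N1)) (maxn N2 (Num.bound K)); exists k => n hn ba.
move: (hn); rewrite /k !geq_max => /andP[/andP[/andP[k1n nx] /andP[ny nN1]] /andP[nN2 _]].
have L0 : 0 < lg n z0 by exact: HN2.
have LL : lg n z0 <= lg n.+1 z0 by rewrite -[leLHS]mul1r; exact: HN1.
have [a0 a1 _] := Hkx n nx; have [b0 _ b1] := Hky n ny.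
have [a'0 a'1 _] := Hkx n.+1 (leqW nx); have [b'0 _ b'1] := Hky n.+1 (leqW ny).
pose X := (1 + k1%:R / lg n z0) * lg n.+1 x.
have k1L : 0 <= k1%:R / lg n z0 by rewrite divr_ge0 // ltW.
have X0 : 0 <= X by rewrite mulr_ge0 ?(ltW a'0) //; lra.
have HX w : modulus w <= expR (lg n x) -> modulus (f w) <= expR X by rewrite lgK //; exact: Hk1.
have := HB _ _ _ b0 ba X0 HX (it n y); rewrite lgK // lexx -iterS -lgK // ler_expR => /(_ isT).
have kxy (m : nat) : 0 < lg m x -> 0 < lg m y -> lg m x <= kx%:R * lg m z0 -> lg m z0 <= ky%:R * lg m y -> lg m x / lg m y <= kx%:R * ky%:R.
  by move=> p1 p2 h1 h2; rewrite ler_pdivrMr //; apply: (le_trans h1); rewrite -mulrA ler_wpM2l.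
have := kxy n a0 b0 a1 b1; have := kxy n.+1 a'0 b'0 a'1 b'1.
have ib : (lg n.+1 y)^-1 <= ky%:R / lg n z0.
  by rewrite ler_pdivlMr // mulrC ler_pdivrMr // (le_trans LL).
have KL : K / lg n z0 <= k%:R / lg n z0.
  rewrite ler_wpM2r ?invr_ge0 ?(ltW L0) //; apply: (le_trans (ltW (archi_boundP _))).
    by rewrite /K addr_ge0 ?mulr_ge0.
  by rewrite ler_nat /k !leq_max leqnn !orbT.
have q0 : 0 < lg n x / lg n y by rewrite divr_gt0.
have q'0 : 0 < lg n.+1 x / lg n.+1 y by rewrite divr_gt0.
move=> q'P qP h.
have E : lg n x / lg n y <= lg n.+1 x / lg n.+1 y + k1%:R / lg n z0 * (lg n.+1 x / lg n.+1 y) + B * (lg n x / lg n y) * (lg n.+1 y)^-1.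
  have -> : lg n.+1 x / lg n.+1 y + k1%:R / lg n z0 * (lg n.+1 x / lg n.+1 y) + B * (lg n x / lg n y) * (lg n.+1 y)^-1
    = (X * (lg n y / lg n x) + B) * (lg n x / lg n y) / lg n.+1 y.
    by rewrite /X; field; rewrite !gt_eqF.
  by rewrite ler_pdivlMr // mulrC ler_wpM2r // ltW.
have e1 : k1%:R / lg n z0 * (lg n.+1 x / lg n.+1 y) <= k1%:R / lg n z0 * (kx%:R * ky%:R) by rewrite ler_wpM2l.
have e2 : B * (lg n x / lg n y) * (lg n.+1 y)^-1 <= B * (kx%:R * ky%:R) * (ky%:R / lg n z0).
  by apply: ler_pM => //; [rewrite mulr_ge0 // ltW|rewrite invr_ge0 ltW|rewrite ler_wpM2l].
have KE : K / lg n z0 = k1%:R / lg n z0 * (kx%:R * ky%:R) + B * (kx%:R * ky%:R) * (ky%:R / lg n z0).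
  by rewrite /K; field; rewrite gt_eqF.
rewrite lerBlDr; apply: (le_trans E); rewrite -addrA lerD2l; apply: (le_trans (lerD e1 e2)); by rewrite -KE.
Qed.

Lemma ratio_is_cvg z : U z -> exists l : R, (fun n => lg n z / lg n z0) @ \oo --> l.
Proof.
move=> Uz; have [k1 H1] := ratio_drift Uz Uz0; have [k2 H2] := ratio_drift Uz0 Uz.
have [k3 H3] := comparable_growth_ex Uz; have [N1 HN1] := lg_base_growth 2; have [N2 HN2] := lg_base_gt0.
pose N := maxn (maxn (maxn k1 k2) k3) (maxn N1 N2).
have NL n k : (N <= n)%N -> (k <= N)%N -> k%:R / lg n z0 <= N%:R / lg n z0.
  move=> hn kN; rewrite ler_wpM2r ?ler_nat // invr_ge0 ltW // HN2 //; move: hn; rewrite /N; lia.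
apply: (@ratio_cvg R _ (fun n => lg n z0) N%:R k3%:R N _ _ _ lg_base_infty) => //.
- move=> n hn; have [|a b c] := H3 n; first by move: hn; rewrite /N; lia.
  have L0 : 0 < lg n z0 by apply: HN2; move: hn; rewrite /N; lia.
  by split; [rewrite divr_gt0|rewrite ler_pdivrMr|rewrite invf_div ler_pdivrMr].
- by move=> n hn; split; [apply: HN2|apply: HN1]; move: hn; rewrite /N; lia.
- move=> n hn; have L0 : 0 < lg n z0 by apply: HN2; move: hn; rewrite /N; lia.
  rewrite ler_pdivlMr // mul1r => h.
  have := H1 n ltac:(move: hn; rewrite /N; lia) h; have := NL n k1 hn ltac:(rewrite /N; lia).
  by move: (_ / _) (_ / _) (_ / _) (_ / _) => a b c d; lra''.
- move=> n hn; have L0 : 0 < lg n z0 by apply: HN2; move: hn; rewrite /N; lia.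
  rewrite ler_pdivrMr // mul1r !invf_div => h.
  have := H2 n ltac:(move: hn; rewrite /N; lia) h; have := NL n k2 hn ltac:(rewrite /N; lia).
  by move: (_ / _) (_ / _) (_ / _) (_ / _) => a b c d; lra''.
Qed.

Lemma escape_ratio : exists h : C -> R,
  [/\ forall z, U z -> (fun n => lg n z / lg n z0) @ \oo --> h z,
      harmonic_on U h, forall z, U z -> 0 < h z, ~ (exists c : R, forall z, U z -> h z = c) & h z0 = 1].
Proof.
pose h z := lim ((fun n => lg n z / lg n z0) @ \oo).
have hc z : U z -> (fun n => lg n z / lg n z0) @ \oo --> h z.
  by move=> /ratio_is_cvg[l hl]; apply/cvg_ex; exists l.
(* The limit along any free ultrafilter is the same [h], so [local_hol] describes [h] although its
   functions are built from [W]. *)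
have [W [UW fW]] := free_ultra.
have [N HN] := lg_base_gt0.
have hl z : U z -> lim_at W z (h z).
  move=> Uz e e0; apply: fW; have /cvgrPdist_le /(_ e e0)[N' _ HN'] := hc z Uz.
  exists (maxn N N') => // n /= hn; have L0 : 0 < lg n z0 by apply: HN; lia.
  have := HN' n ltac:(rewrite /=; lia); rewrite distrC => h1.
  rewrite -ler_pdivrMr // -(gtr0_norm L0) -normrV ?unitfE ?gt_eqF // -normrM (gtr0_norm L0).
  by rewrite mulrBl mulfK ?gt_eqF.
have h1 : h z0 = 1 by apply: (lim_at_uniq UW fW (hl z0 Uz0) (lim_at_z0 UW fW)).
exists h; split => //.
- apply: re_hol_harmonic => z Uz; have [r r0 [rU [G hG HG]]] := local_hol UW fW Uz.
  exists r => //; split => //; exists G => // w Dw.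
  exact: (lim_at_uniq UW fW (hl w (rU w Dw)) (HG w Dw)).
- move=> z Uz; have [k Hk] := comparable_growth_ex Uz.
  have k0 : 0 < k%:R :> R.
    have [_ p1 _] := Hk (maxn k N) (leq_maxl _ _); have := HN (maxn k N) (leq_maxr _ _).
    have [p0 _ _] := Hk (maxn k N) (leq_maxl _ _); move=> L0.
    by rewrite -(pmulr_lgt0 _ L0); apply: lt_le_trans p1.
  apply: (@lt_le_trans _ _ k%:R^-1); first by rewrite invr_gt0.
  apply: cvgr_to_ge (hc z Uz) _; exists (maxn k N) => // n /= hn.
  have L0 : 0 < lg n z0 by apply: HN; lia.
  have [|_ _ b] := Hk n; first by lia.
  by rewrite ler_pdivlMr // mulrC ler_pdivrMr // mulrC.
- move=> [c hcst]; apply: (ratio_not_const UW fW) => z Uz.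
  by rewrite -h1 (hcst z0 Uz0) -(hcst z Uz); exact: hl.
Qed.

End Dyn.

(** A segment inside the disc is a connected subset of [F]. *)
Lemma component_disc (R : realType) (F : set (Cx R)) (a z : Cx R) (r : R) :
  (exists2 w, D z r w & connected_component F a w) -> D z r `<=` F -> D z r `<=` connected_component F a.
Proof.
move=> [w Dw aw] DF v Dv; rewrite (same_connected_component aw).
pose g (t : R) : Cx R := w + rc t * (v - w).
have gc : continuous g.
  move=> t; apply/contRC => e e0; exists (e / (modulus (v - w) + 1)).
    by rewrite divr_gt0 //; have := mo_ge0 (v - w); lra.
  move=> s; have m0 := mo_ge0 (v - w); rewrite ltr_pdivlMr; last lra.
  rewrite (_ : g s - g t = rc (s - t) * (v - w)); last by rewrite /g rcB; ring.
  rewrite moM mo_rc; apply: le_lt_trans; rewrite ler_wpM2l //; lra.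
have cS : connected (g @` `[0, 1]).
  apply: connected_continuous_connected; first exact: segment_connected.
  exact: continuous_subspaceT.
apply: (@connected_component_max _ F (g @` `[0, 1]) w) => //.
- by exists 0; [rewrite /= in_itv /= lexx ler01|rewrite /g rc0 mul0r addr0].
- by move=> _ [t /= tI <-]; apply: DF; apply: seg_D => //; rewrite in_itv /= in tI.
- by exists 1; [rewrite /= in_itv /= lexx ler01|rewrite /g rc1 mul1r addrC subrK].
Qed.

Theorem theorem1p1 (R : realType) (f : Cx R -> Cx R) (U : set (Cx R))
    (z0 : Cx R)
    (hf : transcendental_entire f)
    (hU : wandering_domain f U)
    (hUm : multiply_connected U)
    (hz0 : U z0) :
  exists h : Cx R -> R,
    [/\ forall z, U z ->
          (fun n : nat => ln (modulus (iter n f z)) /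
                          ln (modulus (iter n f z0))) @ \oo --> h z,
        harmonic_on U h,
        forall z, U z -> 0 < h z,
        ~ (exists c : R, forall z, U z -> h z = c) &
        h z0 = 1].
Proof.
have [fE fT] := hf; have [[a Fa Ea] _] := hU; have [[oU cU _] nsc] := hUm.
have {}fE z : exists l, hder f z l by apply/hder_derivable.
have UF : U `<=` fatou_set f by rewrite Ea; exact: connected_component_sub.
have Umax z r : (exists2 w, D z r w & U w) -> D z r `<=` fatou_set f -> D z r `<=` U.
  by rewrite Ea; exact: component_disc.
have [c [pc c01 nc]] : exists c, [/\ path_in U c, c 0 = c 1 & ~ null_homotopic U c].
  apply: contrapT => no; apply: nsc; split; first exact: connected_path.
  by move=> c pc c01; apply: contrapT => nc; apply: no; exists c.
have [Om [oO bO frU nOU]] := hole_exists oU pc c01 nc.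
have frU' : fr Om `<=` U by move=> z []; exact: frU.
exact: (escape_ratio fE fT oO bO oU cU UF Umax frU' nOU hz0).
Qed.
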